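(* Let $\mathcal{F}$ be a family of complex valued holomorphic functions on a domain $D\subseteq\mathbb{C}$. Let $A$ and $B$ be two disjoint compact subsets of the unit disk $\mathbb{D}=\{z\in\mathbb{C}:|z|<1\}$ not containing the origin, and let $M$ be a positive number. Suppose that for each $f\in\mathcal{F}$ there exist two holomorphic functions $a_1^f$ and $a_2^f$ defined on $D$, having range in $A$ and $B$ respectively, such that the following conditions are satisfied: (i) For $j\in\{1,2\}$ and $z\in D$: $f'(z)=a_j^f(z)$ implies $f(z)=a_j^f(z)$, and $f(z)=a_j^f(z)$ implies $|f'(z)|\le M$. (ii) For $z\in D$: if $f'(z)=1$, then $z$ is a fixed point of $f$, i.e. $f(z)=z$. (iii) For $z\in D$: if $z$ is a fixed point of $f$, i.e. $f(z)=z$, then $|f'(z)|\le M$. Then $\mathcal{F}$ is a normal family in $D$.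
   Context: A family $\mathcal{F}$ of holomorphic functions on $D$ is normal in $D$ if every sequence in $\mathcal{F}$ has a subsequence which converges locally uniformly in $D$ to a holomorphic function, or a subsequence which converges locally uniformly in $D$ to $\infty$. *)

(* Defs.v *)
From Stdlib Require Import Reals List.
From Coquelicot Require Import Coquelicot.

Open Scope R_scope.

Definition C_connected (D : C -> Prop) : Prop :=
  forall U V : C -> Prop,
    open U -> open V ->
    (forall z, D z -> U z \/ V z) ->
    (exists z, D z /\ U z) ->
    (exists z, D z /\ V z) ->
    exists z, D z /\ U z /\ V z.

Definition C_domain (D : C -> Prop) : Prop :=
  open D /\ C_connected D /\ exists z, D z.

Definition C_compact (K : C -> Prop) : Prop :=
  forall (I : Type) (U : I -> C -> Prop),
    (forall i, open (U i)) ->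
    (forall z, K z -> exists i, U i z) ->
    exists l : list I, forall z, K z -> exists i, In i l /\ U i z.

(* A function on [D] is represented by a total function [C -> C] whose values
   off [D] are irrelevant. Meant for open [D]: [ex_derive] is then complex
   differentiability of the restriction to [D]. *)
Definition holomorphic_on (D : C -> Prop) (f : C -> C) : Prop :=
  forall z : C, D z -> ex_derive f z.

Definition loc_unif_cvg (D : C -> Prop) (u : nat -> C -> C) (g : C -> C)
  : Prop :=
  forall z0 : C, D z0 ->
    exists r : R, 0 < r /\
      forall eps : R, 0 < eps ->
        exists N : nat, forall n : nat, (N <= n)%nat ->
          forall z : C, D z -> Cmod (z - z0) < r ->
            Cmod (u n z - g z) < eps.

Definition loc_unif_cvg_infty (D : C -> Prop) (u : nat -> C -> C) : Prop :=
  forall z0 : C, D z0 ->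
    exists r : R, 0 < r /\
      forall K : R,
        exists N : nat, forall n : nat, (N <= n)%nat ->
          forall z : C, D z -> Cmod (z - z0) < r -> K < Cmod (u n z).

Definition normal_family (D : C -> Prop) (F : (C -> C) -> Prop) : Prop :=
  forall u : nat -> C -> C, (forall n, F (u n)) ->
    exists phi : nat -> nat,
      (forall n, (phi n < phi (S n))%nat) /\
      ((exists g : C -> C, holomorphic_on D g /\
          loc_unif_cvg D (fun n => u (phi n)) g) \/
       loc_unif_cvg_infty D (fun n => u (phi n))).

(* Main.v *)
(* If the spherical derivatives of [F] are not bounded near some [z0], Zalcman's
   rescaling gives [g n x = f n (z n + rho n x)], [rho n -> 0], converging locally
   uniformly to a nonconstant entire [G] of bounded spherical derivative, while
   the rescaled targets tend to constants [beta1 <> beta2].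
   - If [G' c = 0], Hurwitz applied to [g' n - rho n a_j] gives points near [c]
     where [f' = a_j], hence [f = a_j]; so [G c = beta1] and [G c = beta2], which
     is absurd. If [G c = beta_j], Hurwitz gives points near [c] where [f = a_j],
     hence [|g' n| <= rho n M], so [G' c = 0]. Thus [G'] has no zeros and [G]
     omits [beta1] and [beta2], say [0] and [1].
   - Bounded spherical derivative makes [E = G'/(G (G - 1))] zero-free of
     exponential type, so [E' = a E]; then [(G - 1)/G = k exp (E/a)] (or
     [k exp (E z)] if [a = 0]), which takes the value [1], a contradiction.
   So the spherical derivatives of [F] are locally bounded, and Marty's theorem
   concludes.
   Zero-free functions are handled throughout by one estimate, [zero_free_deriv]:
   if [0 < |h| <= K] on a disc of radius [R] about [c], then
   [|h'/h| (c) <= (16/R) log (K/|h c|)]. *)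

Require Import Defs.
From Stdlib Require Import Reals Lra Lia List Classical IndefiniteDescription Cantor.
From Coquelicot Require Import Coquelicot.

Open Scope R_scope.

(** * Limits and derivatives of complex functions *)

(** Apart from circles, integrals run along horizontal and vertical segments only, and a disc need
    not contain the rectangle spanned by two of its points. Hence the work on boxes, with a square
    squeezed between two discs; the factors lost there enter the constants 4, 8 and 16 of the
    estimates. The weak form of Picard's theorem rests on one observation: a bounded spherical
    derivative bounds [|G'/G|] by a multiple of [1 + |ln |G||], so [ln (1 + (ln |G|)^2)] grows at
    most linearly along rays and [|G'/G|] at most like [exp (c |z|)]. The same holds for [G - 1],
    and [E = G'/(G - 1) - G'/G]. A zero-free [E] of this growth has a bounded [E'/E], which is
    constant by Liouville. The rescaling is normalised so that the derivative of [g n] at [0] has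
    modulus [1 + |g n 0|^2 >= 1]; this makes [G] nonconstant and excludes the limit infinity. The
    targets take values in the unit disc, so by Cauchy's estimate they are uniformly Lipschitz near
    [z0] and become constant on the scale [rho n]. Their limits lie in the disjoint compact sets [A]
    and [B], hence differ. *)

Definition clim {T : Type} (F : (T -> Prop) -> Prop) (f : T -> C) (l : C) : Prop :=
  forall eps : R, 0 < eps -> F (fun x => Cmod (f x - l) < eps).

Definition ccont {T : UniformSpace} (f : T -> C) (x : T) : Prop :=
  clim (locally x) f (f x).

Lemma Rlt_Rmin (x a b : R) : x < Rmin a b -> x < a /\ x < b.
Proof. intros H. generalize (Rmin_l a b) (Rmin_r a b). lra. Qed.

Lemma lt_div_mult (x a k : R) : 0 < k -> x < a / k -> x * k < a.
Proof.
  intros Hk H. apply (Rmult_lt_compat_r k) in H; auto.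
  replace (a / k * k) with a in H by (field; lra). exact H.
Qed.

Lemma Cinv_neq_0 (z : C) : z <> 0%C -> (/ z)%C <> 0%C.
Proof.
  intros H. apply Cmod_gt_0. rewrite Cmod_inv; auto. apply Rinv_0_lt_compat, Cmod_gt_0; auto.
Qed.

Lemma Cmod_self (z : C) : Cmod (z - z) = 0.
Proof. replace (z - z)%C with (RtoC 0) by ring. apply Cmod_0. Qed.

Lemma Cmod_sub_comm (a b : C) : Cmod (a - b) = Cmod (b - a).
Proof. rewrite <- Cmod_opp. f_equal. ring. Qed.

Lemma Cmod_sub_triangle (b a c : C) : Cmod (a - c) <= Cmod (a - b) + Cmod (b - c).
Proof.
  replace (a - c)%C with ((a - b) + (b - c))%C by ring. apply Cmod_triangle.
Qed.

Lemma Cmod_sub_le (a b : C) : Cmod (a - b) <= Cmod a + Cmod b.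
Proof.
  rewrite <- (Cmod_opp b). apply Cmod_triangle.
Qed.

Lemma Cmod_le_sub (a b : C) : Cmod a <= Cmod (a - b) + Cmod b.
Proof.
  replace a with ((a - b) + b)%C at 1 by ring. apply Cmod_triangle.
Qed.

Lemma im_le_Cmod (c : C) : Rabs (Im c) <= Cmod c.
Proof.
  eapply Rle_trans; [|apply Rmax_Cmod]. apply Rmax_r.
Qed.

Lemma Cmod_le_abs (c : C) : Cmod c <= Rabs (Re c) + Rabs (Im c).
Proof.
  destruct c as [x y]; simpl.
  replace (x, y) with (RtoC x + Ci * RtoC y)%C
    by (unfold Cplus, Cmult, RtoC, Ci; simpl; f_equal; ring).
  eapply Rle_trans; [apply Cmod_triangle|].
  rewrite Cmod_mult, Cmod_Ci, !Cmod_R; lra.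
Qed.

Lemma Cmod_small_eq_0 (z : C) (k : R) : 0 <= k -> (forall e, 0 < e -> Cmod z <= e * k) -> z = 0%C.
Proof.
  intros Hk H. apply Cmod_eq_0, Rle_antisym; [|apply Cmod_ge_0]. apply le_epsilon. intros e He.
  assert (He' : 0 < e / (k + 1)) by (apply Rdiv_lt_0_compat; lra).
  eapply Rle_trans; [apply (H _ He')|]. rewrite Rplus_0_l.
  apply Rle_trans with (e / (k + 1) * (k + 1)); [apply Rmult_le_compat_l; lra|right; field; lra].
Qed.

Lemma Cmod_sub_lt_eq (a b : C) : (forall eps, 0 < eps -> Cmod (a - b) < eps) -> a = b.
Proof.
  intros H. replace a with ((a - b) + b)%C by ring.
  rewrite (Cmod_small_eq_0 (a - b) 1); [ring|lra|]. intros e He. rewrite Rmult_1_r. left; auto.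
Qed.

Lemma Csub_neq_0 (a b : C) : a <> b -> (a - b <> 0)%C.
Proof. intros H E; apply H. replace a with ((a - b) + b)%C by ring. rewrite E; ring. Qed.

(** The balls of the product uniform structure on [C] are squares; this converts them to the discs
    of [Cmod], in which all estimates are made. *)
Lemma locally_Cmod (z : C) (P : C -> Prop) :
  locally z P <-> exists d, 0 < d /\ forall w, Cmod (w - z) < d -> P w.
Proof.
  split.
  - intros [d Hd]. exists d; split; [apply cond_pos|]. intros w Hw. apply Hd.
    apply C_NormedModule_mixin_compat1. exact Hw.
  - intros [d [Hd H]].
    assert (Hd2 : 0 < d / 2) by lra.
    exists (mkposreal _ Hd2). intros w [H1 H2]. apply H.
    eapply Rle_lt_trans; [apply Cmod_le_abs|].
    change (Rabs (fst w - fst z) < d / 2) in H1.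
    change (Rabs (snd w - snd z) < d / 2) in H2.
    unfold Re, Im, Rminus in *; simpl in *. lra.
Qed.

Lemma open_Cmod (D : C -> Prop) :
  open D <-> forall z, D z -> exists d, 0 < d /\ forall w, Cmod (w - z) < d -> D w.
Proof.
  split; intros H z Hz; apply locally_Cmod; auto.
Qed.

Lemma locally_R (t : R) (P : R -> Prop) :
  locally t P <-> exists d, 0 < d /\ forall s, Rabs (s - t) < d -> P s.
Proof.
  split.
  - intros [d Hd]. exists d; split; [apply cond_pos|]. intros w Hw. apply Hd. exact Hw.
  - intros [d [Hd H]]. exists (mkposreal _ Hd). intros w Hw. apply H. exact Hw.
Qed.

Lemma lim_const {T : UniformSpace} (x0 : T) (c : C) :
  clim (locally x0) (fun _ => c) c.
Proof.
  intros eps He. apply filter_forall. intros _. replace (c - c)%C with (RtoC 0) by ring.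
  rewrite Cmod_0; auto.
Qed.

Lemma lim_ext {T : UniformSpace} (x0 : T) (f g : T -> C) (l : C) :
  locally x0 (fun x => f x = g x) -> clim (locally x0) f l -> clim (locally x0) g l.
Proof.
  intros H1 H2 eps He. generalize (filter_and _ _ H1 (H2 eps He)).
  apply filter_imp. intros x [<- h]; auto.
Qed.

Lemma lim_plus {T : UniformSpace} (x0 : T) (f g : T -> C) (l m : C) :
  clim (locally x0) f l -> clim (locally x0) g m -> clim (locally x0) (fun x => f x + g x)%C (l + m)%C.
Proof.
  intros H1 H2 eps He.
  assert (He2 : 0 < eps / 2) by lra.
  generalize (filter_and _ _ (H1 _ He2) (H2 _ He2)).
  apply filter_imp. intros x [h1 h2].
  replace (f x + g x - (l + m))%C with ((f x - l) + (g x - m))%C by ring.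
  eapply Rle_lt_trans; [apply Cmod_triangle|lra].
Qed.

Lemma lim_mult {T : UniformSpace} (x0 : T) (f g : T -> C) (l m : C) :
  clim (locally x0) f l -> clim (locally x0) g m -> clim (locally x0) (fun x => f x * g x)%C (l * m)%C.
Proof.
  intros H1 H2 eps He.
  set (K := Cmod l + Cmod m + 1).
  generalize (Cmod_ge_0 l) (Cmod_ge_0 m); intros hl hm.
  assert (HK : 0 < K) by (unfold K; lra).
  set (e := Rmin 1 (eps / (2 * K))).
  assert (Hek : 0 < eps / (2 * K)) by (apply Rdiv_lt_0_compat; lra).
  assert (He2 : 0 < e) by (apply Rmin_glb_lt; lra).
  assert (He1 : e <= 1) by apply Rmin_l.
  assert (He3 : e * (2 * K) <= eps).
  { apply Rle_trans with (eps / (2 * K) * (2 * K)).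
    apply Rmult_le_compat_r; [lra|apply Rmin_r]. right; field; lra. }
  generalize (filter_and _ _ (H1 _ He2) (H2 _ He2)).
  apply filter_imp. intros x [h1 h2].
  replace (f x * g x - l * m)%C
    with ((f x - l) * (g x - m) + (f x - l) * m + l * (g x - m))%C by ring.
  eapply Rle_lt_trans; [apply Cmod_triangle|].
  eapply Rle_lt_trans; [apply Rplus_le_compat_r, Cmod_triangle|].
  rewrite !Cmod_mult.
  set (a := Cmod (f x - l)) in *. set (b := Cmod (g x - m)) in *.
  assert (0 <= a) by apply Cmod_ge_0. assert (0 <= b) by apply Cmod_ge_0.
  unfold K in *. clearbody a b e. nra.
Qed.

Lemma lim_inv {T : UniformSpace} (x0 : T) (f : T -> C) (l : C) :
  clim (locally x0) f l -> l <> 0%C -> clim (locally x0) (fun x => / f x)%C (/ l)%C.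
Proof.
  intros H1 Hl eps He.
  assert (h : 0 < Cmod l) by (apply Cmod_gt_0; auto).
  set (K := Cmod l) in *.
  assert (Hq : 0 < eps * (K * K) / 2) by (apply Rdiv_lt_0_compat; [|lra]; repeat apply Rmult_lt_0_compat; lra).
  set (e := Rmin (K / 2) (eps * (K * K) / 2)).
  assert (He2 : 0 < e) by (apply Rmin_glb_lt; lra).
  assert (He1 : e <= K / 2) by apply Rmin_l.
  assert (He3 : e <= eps * (K * K) / 2) by apply Rmin_r.
  generalize (H1 _ He2). apply filter_imp. intros x hx.
  assert (h2 : K / 2 < Cmod (f x)).
  { generalize (Cmod_le_sub l (f x)). rewrite Cmod_sub_comm. fold K. lra. }
  assert (Hf : f x <> 0%C) by (apply Cmod_gt_0; lra).
  replace (/ f x - / l)%C with ((l - f x) / (f x * l))%C by (field; auto).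
  rewrite Cmod_div by (apply Cmult_neq_0; auto).
  rewrite Cmod_mult, Cmod_sub_comm. fold K.
  apply (Rmult_lt_reg_r (Cmod (f x) * K)); [nra|].
  unfold Rdiv. rewrite Rmult_assoc, Rinv_l by nra. nra.
Qed.

Lemma lim_opp {T : UniformSpace} (x0 : T) (f : T -> C) (l : C) :
  clim (locally x0) f l -> clim (locally x0) (fun x => - f x)%C (- l)%C.
Proof.
  intros H eps He. generalize (H eps He). apply filter_imp. intros x Hx.
  rewrite <- Cmod_opp. replace (- (- f x - - l))%C with (f x - l)%C by ring. auto.
Qed.

Lemma clim_comp {T U : Type} (F : (T -> Prop) -> Prop) (G : (U -> Prop) -> Prop)
  (g : T -> U) (f : U -> C) (l : C) :
  filterlim g F G -> clim G f l -> clim F (fun x => f (g x)) l.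
Proof. intros H1 H2 eps He. exact (H1 _ (H2 eps He)). Qed.

Lemma clim_filterlim {T : Type} (F : (T -> Prop) -> Prop) {FF : Filter F} (f : T -> C) (l : C) :
  clim F f l <-> filterlim f F (locally l).
Proof.
  split.
  - intros H P HP. apply locally_Cmod in HP. destruct HP as [d [Hd HP]].
    generalize (H d Hd). unfold filtermap; apply filter_imp. auto.
  - intros H eps He. refine (H (fun w => Cmod (w - l) < eps) _). apply locally_Cmod. exists eps; auto.
Qed.

(** [gder e f x l]: the increments of [f] at [x] relative to those of the
    parameter [e] tend to [l] (Caratheodory's form); [e] is the identity of [C]
    or the injection of [R] in [C]. *)
Definition gder {T : UniformSpace} (e : T -> C) (f : T -> C) (x : T) (l : C) : Prop :=
  exists phi : T -> C,
    locally x (fun y => f y - f x = phi y * (e y - e x))%C /\ clim (locally x) phi l.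

Definition cderiv : (C -> C) -> C -> C -> Prop := gder (T := C_UniformSpace) (fun z => z).
Definition rderiv : (R -> C) -> R -> C -> Prop := gder (T := R_UniformSpace) RtoC.

Lemma gder_const {T : UniformSpace} (e : T -> C) (c : C) (x : T) : gder e (fun _ => c) x 0%C.
Proof.
  exists (fun _ => 0%C); split; [|apply lim_const; apply locally_filter].
  apply filter_forall. intros; ring.
Qed.

Lemma gder_param {T : UniformSpace} (e : T -> C) (x : T) : gder e e x 1%C.
Proof.
  exists (fun _ => 1%C); split; [|apply lim_const; apply locally_filter].
  apply filter_forall. intros; ring.
Qed.

Lemma gder_plus {T : UniformSpace} (e f g : T -> C) (x : T) (l m : C) :
  gder e f x l -> gder e g x m -> gder e (fun y => f y + g y)%C x (l + m)%C.
Proof.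
  intros [p [H1 H2]] [q [H3 H4]]. exists (fun y => p y + q y)%C; split.
  - generalize (filter_and _ _ H1 H3). apply filter_imp. intros y [h1 h2].
    replace (f y + g y - (f x + g x))%C with ((f y - f x) + (g y - g x))%C by ring.
    rewrite h1, h2; ring.
  - apply lim_plus; auto.
Qed.

Lemma gder_cont {T : UniformSpace} (e f : T -> C) (x : T) (l : C) :
  ccont e x -> gder e f x l -> ccont f x.
Proof.
  intros He [p [H1 H2]].
  apply lim_ext with (fun y => f x + p y * (e y + - e x))%C.
  - revert H1; apply filter_imp. intros y h.
    replace (f y) with (f x + (f y - f x))%C by ring. rewrite h; ring.
  - replace (f x) with (f x + l * (e x + - e x))%C at 1 by ring.
    apply lim_plus; auto; [apply lim_const; auto|]. apply lim_mult; auto.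
    apply lim_plus; auto. apply lim_const; auto.
Qed.

Lemma gder_mult {T : UniformSpace} (e f g : T -> C) (x : T) (l m : C) :
  ccont e x -> gder e f x l -> gder e g x m ->
  gder e (fun y => f y * g y)%C x (l * g x + f x * m)%C.
Proof.
  intros He Hf Hg. assert (Cg := gder_cont _ _ _ _ He Hg).
  destruct Hf as [p [H1 H2]], Hg as [q [H3 H4]].
  exists (fun y => p y * g y + f x * q y)%C; split.
  - generalize (filter_and _ _ H1 H3). apply filter_imp. intros y [h1 h2].
    replace (f y * g y - f x * g x)%C with ((f y - f x) * g y + f x * (g y - g x))%C by ring.
    rewrite h1, h2; ring.
  - apply lim_plus; auto; apply lim_mult; auto.
    apply lim_const; auto.
Qed.

Lemma ccont_nonzero {T : UniformSpace} (f : T -> C) (x : T) :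
  ccont f x -> f x <> 0%C -> locally x (fun y => f y <> 0%C).
Proof.
  intros Hf H0. assert (h : 0 < Cmod (f x)) by (apply Cmod_gt_0; auto).
  generalize (Hf _ h); apply filter_imp. intros y hy E. rewrite E in hy.
  replace (0 - f x)%C with (- f x)%C in hy by ring. rewrite Cmod_opp in hy; lra.
Qed.

Lemma gder_inv {T : UniformSpace} (e f : T -> C) (x : T) (l : C) :
  ccont e x -> gder e f x l -> f x <> 0%C -> gder e (fun y => / f y)%C x (- l / (f x * f x))%C.
Proof.
  intros He Hf H0. assert (Cf := gder_cont _ _ _ _ He Hf).
  assert (N := ccont_nonzero _ _ Cf H0).
  destruct Hf as [p [H1 H2]].
  exists (fun y => - 1 * p y * / (f y * f x))%C; split.
  - generalize (filter_and _ _ H1 N). apply filter_imp. intros y [h1 h2].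
    replace (/ f y - / f x)%C with (- (f y - f x) * / (f y * f x))%C by (field; auto).
    rewrite h1; ring.
  - assert (FF := locally_filter x).
    replace (- l / (f x * f x))%C with (- 1 * l * / (f x * f x))%C by (field; auto).
    apply lim_mult; auto. apply lim_mult; auto. apply lim_const; auto.
    apply lim_inv; auto. apply lim_mult; auto. apply lim_const; auto.
    apply Cmult_neq_0; auto.
Qed.

Lemma gder_eq {T : UniformSpace} (e f : T -> C) (x : T) (l m : C) :
  gder e f x l -> l = m -> gder e f x m.
Proof. intros H <-; auto. Qed.

Lemma gder_loc {T : UniformSpace} (e f g : T -> C) (x : T) (l : C) :
  locally x (fun y => f y = g y) -> gder e f x l -> gder e g x l.
Proof.
  intros H [p [H1 H2]]. exists p; split; auto.
  generalize (filter_and _ _ H H1). apply filter_imp. intros y [<- h1].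
  rewrite <- (locally_singleton _ _ H). auto.
Qed.

Lemma gder_ext {T : UniformSpace} (e f g : T -> C) (x : T) (l : C) :
  (forall y, f y = g y) -> gder e f x l -> gder e g x l.
Proof. intros H. apply gder_loc. apply filter_forall; auto. Qed.

(** The Caratheodory factors simply multiply, as [p (g y) * q y], so no case distinction on
    [g y = g x] arises. *)
Lemma gder_chain {T : UniformSpace} (e g : T -> C) (f : C -> C) (x : T) (l m : C) :
  ccont e x -> gder e g x m -> cderiv f (g x) l ->
  gder e (fun y => f (g y)) x (l * m)%C.
Proof.
  intros He Hg Hf. assert (Cg := gder_cont _ _ _ _ He Hg).
  assert (Fg := proj1 (clim_filterlim (FF := filter_filter) _ _ _) Cg).
  destruct Hg as [q [H3 H4]], Hf as [p [H1 H2]].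
  exists (fun y => p (g y) * q y)%C; split.
  - assert (Fg1 : locally x (fun y => f (g y) - f (g x) = p (g y) * (g y - g x))%C) by exact (Fg _ H1).
    generalize (filter_and _ _ Fg1 H3). apply filter_imp. intros y [h1 h2].
    rewrite h1, h2; ring.
  - apply lim_mult; auto. eapply clim_comp; eauto.
Qed.

Lemma ccont_id (z : C) : ccont (fun z : C_UniformSpace => z) z.
Proof. intros eps He. apply locally_Cmod. exists eps; auto. Qed.

Lemma ccont_RtoC (t : R) : ccont RtoC t.
Proof.
  intros eps He. apply locally_R. exists eps; split; auto. intros s Hs.
  rewrite <- RtoC_minus, Cmod_R. auto.
Qed.

Lemma cderiv_cont (f : C -> C) (z l : C) : cderiv f z l -> ccont f z.
Proof. apply gder_cont, ccont_id. Qed.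

Lemma rderiv_cont (f : R -> C) (t : R) (l : C) : rderiv f t l -> ccont f t.
Proof. apply gder_cont, ccont_RtoC. Qed.

Lemma ccont_const {T : UniformSpace} (c : C) (x : T) : ccont (fun _ => c) x.
Proof. apply lim_const. Qed.

Lemma ccont_plus {T : UniformSpace} (f g : T -> C) (x : T) :
  ccont f x -> ccont g x -> ccont (fun y => f y + g y)%C x.
Proof. apply lim_plus. Qed.

Lemma ccont_mult {T : UniformSpace} (f g : T -> C) (x : T) :
  ccont f x -> ccont g x -> ccont (fun y => f y * g y)%C x.
Proof. apply lim_mult. Qed.

Lemma ccont_inv {T : UniformSpace} (f : T -> C) (x : T) :
  ccont f x -> f x <> 0%C -> ccont (fun y => / f y)%C x.
Proof. apply lim_inv. Qed.

Lemma ccont_opp {T : UniformSpace} (f : T -> C) (x : T) :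
  ccont f x -> ccont (fun y => - f y)%C x.
Proof. apply lim_opp. Qed.

Lemma ccont_minus {T : UniformSpace} (f g : T -> C) (x : T) :
  ccont f x -> ccont g x -> ccont (fun y => f y - g y)%C x.
Proof. intros. apply ccont_plus; auto. apply ccont_opp; auto. Qed.

Lemma ccont_comp {T : UniformSpace} (g : T -> C) (f : C -> C) (x : T) :
  ccont g x -> ccont f (g x) -> ccont (fun y => f (g y)) x.
Proof.
  intros H1 H2. apply clim_comp with (locally (g x)); auto.
  apply clim_filterlim; auto. apply filter_filter.
Qed.

Lemma gder_opp {T : UniformSpace} (e f : T -> C) (x : T) (l : C) :
  gder e f x l -> gder e (fun y => - f y)%C x (- l)%C.
Proof.
  intros [p [H1 H2]]. exists (fun y => - p y)%C; split; [|apply lim_opp; auto].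
  revert H1; apply filter_imp. intros y h1.
  replace (- f y - - f x)%C with (- (f y - f x))%C by ring. rewrite h1; ring.
Qed.

Lemma gder_minus {T : UniformSpace} (e f g : T -> C) (x : T) (l m : C) :
  gder e f x l -> gder e g x m -> gder e (fun y => f y - g y)%C x (l - m)%C.
Proof. intros. apply gder_plus; auto. apply gder_opp; auto. Qed.

Lemma gder_div {T : UniformSpace} (e f g : T -> C) (x : T) (l m : C) :
  ccont e x -> gder e f x l -> gder e g x m -> g x <> 0%C ->
  gder e (fun y => f y / g y)%C x ((l * g x - f x * m) / (g x * g x))%C.
Proof.
  intros He Hf Hg H0. eapply gder_eq.
  apply gder_mult; auto. exact Hf. apply gder_inv; auto. exact Hg. cbv beta. field; auto.
Qed.

Lemma gder_scal {T : UniformSpace} (e f : T -> C) (x : T) (c l : C) :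
  ccont e x -> gder e f x l -> gder e (fun y => c * f y)%C x (c * l)%C.
Proof.
  intros He Hf. eapply gder_eq. apply gder_mult; auto. apply gder_const. exact Hf. cbv beta. ring.
Qed.

Lemma cderiv_chain (f g : C -> C) (z l m : C) :
  cderiv g z m -> cderiv f (g z) l -> cderiv (fun y => f (g y)) z (l * m)%C.
Proof. apply gder_chain, ccont_id. Qed.

Lemma rderiv_chain (f : C -> C) (g : R -> C) (t : R) (l m : C) :
  rderiv g t m -> cderiv f (g t) l -> rderiv (fun y => f (g y)) t (l * m)%C.
Proof. apply gder_chain, ccont_RtoC. Qed.

Lemma gder_intro {T : UniformSpace} (e f : T -> C) (x : T) (l : C) :
  (forall eps, 0 < eps -> locally x (fun y =>
     Cmod (f y - f x - l * (e y - e x)) <= eps * Cmod (e y - e x))) -> gder e f x l.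
Proof.
  intros H. exists (fun y => if Ceq_dec (e y) (e x) then l else (f y - f x) / (e y - e x))%C. split.
  - generalize (H 1 Rlt_0_1). apply filter_imp. intros y Hy.
    destruct (Ceq_dec (e y) (e x)) as [E|N]; [|field; apply Csub_neq_0; auto].
    rewrite E, Cmod_self, Rmult_0_r in Hy. rewrite E.
    replace (f y - f x - l * (e x - e x))%C with (f y - f x)%C in Hy by ring.
    rewrite (Cmod_eq_0 (f y - f x)); [ring|]. apply Rle_antisym; auto. apply Cmod_ge_0.
  - intros eps He. assert (He2 : 0 < eps / 2) by lra.
    generalize (H _ He2). apply filter_imp. intros y Hy.
    destruct (Ceq_dec (e y) (e x)) as [E|N]; [rewrite Cmod_self; auto|].
    assert (N' := Csub_neq_0 _ _ N).
    replace ((f y - f x) / (e y - e x) - l)%C with ((f y - f x - l * (e y - e x)) / (e y - e x))%C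
      by (field; auto).
    rewrite Cmod_div by auto.
    assert (h0 : 0 < Cmod (e y - e x)) by (apply Cmod_gt_0; auto).
    apply (Rmult_lt_reg_r (Cmod (e y - e x))); auto.
    unfold Rdiv; rewrite Rmult_assoc, Rinv_l by lra. nra.
Qed.

Lemma cderiv_intro (f : C -> C) (z l : C) :
  (forall eps, 0 < eps -> exists d, 0 < d /\ forall w, Cmod (w - z) < d ->
     Cmod (f w - f z - l * (w - z)) <= eps * Cmod (w - z)) -> cderiv f z l.
Proof. intros H. apply gder_intro. intros e He. apply locally_Cmod. auto. Qed.

Lemma cderiv_elim (f : C -> C) (z l : C) : cderiv f z l ->
  forall eps, 0 < eps -> exists d, 0 < d /\ forall w, Cmod (w - z) < d ->
     Cmod (f w - f z - l * (w - z)) <= eps * Cmod (w - z).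
Proof.
  intros [p [H1 H2]] eps He. apply locally_Cmod.
  generalize (filter_and _ _ H1 (H2 eps He)). apply filter_imp. intros w [h1 h2].
  rewrite h1. replace (p w * (w - z) - l * (w - z))%C with ((p w - l) * (w - z))%C by ring.
  rewrite Cmod_mult. apply Rmult_le_compat_r; [apply Cmod_ge_0|lra].
Qed.

(** [is_derive] uses the neighbourhoods of [C] as an absolute ring, [cderiv] those of the product;
    [locally_C] identifies them. *)
Lemma cderiv_is_derive (f : C -> C) (z l : C) : is_derive f z l <-> cderiv f z l.
Proof.
  split.
  - intros [_ H]. apply cderiv_intro. intros e He. apply locally_Cmod, locally_C.
    generalize (H z (fun P HP => HP) (mkposreal e He)). apply filter_imp. intros w Hw.
    rewrite Cmult_comm. exact Hw.
  - intros H. split; [apply is_linear_scal_l|].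
    intros x Hx. assert (E := is_filter_lim_locally_unique _ _ Hx). subst x.
    intros e. apply locally_C, locally_Cmod.
    destruct (cderiv_elim f z l H e (cond_pos e)) as [d [Hd Hw]]. exists d. split; auto.
    intros w h. change (Cmod (f w - f z - (w - z) * l) <= e * Cmod (w - z)).
    rewrite (Cmult_comm (w - z)). auto.
Qed.

Lemma cderiv_unique (f : C -> C) (z l m : C) : cderiv f z l -> cderiv f z m -> l = m.
Proof.
  intros H1 H2. apply cderiv_is_derive in H1, H2.
  rewrite <- (is_C_derive_unique _ _ _ H1). apply is_C_derive_unique; auto.
Qed.

Lemma rderiv_intro (u v : R -> R) (t a b : R) :
  is_derive u t a -> is_derive v t b -> rderiv (fun s => (u s, v s)) t (a, b).
Proof.
  assert (K : forall (u : R -> R) a, is_derive u t a -> rderiv (fun s => RtoC (u s)) t (RtoC a)).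
  { clear. intros u a [_ H]. apply gder_intro. intros e He.
    generalize (H t (fun P HP => HP) (mkposreal e He)). apply filter_imp. intros s Hs.
    rewrite <- !RtoC_minus, <- RtoC_mult, <- RtoC_minus, !Cmod_R, (Rmult_comm a). exact Hs. }
  intros Hu Hv.
  apply gder_ext with (fun s => RtoC (u s) + Ci * RtoC (v s))%C.
  - intros s. unfold Cplus, Cmult, RtoC, Ci; simpl; f_equal; ring.
  - eapply gder_eq. apply gder_plus. apply K; eauto. apply gder_scal. apply ccont_RtoC.
    apply K; eauto. unfold Cplus, Cmult, RtoC, Ci; simpl; f_equal; ring.
Qed.

Lemma rderiv_elim (f : R -> C) (t : R) (l : C) :
  rderiv f t l ->
  is_derive (fun s => Re (f s)) t (Re l) /\ is_derive (fun s => Im (f s)) t (Im l).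
Proof.
  intros [p [H1 H2]].
  assert (K : forall eps : posreal,
     locally t (fun s => Cmod (f s - f t - RtoC (s - t) * l) <= eps * Rabs (s - t))).
  { intros eps. generalize (filter_and _ _ H1 (H2 eps (cond_pos eps))).
    apply filter_imp. intros s [h1 h2].
    replace (f s - f t - RtoC (s - t) * l)%C with ((p s - l) * RtoC (s - t))%C
      by (rewrite h1, RtoC_minus; ring).
    rewrite Cmod_mult, Cmod_R. apply Rmult_le_compat_r; [apply Rabs_pos|lra]. }
  split; (split; [apply @is_linear_scal_l|]); intros x Hx;
    assert (E := is_filter_lim_locally_unique _ _ Hx); subst x;
    intros eps; generalize (K eps); apply filter_imp; intros s Hs.
  - change (Rabs (Re (f s) - Re (f t) - (s - t) * Re l) <= eps * Rabs (s - t)).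
    eapply Rle_trans; [|exact Hs]. eapply Rle_trans; [|apply re_le_Cmod].
    right; f_equal. unfold Re, Im, Rminus; simpl. ring.
  - change (Rabs (Im (f s) - Im (f t) - (s - t) * Im l) <= eps * Rabs (s - t)).
    eapply Rle_trans; [|exact Hs]. eapply Rle_trans; [|apply im_le_Cmod].
    right; f_equal. unfold Re, Im, Rminus; simpl. ring.
Qed.

Lemma ccont_elim (f : R -> C) (t : R) :
  ccont f t -> continuous (fun s => Re (f s)) t /\ continuous (fun s => Im (f s)) t.
Proof.
  intros H. split; apply filterlim_locally; intros eps; generalize (H eps (cond_pos eps));
  apply filter_imp; intros s Hs.
  - eapply Rle_lt_trans; [|exact Hs]. eapply Rle_trans; [|apply re_le_Cmod].
    right; unfold ball; simpl; unfold AbsRing_ball, abs, minus, plus, opp; simpl. f_equal.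
  - eapply Rle_lt_trans; [|exact Hs]. eapply Rle_trans; [|apply im_le_Cmod].
    right; unfold ball; simpl; unfold AbsRing_ball, abs, minus, plus, opp; simpl. f_equal.
Qed.

(** * Integrals along horizontal and vertical segments *)

Ltac minmax := unfold Rmin, Rmax in *; repeat destruct Rle_dec; lra.

Definition cint (f : R -> C) (a b : R) : C :=
  (RInt (fun t => Re (f t)) a b, RInt (fun t => Im (f t)) a b).

Definition cont_on (f : R -> C) (a b : R) : Prop :=
  forall t, Rmin a b <= t <= Rmax a b -> ccont f t.

Lemma cont_on_swap (f : R -> C) (a b : R) : cont_on f a b -> cont_on f b a.
Proof. intros H t Ht. apply H. minmax. Qed.

Lemma cont_on_sub (f : R -> C) (a b c d : R) :
  Rmin a b <= c <= Rmax a b -> Rmin a b <= d <= Rmax a b -> cont_on f a b -> cont_on f c d.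
Proof. intros H1 H2 H t Ht. apply H. minmax. Qed.

Lemma cont_on_ex (f : R -> C) (a b : R) : cont_on f a b ->
  ex_RInt (fun t => Re (f t)) a b /\ ex_RInt (fun t => Im (f t)) a b.
Proof.
  intros H; split; apply (ex_RInt_continuous (V := R_CompleteNormedModule));
    intros t Ht; apply ccont_elim; auto.
Qed.

Lemma cint_ext (f g : R -> C) (a b : R) :
  (forall t, Rmin a b <= t <= Rmax a b -> f t = g t) -> cint f a b = cint g a b.
Proof.
  intros H; unfold cint; f_equal; apply RInt_ext; intros t Ht; rewrite H; auto; lra.
Qed.

Lemma cint_point (f : R -> C) (a : R) : cint f a a = 0%C.
Proof. unfold cint. rewrite !RInt_point. reflexivity. Qed.

Lemma cint_swap (f : R -> C) (a b : R) : cont_on f a b -> cint f b a = (- cint f a b)%C.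
Proof.
  intros H. destruct (cont_on_ex _ _ _ H). unfold cint.
  rewrite <- !(opp_RInt_swap (V := R_CompleteNormedModule) _ a b) by auto. reflexivity.
Qed.

Lemma cint_Chasles (f : R -> C) (a b c : R) : cont_on f a b -> cont_on f b c ->
  (cint f a b + cint f b c)%C = cint f a c.
Proof.
  intros H1 H2. destruct (cont_on_ex _ _ _ H1), (cont_on_ex _ _ _ H2).
  unfold cint, Cplus; simpl. f_equal; apply (RInt_Chasles (V := R_CompleteNormedModule)); auto.
Qed.

Lemma cint_plus (f g : R -> C) (a b : R) : cont_on f a b -> cont_on g a b ->
  cint (fun t => f t + g t)%C a b = (cint f a b + cint g a b)%C.
Proof.
  intros H1 H2. destruct (cont_on_ex _ _ _ H1), (cont_on_ex _ _ _ H2).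
  unfold cint, Cplus; simpl. f_equal; apply (RInt_plus (V := R_CompleteNormedModule)); auto.
Qed.

Lemma cint_scal (c : C) (f : R -> C) (a b : R) : cont_on f a b ->
  cint (fun t => c * f t)%C a b = (c * cint f a b)%C.
Proof.
  intros H1. destruct (cont_on_ex _ _ _ H1) as [h1 h2].
  destruct c as [x y]. unfold cint, Cmult; simpl.
  assert (S : forall k (u : R -> R), ex_RInt u a b -> is_RInt (fun t => k * u t) a b (k * RInt u a b)).
  { intros k u Hu. apply (is_RInt_scal (V := R_NormedModule)).
    apply (RInt_correct (V := R_CompleteNormedModule)); auto. }
  f_equal; apply is_RInt_unique.
  - apply (is_RInt_minus (V := R_NormedModule)); apply S; auto.
  - apply (is_RInt_plus (V := R_NormedModule)); apply S; auto.
Qed.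

Lemma cint_minus (f g : R -> C) (a b : R) : cont_on f a b -> cont_on g a b ->
  cint (fun t => f t - g t)%C a b = (cint f a b - cint g a b)%C.
Proof.
  intros H1 H2. rewrite (cint_ext _ (fun t => f t + - 1 * g t)%C).
  - rewrite cint_plus, cint_scal; auto. ring.
    intros t Ht. apply ccont_mult; auto. apply ccont_const.
  - intros; ring.
Qed.

Lemma cint_const (c : C) (a b : R) : cint (fun _ => c) a b = (RtoC (b - a) * c)%C.
Proof.
  unfold cint. rewrite !RInt_const. unfold Cmult, RtoC, scal; simpl. unfold mult; simpl.
  unfold Re, Im. f_equal; ring.
Qed.

Lemma cint_FTC (F f : R -> C) (a b : R) :
  (forall t, Rmin a b <= t <= Rmax a b -> rderiv F t (f t)) -> cont_on f a b ->
  cint f a b = (F b - F a)%C.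
Proof.
  intros H1 H2. unfold cint, Cminus, Cplus; simpl.
  f_equal; apply is_RInt_unique.
  - apply (is_RInt_derive (V := R_CompleteNormedModule) (fun s => Re (F s)) (fun s => Re (f s)));
      intros t Ht; [apply rderiv_elim|apply ccont_elim]; auto.
  - apply (is_RInt_derive (V := R_CompleteNormedModule) (fun s => Im (F s)) (fun s => Im (f s)));
      intros t Ht; [apply rderiv_elim|apply ccont_elim]; auto.
Qed.

Lemma cint_ML (f : R -> C) (a b M : R) : cont_on f a b ->
  (forall t, Rmin a b <= t <= Rmax a b -> Cmod (f t) <= M) ->
  Cmod (cint f a b) <= M * Rabs (b - a).
Proof.
  assert (K : forall a b, a <= b -> cont_on f a b ->
    (forall t, Rmin a b <= t <= Rmax a b -> Cmod (f t) <= M) ->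
    Cmod (cint f a b) <= M * (b - a)).
  { clear a b. intros a b Hab H1 H2. set (I := cint f a b).
    assert (HM : 0 <= M) by (eapply Rle_trans; [apply Cmod_ge_0|apply (H2 a); minmax]).
    destruct (Rle_lt_or_eq_dec 0 (Cmod I) (Cmod_ge_0 I)) as [h|<-]; [|apply Rmult_le_pos; lra].
    (* [|I|^2] is the real part of the integral of [conj I * f] *)
    assert (Hc : cont_on (fun t => Cconj I * f t)%C a b).
    { intros t Ht. apply ccont_mult; auto. apply ccont_const. }
    apply (Rmult_le_reg_l (Cmod I)); auto.
    replace (Cmod I * Cmod I) with (RInt (fun t => Re (Cconj I * f t)%C) a b).
    - replace (Cmod I * (M * (b - a))) with (RInt (fun _ => Cmod I * M) a b).
      + apply RInt_le; auto; [apply (cont_on_ex _ _ _ Hc)|apply ex_RInt_const|].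
        intros t Ht. eapply Rle_trans; [apply Rle_abs|]. eapply Rle_trans; [apply re_le_Cmod|].
        rewrite Cmod_mult, Cmod_conj. apply Rmult_le_compat_l; [lra|]. apply H2. minmax.
      + rewrite RInt_const. unfold scal; simpl; unfold mult; simpl; ring.
    - change (Re (cint (fun t => Cconj I * f t)%C a b) = Cmod I * Cmod I).
      rewrite cint_scal by auto. fold I. rewrite Cmult_comm, <- Cmod2_conj. simpl. ring. }
  intros H1 H2. destruct (Rle_dec a b) as [h|h].
  - rewrite Rabs_pos_eq by lra. auto.
  - rewrite cint_swap by (apply cont_on_swap; auto). rewrite Cmod_opp, Rabs_minus_sym, Rabs_pos_eq by lra.
    apply K; try lra. apply cont_on_swap; auto. intros t Ht; apply H2. minmax.
Qed.

Definition hint (f : C -> C) (a b y : R) : C := cint (fun t => f (t, y)) a b.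
Definition vint (f : C -> C) (x c d : R) : C := (Ci * cint (fun t => f (x, t)) c d)%C.
(** The integral of [f dz] around the rectangle with opposite corners [(a, c)] and [(b, d)],
    counterclockwise when [a <= b] and [c <= d]. Corners in any order are allowed, the sign
    recording the orientation; this spares case distinctions on the position of a point relative to
    a base point. *)
Definition rint (f : C -> C) (a b c d : R) : C :=
  (hint f a b c + vint f b c d - hint f a b d - vint f a c d)%C.

Definition in_rect (a b c d : R) (z : C) : Prop :=
  Rmin a b <= Re z <= Rmax a b /\ Rmin c d <= Im z <= Rmax c d.

Lemma rderiv_horizontal (y t : R) : rderiv (fun t => (t, y)) t 1%C.
Proof.
  apply (rderiv_intro (fun t => t) (fun _ => y)); auto_derive; auto.
Qed.

Lemma rderiv_vertical (x t : R) : rderiv (fun t => (x, t)) t Ci.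
Proof.
  apply (rderiv_intro (fun _ => x) (fun t => t)); auto_derive; auto.
Qed.

Lemma ccont_horizontal (f : C -> C) (y t : R) : ccont f (t, y) -> ccont (fun t => f (t, y)) t.
Proof. intros H. apply ccont_comp; auto. eapply rderiv_cont, rderiv_horizontal. Qed.

Lemma ccont_vertical (f : C -> C) (x t : R) : ccont f (x, t) -> ccont (fun t => f (x, t)) t.
Proof. intros H. apply (ccont_comp (fun t => (x, t))); auto. eapply rderiv_cont, rderiv_vertical. Qed.

Lemma cont_on_horizontal (f : C -> C) (a b c d y : R) :
  (forall z, in_rect a b c d z -> ccont f z) -> Rmin c d <= y <= Rmax c d ->
  cont_on (fun t => f (t, y)) a b.
Proof. intros H Hy t Ht. apply ccont_horizontal, H. split; auto. Qed.

Lemma cont_on_vertical (f : C -> C) (a b c d x : R) :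
  (forall z, in_rect a b c d z -> ccont f z) -> Rmin a b <= x <= Rmax a b ->
  cont_on (fun t => f (x, t)) c d.
Proof. intros H Hy t Ht. apply ccont_vertical, H. split; auto. Qed.

Lemma Rminmax_l (a b : R) : Rmin a b <= a <= Rmax a b. Proof. minmax. Qed.
Lemma Rminmax_r (a b : R) : Rmin a b <= b <= Rmax a b. Proof. minmax. Qed.

Lemma rint_split_x (f : C -> C) (a m b c d : R) :
  Rmin a b <= m <= Rmax a b -> (forall z, in_rect a b c d z -> ccont f z) ->
  rint f a b c d = (rint f a m c d + rint f m b c d)%C.
Proof.
  intros Hm H. unfold rint, hint.
  assert (K : forall y, Rmin c d <= y <= Rmax c d ->
    cint (fun t => f (t, y)) a b = (cint (fun t => f (t, y)) a m + cint (fun t => f (t, y)) m b)%C).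
  { intros y Hy. assert (C1 := cont_on_horizontal _ _ _ _ _ _ H Hy).
    symmetry; apply cint_Chasles; eapply cont_on_sub; try exact C1; auto using Rminmax_l, Rminmax_r. }
  rewrite (K c), (K d) by auto using Rminmax_l, Rminmax_r. ring.
Qed.

Lemma rint_split_y (f : C -> C) (a b c m d : R) :
  Rmin c d <= m <= Rmax c d -> (forall z, in_rect a b c d z -> ccont f z) ->
  rint f a b c d = (rint f a b c m + rint f a b m d)%C.
Proof.
  intros Hm H. unfold rint, vint.
  assert (K : forall x, Rmin a b <= x <= Rmax a b ->
    cint (fun t => f (x, t)) c d = (cint (fun t => f (x, t)) c m + cint (fun t => f (x, t)) m d)%C).
  { intros y Hy. assert (C1 := cont_on_vertical _ _ _ _ _ _ H Hy).
    symmetry; apply cint_Chasles; eapply cont_on_sub; try exact C1; auto using Rminmax_l, Rminmax_r. }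
  rewrite (K a), (K b) by auto using Rminmax_l, Rminmax_r. ring.
Qed.

Lemma rint_minus (f g : C -> C) (a b c d : R) :
  (forall z, in_rect a b c d z -> ccont f z) -> (forall z, in_rect a b c d z -> ccont g z) ->
  rint (fun z => f z - g z)%C a b c d = (rint f a b c d - rint g a b c d)%C.
Proof.
  intros Hf Hg. unfold rint, hint, vint.
  rewrite !cint_minus by
    (eapply cont_on_horizontal + eapply cont_on_vertical; eauto using Rminmax_l, Rminmax_r).
  ring.
Qed.

Lemma hint_FTC (F f : C -> C) (a b y : R) :
  (forall t, Rmin a b <= t <= Rmax a b -> cderiv F (t, y) (f (t, y)) /\ ccont f (t, y)) ->
  hint f a b y = (F (b, y) - F (a, y))%C.
Proof.
  intros H. unfold hint. apply (cint_FTC (fun t => F (t, y))); intros t Ht; destruct (H t Ht).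
  - eapply gder_eq. apply rderiv_chain; eauto. apply rderiv_horizontal. ring.
  - apply ccont_horizontal; auto.
Qed.

Lemma vint_FTC (F f : C -> C) (x c d : R) :
  (forall t, Rmin c d <= t <= Rmax c d -> cderiv F (x, t) (f (x, t)) /\ ccont f (x, t)) ->
  vint f x c d = (F (x, d) - F (x, c))%C.
Proof.
  intros H. unfold vint. rewrite <- cint_scal.
  - apply (cint_FTC (fun t => F (x, t))); intros t Ht; destruct (H t Ht).
    + eapply gder_eq. apply (rderiv_chain F (fun t => (x, t))); eauto. apply rderiv_vertical. ring.
    + apply ccont_mult. apply ccont_const. apply ccont_vertical; auto.
  - intros t Ht. apply ccont_vertical, H; auto.
Qed.

Lemma rint_FTC (F f : C -> C) (a b c d : R) :
  (forall z, in_rect a b c d z -> cderiv F z (f z) /\ ccont f z) -> rint f a b c d = 0%C.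
Proof.
  intros H. unfold rint. rewrite !(hint_FTC F f), !(vint_FTC F f); [ring|..];
    intros t Ht; apply H; split; simpl; auto using Rminmax_l, Rminmax_r.
Qed.

Lemma rint_ML (f : C -> C) (a b c d M : R) :
  (forall z, in_rect a b c d z -> ccont f z) ->
  (forall z, in_rect a b c d z -> Cmod (f z) <= M) ->
  Cmod (rint f a b c d) <= 2 * M * (Rabs (b - a) + Rabs (d - c)).
Proof.
  intros H HM.
  assert (K1 : forall y, Rmin c d <= y <= Rmax c d -> Cmod (hint f a b y) <= M * Rabs (b - a)).
  { intros y Hy. apply cint_ML. eapply cont_on_horizontal; eauto.
    intros t Ht; apply HM; split; auto. }
  assert (K2 : forall x, Rmin a b <= x <= Rmax a b -> Cmod (vint f x c d) <= M * Rabs (d - c)).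
  { intros x Hx. unfold vint. rewrite Cmod_mult, Cmod_Ci, Rmult_1_l.
    apply cint_ML. eapply cont_on_vertical; eauto.
    intros t Ht; apply HM; split; auto. }
  unfold rint.
  generalize (K1 c (Rminmax_l _ _)) (K1 d (Rminmax_r _ _)) (K2 a (Rminmax_l _ _)) (K2 b (Rminmax_r _ _)).
  intros h1 h2 h3 h4.
  eapply Rle_trans; [apply Cmod_sub_le|].
  eapply Rle_trans; [apply Rplus_le_compat_r, Cmod_sub_le|].
  eapply Rle_trans; [apply Rplus_le_compat_r, Rplus_le_compat_r, Cmod_triangle|].
  lra.
Qed.

(** * Goursat's theorem by dyadic subdivision *)

Lemma nested_intervals (s e : nat -> R) :
  (forall n, s n <= s (S n)) -> (forall n, s (S n) + e (S n) <= s n + e n) ->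
  (forall n, 0 <= e n) -> exists l, forall n, s n <= l <= s n + e n.
Proof.
  intros H1 H2 H3.
  assert (M1 : forall n m, s n <= s (n + m)%nat).
  { intros n m; induction m; [rewrite Nat.add_0_r; lra|].
    rewrite Nat.add_succ_r. eapply Rle_trans; eauto. }
  assert (M2 : forall n m, s (n + m)%nat + e (n + m)%nat <= s n + e n).
  { intros n m; induction m; [rewrite Nat.add_0_r; lra|].
    rewrite Nat.add_succ_r. eapply Rle_trans; eauto. }
  assert (U : forall n m, s n <= s m + e m).
  { intros n m. generalize (M1 n m) (M2 m n) (H3 (n + m)%nat).
    rewrite (Nat.add_comm m n). lra. }
  destruct (completeness (fun x => exists n, x = s n)) as [l [Hl1 Hl2]].
  - exists (s O + e O). intros x [n ->]. auto.
  - exists (s O), O; auto.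
  - exists l. intros n; split.
    + apply Hl1. exists n; auto.
    + apply Hl2. intros x [m ->]. auto.
Qed.

Lemma ccont_of_cderiv (f : C -> C) (z : C) : (exists l, cderiv f z l) -> ccont f z.
Proof. intros [l Hl]. eapply cderiv_cont; eauto. Qed.

Lemma mid_between (a e : R) : Rmin a (a + e) <= a + e / 2 <= Rmax a (a + e).
Proof. minmax. Qed.

Lemma in_rect_mono (a b c d a' b' c' d' : R) (z : C) :
  Rmin a b <= a' <= Rmax a b -> Rmin a b <= b' <= Rmax a b ->
  Rmin c d <= c' <= Rmax c d -> Rmin c d <= d' <= Rmax c d ->
  in_rect a' b' c' d' z -> in_rect a b c d z.
Proof. intros H1 H2 H3 H4 [h1 h2]. split; minmax. Qed.

(** The integrals around the four quarters add up, since the inner sides cancel, so one of them has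
    at least a quarter of the total modulus. [i] and [j] tell whether it lies in the second half in
    each direction; [u] and [v] may be negative. *)
Lemma rint_quarter (f : C -> C) (x y u v : R) :
  (forall z, in_rect x (x + u) y (y + v) z -> ccont f z) ->
  exists i j : bool,
    let x' := if i then x + u / 2 else x in
    let y' := if j then y + v / 2 else y in
    Cmod (rint f x (x + u) y (y + v)) <=
      4 * Cmod (rint f x' (x' + u / 2) y' (y' + v / 2)).
Proof.
  intros H.
  assert (M1 := mid_between x u). assert (M2 := mid_between y v).
  assert (E : (rint f x (x + u) y (y + v) =
    rint f x (x + u / 2) y (y + v / 2) +
    rint f x (x + u / 2) (y + v / 2) (y + v / 2 + v / 2) +
    (rint f (x + u / 2) (x + u / 2 + u / 2) y (y + v / 2) +
    rint f (x + u / 2) (x + u / 2 + u / 2) (y + v / 2) (y + v / 2 + v / 2)))%C).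
  { replace (x + u / 2 + u / 2) with (x + u) by field.
    replace (y + v / 2 + v / 2) with (y + v) by field.
    rewrite (rint_split_x _ _ (x + u / 2)) by auto.
    rewrite (rint_split_y _ x _ _ (y + v / 2)), (rint_split_y _ _ (x + u) _ (y + v / 2)); auto;
    intros z Hz; apply H; revert Hz; apply in_rect_mono; auto using Rminmax_l, Rminmax_r. }
  assert (T : Cmod (rint f x (x + u) y (y + v)) <=
    Cmod (rint f x (x + u / 2) y (y + v / 2)) +
    Cmod (rint f x (x + u / 2) (y + v / 2) (y + v / 2 + v / 2)) +
    (Cmod (rint f (x + u / 2) (x + u / 2 + u / 2) y (y + v / 2)) +
    Cmod (rint f (x + u / 2) (x + u / 2 + u / 2) (y + v / 2) (y + v / 2 + v / 2)))).
  { rewrite E. eapply Rle_trans; [apply Cmod_triangle|].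
    apply Rplus_le_compat; apply Cmod_triangle. }
  set (P := Cmod (rint f x (x + u) y (y + v))) in *. clear E.
  destruct (Rle_dec P (4 * Cmod (rint f x (x + u / 2) y (y + v / 2)))).
  { exists false, false; auto. }
  destruct (Rle_dec P (4 * Cmod (rint f x (x + u / 2) (y + v / 2) (y + v / 2 + v / 2)))).
  { exists false, true; auto. }
  destruct (Rle_dec P (4 * Cmod (rint f (x + u / 2) (x + u / 2 + u / 2) y (y + v / 2)))).
  { exists true, false; auto. }
  exists true, true. cbv zeta. fold P. lra.
Qed.

Lemma pow2_pos (n : nat) : 0 < 2 ^ n.
Proof. apply pow_lt; lra. Qed.

Lemma subrect_between (x u s e : R) : 0 <= s -> s + e <= 1 -> 0 <= e ->
  Rmin x (x + u) <= x + u * s <= Rmax x (x + u) /\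
  Rmin x (x + u) <= x + u * s + u * e <= Rmax x (x + u).
Proof. intros h1 h2 h3. unfold Rmin, Rmax; destruct Rle_dec; split; split; nra. Qed.

(** Dyadic subrectangles, in coordinates where the initial one is the unit square. *)
Definition dyadic_rint (f : C -> C) (x y u v : R) (n : nat) (p : R * R) : R :=
  Cmod (rint f (x + u * fst p) (x + u * fst p + u / 2 ^ n) (y + v * snd p) (y + v * snd p + v / 2 ^ n)).

Definition dyadic_corner (n : nat) (p : R * R) : Prop :=
  0 <= fst p /\ fst p + / 2 ^ n <= 1 /\ 0 <= snd p /\ snd p + / 2 ^ n <= 1.

Definition dyadic_step (n : nat) (p q : R * R) : Prop :=
  fst p <= fst q /\ fst q + / 2 ^ S n <= fst p + / 2 ^ n /\
  snd p <= snd q /\ snd q + / 2 ^ S n <= snd p + / 2 ^ n.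

Lemma dyadic_refine (f : C -> C) (x y u v : R) :
  (forall z, in_rect x (x + u) y (y + v) z -> ccont f z) ->
  forall n p, dyadic_corner n p -> exists q, dyadic_corner (S n) q /\ dyadic_step n p q /\
    dyadic_rint f x y u v n p <= 4 * dyadic_rint f x y u v (S n) q.
Proof.
  intros H n [s t] [h1 [h2 [h3 h4]]]; simpl in h1, h2, h3, h4.
  assert (P2 := pow2_pos n).
  assert (E2 : / 2 ^ n = / 2 ^ S n + / 2 ^ S n) by (simpl; field; lra).
  assert (Pi : 0 < / 2 ^ S n) by (apply Rinv_0_lt_compat, pow2_pos).
  destruct (rint_quarter f (x + u * s) (y + v * t) (u / 2 ^ n) (v / 2 ^ n)) as [i [j B]].
  { intros z Hz; apply H; revert Hz. apply in_rect_mono; apply (subrect_between _ _ _ (/ 2 ^ n)); lra. }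
  exists ((if i then s + / 2 ^ S n else s), (if j then t + / 2 ^ S n else t)).
  unfold dyadic_corner, dyadic_step, dyadic_rint. cbn [fst snd]. split; [|split].
  - destruct i, j; lra.
  - destruct i, j; lra.
  - assert (Eu : forall u, u / 2 ^ S n = u / 2 ^ n / 2) by (intros; simpl; field; lra).
    assert (Ed : forall x u s (i : bool), x + u * (if i then s + / 2 ^ S n else s) =
      if i then x + u * s + u / 2 ^ n / 2 else x + u * s).
    { intros x0 u0 s0 [|]; [rewrite <- Eu; unfold Rdiv|]; ring. }
    rewrite !Ed, !Eu. exact B.
Qed.

(** Dependent choice with an invariant [P] and a relation [Q] between consecutive terms. Choosing
    over all pairs [(n, x)] at once requires a value even where [P] fails; there [x] itself
    serves. *)
Lemma sequence_choice {T : Type} (P : nat -> T -> Prop) (Q : nat -> T -> T -> Prop) (a : T) :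
  P O a -> (forall n x, P n x -> exists y, P (S n) y /\ Q n x y) ->
  exists f, f O = a /\ forall n, P n (f n) /\ Q n (f n) (f (S n)).
Proof.
  intros Ha H.
  destruct (functional_choice (fun (p : nat * T) y =>
    P (fst p) (snd p) -> P (S (fst p)) y /\ Q (fst p) (snd p) y)) as [g Hg].
  { intros [n x]. simpl. destruct (classic (P n x)) as [h|h]; [|exists x; tauto].
    destruct (H n x h) as [y Hy]. exists y; auto. }
  set (f := fix f n := match n with O => a | S n => g (n, f n) end).
  assert (K : forall n, P n (f n)) by (induction n; [exact Ha|apply (Hg (n, f n)); auto]).
  exists f. split; auto. intros n. split; auto. apply (Hg (n, f n)), K.
Qed.

Theorem goursat (f : C -> C) (a b c d : R) :
  (forall z, in_rect a b c d z -> exists l, cderiv f z l) -> rint f a b c d = 0%C.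
Proof.
  intros H.
  assert (E : exists u v, b = a + u /\ d = c + v) by (exists (b - a), (d - c); split; ring).
  destruct E as [u [v [-> ->]]].
  assert (Hc : forall z, in_rect a (a + u) c (c + v) z -> ccont f z)
    by (intros; apply ccont_of_cderiv; auto).
  destruct (sequence_choice dyadic_corner (fun n p q => dyadic_step n p q /\
    dyadic_rint f a c u v n p <= 4 * dyadic_rint f a c u v (S n) q) (0, 0)) as [pq [pq0 Hpq]].
  { unfold dyadic_corner; simpl. lra. }
  { intros n p Hp. destruct (dyadic_refine f a c u v Hc n p Hp) as [q Hq]. exists q; tauto. }
  set (s n := fst (pq n)). set (t n := snd (pq n)).
  assert (Pi : forall n, 0 <= / 2 ^ n) by (intros; left; apply Rinv_0_lt_compat, pow2_pos).
  destruct (nested_intervals s (fun n => / 2 ^ n)) as [p Hp]; auto; try (intros; apply Hpq).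
  destruct (nested_intervals t (fun n => / 2 ^ n)) as [q Hq]; auto; try (intros; apply Hpq).
  assert (S' : forall n, dyadic_corner n (pq n) /\
    Cmod (rint f a (a + u) c (c + v)) <= 4 ^ n * dyadic_rint f a c u v n (pq n)).
  { intros n. split; [apply Hpq|]. induction n.
    - rewrite pq0. unfold dyadic_rint. simpl. right.
      rewrite Rmult_1_l, !Rmult_0_r, !Rplus_0_r, !Rdiv_1_r. reflexivity.
    - eapply Rle_trans; [exact IHn|]. destruct (Hpq n) as [_ [_ B]]. simpl (4 ^ S n).
      rewrite (Rmult_comm 4), Rmult_assoc. apply Rmult_le_compat_l; auto. apply pow_le; lra. }
  set (z := (a + u * p, c + v * q) : C).
  assert (Hz : in_rect a (a + u) c (c + v) z).
  { generalize (Hp O) (Hq O) (proj1 (S' O)); unfold dyadic_corner; fold (s O) (t O); simpl. intros.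
    unfold in_rect, z; simpl. unfold Rmin, Rmax. repeat destruct Rle_dec; split; split; nra. }
  destruct (H z Hz) as [l Hl].
  (* Half the perimeter, which also bounds the diameter. At stage [n] perimeter and distance to [z]
     each bring a factor [L / 2 ^ n]; together they cancel [4 ^ n] and leave [eta * (2 * L * L)]. *)
  set (L := Rabs u + Rabs v).
  assert (HL : 0 <= L) by (unfold L; generalize (Rabs_pos u) (Rabs_pos v); lra).
  apply (Cmod_small_eq_0 _ (2 * L * L)); [nra|]. intros eta He.
  destruct (cderiv_elim _ _ _ Hl eta He) as [de [Hde Hf]].
  assert (Hn : exists n, L * / 2 ^ n < de).
  { destruct (Req_dec_T L 0) as [->|N]; [exists O; lra|].
    destruct (pow_lt_1_zero (/ 2)) with (y := de / L) as [n Hn].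
    rewrite Rabs_pos_eq; lra. apply Rdiv_lt_0_compat; lra.
    exists n. specialize (Hn n (le_n n)). rewrite <- pow_inv.
    rewrite Rabs_pos_eq in Hn by (apply pow_le; lra).
    apply (Rmult_lt_compat_l L) in Hn; [|lra].
    replace (L * (de / L)) with de in Hn by (field; lra). lra. }
  destruct Hn as [n Hn].
  destruct (S' n) as [[h1 [h2 [h3 h4]]] h5]. unfold dyadic_rint in h5.
  fold (s n) (t n) in h1, h2, h3, h4, h5.
  set (a' := a + u * s n) in *. set (b' := a' + u / 2 ^ n) in *.
  set (c' := c + v * t n) in *. set (d' := c' + v / 2 ^ n) in *.
  assert (Near : forall w, in_rect a' b' c' d' w -> Cmod (w - z) <= L * / 2 ^ n).
  { intros w [w1 w2]. eapply Rle_trans; [apply Cmod_le_abs|].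
    unfold L. rewrite Rmult_plus_distr_r.
    generalize (Hp n) (Hq n) (Pi n); intros k1 k2 k3.
    assert (G : forall x u s p r e, s <= p <= s + e -> 0 <= e ->
      Rmin (x + u * s) (x + u * s + u * e) <= r <= Rmax (x + u * s) (x + u * s + u * e) ->
      Rabs (r - (x + u * p)) <= Rabs u * e).
    { clear. intros x u s p r e h1 h2 h3. apply Rabs_le.
      unfold Rabs. destruct Rcase_abs as [k|k].
      - rewrite Rmin_right, Rmax_left in h3 by nra. nra.
      - rewrite Rmin_left, Rmax_right in h3 by nra. nra. }
    apply Rplus_le_compat.
    - apply (G a u (s n) p (Re w)); auto.
    - apply (G c v (t n) q (Im w)); auto. }
  assert (Sub : forall w, in_rect a' b' c' d' w -> in_rect a (a + u) c (c + v) w).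
  { intros w. apply in_rect_mono; apply (subrect_between _ _ _ (/ 2 ^ n)); auto. }
  (* The affine part of [f] at [z] has a primitive and so integrates to zero; only the remainder, at
     most [eta * |w - z|], contributes. *)
  set (k w := (f z - l * z + l * w)%C).
  assert (Hk : forall w, ccont k w).
  { intros w. apply ccont_plus; [apply ccont_const|]. apply ccont_mult; [apply ccont_const|apply ccont_id]. }
  assert (HK : forall w, cderiv (fun w => (f z - l * z) * w + l / 2 * (w * w))%C w (k w)).
  { intros w. eapply gder_eq. apply gder_plus; apply gder_scal; try apply ccont_id; [apply gder_param|].
    apply gder_mult; [apply ccont_id|apply gder_param|apply gder_param]. unfold k. field. }
  assert (E0 : rint k a' b' c' d' = 0%C).
  { eapply rint_FTC. intros w _. split; [apply HK|apply Hk]. }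
  assert (E1 : rint f a' b' c' d' = rint (fun w => f w - k w)%C a' b' c' d').
  { rewrite rint_minus; auto. rewrite E0; ring. }
  assert (B1 : Cmod (rint f a' b' c' d') <=
     2 * (eta * (L * / 2 ^ n)) * (Rabs (b' - a') + Rabs (d' - c'))).
  { rewrite E1. apply rint_ML.
    - intros w Hw. apply ccont_minus; auto.
    - intros w Hw. unfold k. assert (N := Near w Hw).
      replace (f w - (f z - l * z + l * w))%C with (f w - f z - l * (w - z))%C by ring.
      eapply Rle_trans; [apply Hf; lra|]. apply Rmult_le_compat_l; lra. }
  eapply Rle_trans; [exact h5|].
  replace (Rabs (b' - a') + Rabs (d' - c')) with (L * / 2 ^ n) in B1.
  2:{ unfold b', d', L, Rdiv. replace (a' + u * / 2 ^ n - a') with (u * / 2 ^ n) by ring.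
      replace (c' + v * / 2 ^ n - c') with (v * / 2 ^ n) by ring.
      rewrite !Rabs_mult, (Rabs_pos_eq (/ 2 ^ n)) by auto. ring. }
  eapply Rle_trans; [apply Rmult_le_compat_l; [apply pow_le; lra|exact B1]|].
  right. replace (4 ^ n) with (2 ^ n * 2 ^ n).
  field. generalize (pow2_pos n); lra.
  rewrite <- Rpow_mult_distr. f_equal; lra.
Qed.

(** Closure under the rectangle spanned by two points keeps both L-shaped paths between them, and
    the region they enclose, inside [S]. Squares and the plane are boxes, discs are not. *)
Definition box (S : C -> Prop) : Prop :=
  open S /\ forall z w u, S z -> S w -> in_rect (Re z) (Re w) (Im z) (Im w) u -> S u.

Lemma between_mid (x y t : R) : 0 <= t <= 1 -> Rmin x y <= x + t * (y - x) <= Rmax x y.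
Proof. intros H. unfold Rmin, Rmax; destruct Rle_dec; nra. Qed.

(** The rectangle can be shrunk towards its corner [p] by any factor [t]: the two rectangles cut off
    avoid [p], so Goursat applies to them. Near [p] continuity bounds [f], while the perimeter is
    proportional to [t]. *)
Lemma rint_corner_0 (S : C -> Prop) (f : C -> C) (p z : C) : box S -> S p -> S z ->
  (forall w, S w -> ccont f w) -> (forall w, S w -> w <> p -> exists l, cderiv f w l) ->
  rint f (Re p) (Re z) (Im p) (Im z) = 0%C.
Proof.
  intros [_ HB] Hp Hz Hc Hd.
  destruct (Req_dec_T (Re z) (Re p)) as [E|N1].
  { rewrite E. unfold rint, hint. rewrite !cint_point. ring. }
  destruct (Req_dec_T (Im z) (Im p)) as [E|N2].
  { rewrite E. unfold rint, vint. rewrite !cint_point. ring. }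
  destruct p as [p1 p2], z as [x y]; simpl in *.
  assert (HS : forall w, in_rect p1 x p2 y w -> S w) by (intros w; apply (HB (p1, p2) (x, y)); auto).
  assert (K : forall t, 0 < t <= 1 ->
    rint f p1 x p2 y = rint f p1 (p1 + t * (x - p1)) p2 (p2 + t * (y - p2))).
  { intros t Ht. assert (Ht' : 0 <= t <= 1) by lra.
    assert (M1 := between_mid p1 x t Ht'). assert (M2 := between_mid p2 y t Ht').
    set (x' := p1 + t * (x - p1)) in *. set (y' := p2 + t * (y - p2)) in *.
    rewrite (rint_split_x f p1 x' x) by auto.
    rewrite (goursat f x' x p2 y).
    2:{ intros w Hw. apply Hd.
        - apply HS. revert Hw; apply in_rect_mono; auto using Rminmax_l, Rminmax_r.
        - intros ->. destruct Hw as [Hw _]. simpl in Hw. unfold x' in Hw.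
          unfold Rmin, Rmax in Hw; destruct Rle_dec; nra. }
    rewrite (rint_split_y f p1 x' p2 y' y); auto.
    2:{ intros w Hw. apply Hc, HS. revert Hw; apply in_rect_mono; auto using Rminmax_l, Rminmax_r. }
    rewrite (goursat f p1 x' y' y).
    2:{ intros w Hw. apply Hd.
        - apply HS. revert Hw; apply in_rect_mono; auto using Rminmax_l, Rminmax_r.
        - intros ->. destruct Hw as [_ Hw]. simpl in Hw. unfold y' in Hw.
          unfold Rmin, Rmax in Hw; destruct Rle_dec; nra. }
    ring. }
  destruct (proj1 (locally_Cmod _ _) (Hc _ Hp 1 Rlt_0_1)) as [de [Hde Hf]].
  set (M := Cmod (f (p1, p2)) + 1). set (L := Rabs (x - p1) + Rabs (y - p2)).
  assert (HM : 0 <= M) by (unfold M; generalize (Cmod_ge_0 (f (p1, p2))); lra).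
  assert (HL : 0 < L).
  { unfold L. generalize (Rabs_pos_lt (x - p1)) (Rabs_pos (y - p2)). intros h1 h2.
    assert (0 < Rabs (x - p1)) by (apply h1; lra). lra. }
  assert (B : forall t, 0 < t <= 1 -> t * L < de -> Cmod (rint f p1 x p2 y) <= 2 * M * L * t).
  { intros t Ht Htd. rewrite (K t Ht).
    assert (Ht' : 0 <= t <= 1) by lra.
    assert (M1 := between_mid p1 x t Ht'). assert (M2 := between_mid p2 y t Ht').
    assert (G : forall a b r, Rmin a (a + t * (b - a)) <= r <= Rmax a (a + t * (b - a)) ->
      Rabs (r - a) <= t * Rabs (b - a)).
    { clear - Ht'. intros a b r Hr. rewrite <- (Rabs_pos_eq t) at 1 by lra. rewrite <- Rabs_mult.
      set (e := t * (b - a)) in *. clearbody e.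
      unfold Rabs, Rmin, Rmax in *. repeat destruct Rcase_abs; repeat destruct Rle_dec; lra. }
    eapply Rle_trans; [apply (rint_ML _ _ _ _ _ M)|].
    - intros w Hw. apply Hc, HS. revert Hw; apply in_rect_mono; auto using Rminmax_l, Rminmax_r.
    - intros w [Hw1 Hw2]. assert (D : Cmod (w - (p1, p2)) < de).
      { eapply Rle_lt_trans; [apply Cmod_le_abs|].
        eapply Rle_lt_trans; [|exact Htd]. unfold L. rewrite Rmult_plus_distr_l.
        apply Rplus_le_compat; [apply (G p1 x (Re w))|apply (G p2 y (Im w))]; auto. }
      generalize (Hf w D) (Cmod_le_sub (f w) (f (p1, p2))). unfold M. lra.
    - replace (p1 + t * (x - p1) - p1) with (t * (x - p1)) by ring.
      replace (p2 + t * (y - p2) - p2) with (t * (y - p2)) by ring.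
      rewrite !Rabs_mult, (Rabs_pos_eq t) by lra. unfold L. right; ring. }
  assert (HML : 0 <= 2 * M * L) by nra. apply (Cmod_small_eq_0 _ (2 * M * L)); auto. intros e He.
  assert (HT : 0 < Rmin 1 (Rmin e (de / L))) by (repeat apply Rmin_glb_lt; try apply Rdiv_lt_0_compat; lra).
  set (t := Rmin 1 (Rmin e (de / L)) / 2). assert (t1 : 0 < t) by (unfold t; lra).
  destruct (Rlt_Rmin t 1 (Rmin e (de / L))) as [t2 t3]; [unfold t; lra|].
  apply Rlt_Rmin in t3. destruct t3 as [t3 t4]. apply lt_div_mult in t4; auto.
  eapply Rle_trans; [apply (B t); lra|]. rewrite (Rmult_comm _ t). apply Rmult_le_compat_r; lra.
Qed.

(** [F z] integrates [f] from [p] first horizontally, then vertically; the vanishing of [rint]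
    permits the other order. From [z = (x, y)] to [w = (x', y')] the increment is split at
    [(x', y)]: the first form of [F] computes the vertical part and the second form the horizontal
    part, and each is compared with the integral of the constant [f z]. *)
Theorem morera (S : C -> Prop) (f : C -> C) (p : C) : box S -> S p ->
  (forall w, S w -> ccont f w) ->
  (forall z, S z -> rint f (Re p) (Re z) (Im p) (Im z) = 0%C) ->
  exists F, forall z, S z -> cderiv F z (f z).
Proof.
  intros HS Hp Hc R0.
  destruct HS as [HO HB].
  set (F z := (hint f (Re p) (Re z) (Im p) + vint f (Re z) (Im p) (Im z))%C).
  assert (F2 : forall z, S z -> F z = (vint f (Re p) (Im p) (Im z) + hint f (Re p) (Re z) (Im z))%C).
  { intros z Hz. specialize (R0 z Hz). unfold rint in R0. unfold F.
    apply Cmod_sub_lt_eq. intros e He.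
    match goal with |- Cmod ?x < e => replace x with (RtoC 0) end.
    rewrite Cmod_0; auto. rewrite <- R0. ring. }
  assert (CH : forall a b y, S (a, y) -> S (b, y) -> cont_on (fun t => f (t, y)) a b).
  { intros a b y Ha Hb t Ht. apply ccont_horizontal, Hc, (HB _ _ _ Ha Hb).
    split; simpl; auto. apply Rminmax_l. }
  assert (CV : forall x c d, S (x, c) -> S (x, d) -> cont_on (fun t => f (x, t)) c d).
  { intros a b y Ha Hb t Ht. apply ccont_vertical, Hc, (HB _ _ _ Ha Hb).
    split; simpl; auto. apply Rminmax_l. }
  assert (HB1 : forall z w, S z -> S w -> S (Re z, Im w)).
  { intros z w Hz Hw. apply (HB z w); auto. split; simpl; auto using Rminmax_l, Rminmax_r. }
  exists F. intros z Hz. apply cderiv_intro. intros e He.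
  assert (He2 : 0 < e / 2) by lra.
  destruct (proj1 (locally_Cmod _ _) (filter_and _ _ (HO z Hz) (Hc z Hz _ He2))) as [d [Hd0 Hloc]].
  exists d; split; auto. intros w Hw.
  assert (Sw : S w) by (apply (Hloc w Hw)).
  destruct z as [x y], w as [x' y'], p as [p1 p2]. simpl in *.
  assert (Sm : S (x', y)) by (apply (HB1 (x', y') (x, y)); auto).
  assert (E1 : (F (x', y') - F (x', y) = vint f x' y y')%C).
  { unfold F, vint; simpl. rewrite <- (cint_Chasles _ p2 y y'). ring.
    - apply CV; auto. apply (HB1 (x', y') (p1, p2)); auto.
    - apply CV; auto. }
  assert (E2 : (F (x', y) - F (x, y) = hint f x x' y)%C).
  { rewrite !F2; auto. unfold hint; simpl. rewrite <- (cint_Chasles _ p1 x x'). ring.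
    - apply CH; auto. apply (HB1 (p1, p2) (x, y)); auto.
    - apply CH; auto. }
  replace (F (x', y') - F (x, y) - f (x, y) * ((x', y') - (x, y)))%C with
    ((hint f x x' y - RtoC (x' - x) * f (x, y)) +
     Ci * (cint (fun t => f (x', t)) y y' - RtoC (y' - y) * f (x, y)))%C.
  2:{ replace (F (x', y') - F (x, y))%C with ((F (x', y') - F (x', y)) + (F (x', y) - F (x, y)))%C by ring.
      rewrite E1, E2. unfold vint.
      replace ((x', y') - (x, y))%C with (RtoC (x' - x) + Ci * RtoC (y' - y))%C.
      ring. unfold Cminus, Cplus, Cmult, Copp, RtoC, Ci; simpl. f_equal; ring. }
  unfold hint. rewrite <- !cint_const.
  rewrite <- !cint_minus; auto using @ccont_const; try (intros t Ht; apply ccont_const).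
  assert (A1 := re_le_Cmod ((x', y') - (x, y))%C). assert (A2 := im_le_Cmod ((x', y') - (x, y))%C).
  simpl in A1, A2. change (Rabs (x' - x) <= Cmod ((x', y') - (x, y))) in A1.
  change (Rabs (y' - y) <= Cmod ((x', y') - (x, y))) in A2.
  assert (G : forall t s, in_rect x x' y y' (t, s) -> Cmod (f (t, s) - f (x, y)) <= e / 2).
  { intros t s Hts. left. apply Hloc. eapply Rle_lt_trans; [|exact Hw].
    destruct Hts as [h1 h2]; simpl in h1, h2.
    unfold Cmod. simpl. apply sqrt_le_1_alt. rewrite !Rmult_1_r.
    assert (sq : forall a b c, Rmin a b <= c <= Rmax a b -> (c - a) * (c - a) <= (b - a) * (b - a)).
    { clear. intros a b c H. unfold Rmin, Rmax in H; destruct Rle_dec; nra. }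
    apply Rplus_le_compat; apply sq; auto. }
  eapply Rle_trans; [apply Cmod_triangle|]. rewrite Cmod_mult, Cmod_Ci, Rmult_1_l.
  apply Rle_trans with (e / 2 * Rabs (x' - x) + e / 2 * Rabs (y' - y)); [|nra].
  apply Rplus_le_compat.
  - apply cint_ML.
    + intros t Ht. apply ccont_minus; [|apply ccont_const]. apply (CH x x' y); auto.
    + intros t Ht. apply G. split; simpl; auto using Rminmax_l.
  - apply cint_ML.
    + intros t Ht. apply ccont_minus; [|apply ccont_const]. apply (CV x' y y'); auto.
    + intros t Ht. apply G. split; simpl; auto using Rminmax_r.
Qed.

(** The exceptional point [p] is allowed for the sake of difference quotients. *)
Theorem primitive (S : C -> Prop) (f : C -> C) (p : C) : box S -> S p ->
  (forall w, S w -> ccont f w) -> (forall w, S w -> w <> p -> exists l, cderiv f w l) ->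
  exists F, forall z, S z -> cderiv F z (f z).
Proof.
  intros HS Hp Hc Hd. apply (morera S f p); auto. intros z Hz. apply (rint_corner_0 S f p z); auto.
Qed.

(** * Cauchy's integral formula *)

Definition expi (t : R) : C := (cos t, sin t).
Definition circ (c : C) (r t : R) : C := (c + RtoC r * expi t)%C.

Lemma Cmod_expi (t : R) : Cmod (expi t) = 1.
Proof.
  unfold expi, Cmod; simpl. rewrite !Rmult_1_r.
  replace (cos t * cos t + sin t * sin t) with 1. apply sqrt_1.
  generalize (sin2_cos2 t); unfold Rsqr; lra.
Qed.

Lemma expi_neq_0 (t : R) : expi t <> 0%C.
Proof. apply Cmod_gt_0. rewrite Cmod_expi. lra. Qed.

Lemma rderiv_expi (t : R) : rderiv expi t (Ci * expi t)%C.
Proof.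
  replace (Ci * expi t)%C with ((- sin t, cos t) : C).
  - apply rderiv_intro; auto_derive; auto; ring.
  - unfold expi, Ci, Cmult; simpl. f_equal; ring.
Qed.

Lemma rderiv_circ (c : C) (r t : R) : rderiv (circ c r) t (RtoC r * (Ci * expi t))%C.
Proof.
  eapply gder_eq. apply gder_plus. apply gder_const. apply gder_scal. apply ccont_RtoC.
  apply rderiv_expi. ring.
Qed.

Lemma Cmod_circ (c : C) (r t : R) : 0 <= r -> Cmod (circ c r t - c) = r.
Proof.
  intros H. unfold circ. replace (c + RtoC r * expi t - c)%C with (RtoC r * expi t)%C by ring.
  rewrite Cmod_mult, Cmod_expi, Cmod_R, Rabs_pos_eq; auto. ring.
Qed.

Lemma circ_dist (c z : C) (r t : R) : 0 <= r ->
  r - Cmod (z - c) <= Cmod (circ c r t - z) <= r + Cmod (z - c).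
Proof.
  intros H. assert (E := Cmod_circ c r t H).
  generalize (Cmod_sub_triangle z (circ c r t) c) (Cmod_sub_triangle c (circ c r t) z).
  rewrite (Cmod_sub_comm c z). lra.
Qed.

Lemma circ_2PI (c : C) (r : R) : circ c r (2 * PI) = circ c r 0.
Proof. unfold circ, expi. rewrite cos_2PI, sin_2PI, cos_0, sin_0. reflexivity. Qed.

Lemma ccont_expi (t : R) : ccont expi t.
Proof. eapply rderiv_cont, rderiv_expi. Qed.

Lemma ccont_circ (c : C) (r t : R) : ccont (circ c r) t.
Proof. eapply rderiv_cont, rderiv_circ. Qed.

Lemma Cmult_opp_Ci_Ci (x : C) : (- Ci * (Ci * x))%C = x.
Proof. destruct x. unfold Ci, Cmult, Copp; simpl. f_equal; ring. Qed.

Lemma loop_zero (F f : C -> C) (c : C) (r : R) : 0 <= r ->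
  (forall w, Cmod (w - c) <= r -> cderiv F w (f w) /\ ccont f w) ->
  cint (fun t => f (circ c r t) * (RtoC r * expi t))%C 0 (2 * PI) = 0%C.
Proof.
  intros Hr H.
  assert (K : forall t, cderiv F (circ c r t) (f (circ c r t)) /\ ccont f (circ c r t)).
  { intros t. apply H. rewrite Cmod_circ; lra. }
  assert (Cf : forall t, ccont (fun t => f (circ c r t) * (RtoC r * expi t))%C t).
  { intros t. apply ccont_mult. apply ccont_comp. apply ccont_circ. apply K.
    apply ccont_mult. apply ccont_const. apply ccont_expi. }
  (* The factor [Ci] coming from the derivative of [circ] is restored for the fundamental theorem
     and removed again by [- Ci]. *)
  replace (cint (fun t => f (circ c r t) * (RtoC r * expi t))%C 0 (2 * PI)) with
    (- Ci * cint (fun t => Ci * (f (circ c r t) * (RtoC r * expi t)))%C 0 (2 * PI))%C.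
  - rewrite (cint_FTC (fun t => F (circ c r t))).
    + rewrite circ_2PI. ring.
    + intros t _. eapply gder_eq. apply rderiv_chain. apply rderiv_circ. apply K. ring.
    + intros t _. apply ccont_mult. apply ccont_const. apply Cf.
  - rewrite cint_scal by (intros t _; apply Cf).
    apply Cmult_opp_Ci_Ci.
Qed.

Lemma cderiv_const_segment (h : C -> C) (c z : C) (r : R) :
  (forall w, Cmod (w - c) < r -> cderiv h w 0%C) -> Cmod (z - c) < r -> h z = h c.
Proof.
  intros H Hz. assert (E : cint (fun _ => 0%C) 0 1 = (h z - h c)%C).
  { rewrite (cint_FTC (fun t => h (c + RtoC t * (z - c)))%C).
    - f_equal; [|f_equal]; f_equal; ring.
    - intros t Ht. eapply gder_eq. apply rderiv_chain.
      + apply gder_plus. apply gder_const. apply gder_mult. apply ccont_RtoC.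
        apply gder_param. apply gder_const.
      + apply H. replace (c + RtoC t * (z - c) - c)%C with (RtoC t * (z - c))%C by ring.
        rewrite Cmod_mult, Cmod_R. rewrite Rmin_left, Rmax_right in Ht by lra.
        rewrite Rabs_pos_eq by lra. generalize (Cmod_ge_0 (z - c)). nra.
      + ring.
    - intros t _. apply ccont_const. }
  rewrite cint_const in E. replace (h z) with ((h z - h c) + h c)%C by ring.
  rewrite <- E. ring.
Qed.

(** A remainder that is quadratic in [w - z], uniformly in [t], is the form in which algebraic
    identities for the Cauchy kernels justify differentiation under the integral. *)
Lemma cint_param_cderiv (G : C -> R -> C) (H : R -> C) (z : C) (a b K d : R) :
  0 < d -> 0 <= K -> (forall w, Cmod (w - z) < d -> cont_on (G w) a b) -> cont_on H a b ->
  (forall w t, Cmod (w - z) < d -> Rmin a b <= t <= Rmax a b ->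
     Cmod (G w t - G z t - H t * (w - z)) <= K * (Cmod (w - z) * Cmod (w - z))) ->
  cderiv (fun w => cint (G w) a b) z (cint H a b).
Proof.
  intros Hd HK HG HH HB. apply cderiv_intro. intros e He.
  set (L := K * Rabs (b - a)). assert (HL : 0 <= L) by (apply Rmult_le_pos; auto; apply Rabs_pos).
  assert (He' : 0 < e / (L + 1)) by (apply Rdiv_lt_0_compat; lra).
  exists (Rmin d (e / (L + 1))). split; [apply Rmin_glb_lt; auto|].
  intros w Hw. destruct (Rlt_Rmin _ _ _ Hw) as [Hw1 Hw2].
  assert (Hz : Cmod (z - z) < d).
  { rewrite Cmod_self; auto. }
  assert (CH : cont_on (fun t => (w - z) * H t)%C a b).
  { intros t Ht. apply ccont_mult; auto. apply ccont_const. }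
  assert (CG : cont_on (fun t => G w t - G z t)%C a b).
  { intros t Ht. apply ccont_minus; [apply (HG w)|apply (HG z)]; auto. }
  replace (cint (G w) a b - cint (G z) a b - cint H a b * (w - z))%C
    with (cint (fun t => (G w t - G z t) - (w - z) * H t)%C a b).
  2:{ rewrite (cint_minus _ _ _ _ CG CH), cint_scal, cint_minus; auto. ring. }
  eapply Rle_trans; [apply (cint_ML _ _ _ (K * (Cmod (w - z) * Cmod (w - z))))|].
  - intros t Ht. apply ccont_minus; auto.
  - intros t Ht. rewrite (Cmult_comm (w - z)). auto.
  - assert (N := Cmod_ge_0 (w - z)). set (m := Cmod (w - z)) in *.
    replace (K * (m * m) * Rabs (b - a)) with (L * m * m) by (unfold L; ring).
    apply Rmult_le_compat_r; auto.
    apply lt_div_mult in Hw2; [|lra]. nra.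
Qed.

Lemma cont_on_bounded (f : R -> C) (a b : R) : cont_on f a b ->
  exists M, 0 <= M /\ forall t, Rmin a b <= t <= Rmax a b -> Cmod (f t) <= M.
Proof.
  intros H. destruct (bounded_continuity (V := R_NormedModule) (fun t => Cmod (f t)) (Rmin a b) (Rmax a b))
    as [M HM].
  - intros t Ht. apply filterlim_locally. intros e. generalize (H t Ht e (cond_pos e)).
    apply filter_imp. intros s Hs. change (Rabs (Cmod (f s) - Cmod (f t)) < e).
    generalize (Cmod_le_sub (f s) (f t)) (Cmod_le_sub (f t) (f s)).
    rewrite (Cmod_sub_comm (f t)). intros. apply Rabs_def1; lra.
  - exists M. split.
    + assert (h := HM a (Rminmax_l a b)). eapply Rle_trans; [|left; exact h]. apply (norm_ge_0 (V := R_NormedModule)).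
    + intros t Ht. left. eapply Rle_lt_trans; [|apply (HM t Ht)]. apply Rle_abs.
Qed.

(** The factor [i] of [dw = i r expi t dt] is left out of the density [psi]. *)
Definition cauchy1 (c : C) (r : R) (psi : R -> C) (z : C) : C :=
  cint (fun t => psi t * / (circ c r t - z))%C 0 (2 * PI).
Definition cauchy2 (c : C) (r : R) (psi : R -> C) (z : C) : C :=
  cint (fun t => psi t * (/ (circ c r t - z) * / (circ c r t - z)))%C 0 (2 * PI).

Lemma circ_neq (c z : C) (r t : R) : Cmod (z - c) < r -> (circ c r t - z <> 0)%C.
Proof.
  intros H. apply Cmod_gt_0. assert (h := Cmod_ge_0 (z - c)).
  destruct (circ_dist c z r t); lra.
Qed.

Lemma ccont_kernel (c z : C) (r t : R) : Cmod (z - c) < r -> ccont (fun t => / (circ c r t - z))%C t.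
Proof.
  intros H. apply (ccont_inv (fun t => circ c r t - z)%C); [|apply circ_neq; auto].
  apply ccont_minus; [apply ccont_circ|apply ccont_const].
Qed.

Lemma cauchy_cont (c z : C) (r : R) (psi : R -> C) (t : R) : Cmod (z - c) < r ->
  ccont psi t -> ccont (fun t => psi t * / (circ c r t - z))%C t.
Proof. intros H Hp. apply ccont_mult; auto. apply ccont_kernel; auto. Qed.

(** [m] is the distance from [z] to the circle; a point within [m / 2] of [z] stays at distance at
    least [m / 2] from the circle, whence the bound [2 / m]. *)
Lemma cauchy_near (c z w : C) (r t : R) :
  Cmod (z - c) < r -> Cmod (w - z) < (r - Cmod (z - c)) / 2 ->
  let m := r - Cmod (z - c) in let q := (circ c r t - z)%C in let h := (w - z)%C in
  0 < m /\ q <> 0%C /\ (q - h <> 0)%C /\ Cmod (w - c) < r /\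
  Cmod q <= 2 * r /\ Cmod (/ q) <= / m /\ Cmod (/ (q - h)) <= 2 / m.
Proof.
  intros H Hw m q h. assert (h0 := Cmod_ge_0 (z - c)). assert (Hr : 0 <= r) by lra.
  destruct (circ_dist c z r t Hr) as [d1 d2].
  assert (Hm : 0 < m) by (unfold m; lra).
  assert (Hwc : Cmod (w - c) < r).
  { generalize (Cmod_sub_triangle z w c). lra. }
  assert (Eq : (q - h)%C = (circ c r t - w)%C) by (unfold q, h; ring).
  assert (D : m / 2 <= Cmod (q - h)).
  { generalize (Cmod_le_sub q h) . fold q in d1. fold h in Hw. fold m in d1, Hw.
    intros k. lra. }
  assert (N1 : q <> 0%C) by (apply circ_neq; auto).
  assert (N2 : (q - h <> 0)%C) by (apply Cmod_gt_0; lra).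
  repeat (split; auto).
  - unfold q; lra.
  - rewrite Cmod_inv by auto. apply Rinv_le_contravar; auto.
  - rewrite Cmod_inv by auto. replace (2 / m) with (/ (m / 2)) by (field; lra).
    apply Rinv_le_contravar; lra.
Qed.

Lemma Cmod_mult_le (a b : C) (x y : R) : Cmod a <= x -> Cmod b <= y -> Cmod (a * b) <= x * y.
Proof. intros. rewrite Cmod_mult. apply Rmult_le_compat; auto; apply Cmod_ge_0. Qed.

Lemma cauchy1_cderiv (c z : C) (r : R) (psi : R -> C) : (forall t, ccont psi t) ->
  Cmod (z - c) < r -> cderiv (cauchy1 c r psi) z (cauchy2 c r psi z).
Proof.
  intros Hp H. destruct (cont_on_bounded psi 0 (2 * PI)) as [M [HM0 HM]]; [intros t _; auto|].
  set (m := r - Cmod (z - c)).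
  assert (Hm : 0 < m) by (unfold m; lra). assert (Hi : 0 < / m) by (apply Rinv_0_lt_compat; auto).
  apply (cint_param_cderiv _ _ _ _ _ (M * (/ m * / m * (2 / m))) (m / 2)); [lra| | | |].
  - unfold Rdiv. repeat apply Rmult_le_pos; lra.
  - intros w Hw t _. apply cauchy_cont; auto.
    apply (cauchy_near c z w r t); auto.
  - intros t _. repeat apply ccont_mult; auto; apply ccont_kernel; auto.
  - intros w t Hw Ht. destruct (cauchy_near c z w r t H Hw) as [_ [h2 [h3 [_ [_ [h6 h7]]]]]].
    fold m in h6, h7.
    replace (circ c r t - w)%C with (circ c r t - z - (w - z))%C by ring.
    set (q := (circ c r t - z)%C) in *. set (h := (w - z)%C) in *.
    replace (psi t * / (q - h) - psi t * / q - psi t * (/ q * / q) * h)%C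
      with (psi t * (/ q * / q * / (q - h)) * (h * h))%C by (field; auto).
    rewrite (Cmod_mult _ (h * h)), (Cmod_mult h). apply Rmult_le_compat_r.
    apply Rmult_le_pos; apply Cmod_ge_0.
    repeat apply Cmod_mult_le; auto.
Qed.

Lemma cauchy2_cderiv (c z : C) (r : R) (psi : R -> C) : (forall t, ccont psi t) ->
  Cmod (z - c) < r -> exists l, cderiv (cauchy2 c r psi) z l.
Proof.
  intros Hp H. destruct (cont_on_bounded psi 0 (2 * PI)) as [M [HM0 HM]]; [intros t _; auto|].
  set (m := r - Cmod (z - c)).
  assert (Hr : 0 < r) by (generalize (Cmod_ge_0 (z - c)); lra).
  assert (Hm : 0 < m) by (unfold m; lra). assert (Hi : 0 < / m) by (apply Rinv_0_lt_compat; auto).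
  set (H3 t := (psi t * (2 * (/ (circ c r t - z) * (/ (circ c r t - z) * / (circ c r t - z)))))%C).
  exists (cint H3 0 (2 * PI)).
  (* [6 * r + m] bounds the numerator [3 * q - 2 * h] of the remainder, as [|q| <= 2 * r] and
     [|h| < m / 2]. *)
  apply (cint_param_cderiv _ _ _ _ _
    (M * ((6 * r + m) * ((/ m * (/ m * / m)) * (2 / m * (2 / m))))) (m / 2)); [lra| | | |].
  - unfold Rdiv. repeat apply Rmult_le_pos; lra.
  - intros w Hw t _. assert (Hw2 : Cmod (w - c) < r) by (apply (cauchy_near c z w r t); auto).
    repeat apply ccont_mult; auto; apply ccont_kernel; auto.
  - intros t _. repeat apply ccont_mult; auto; apply ccont_const || (apply ccont_kernel; auto).
  - intros w t Hw Ht. destruct (cauchy_near c z w r t H Hw) as [_ [h2 [h3 [_ [h5 [h6 h7]]]]]].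
    fold m in h6, h7. unfold H3. fold m in Hw.
    replace (circ c r t - w)%C with (circ c r t - z - (w - z))%C by ring.
    set (q := (circ c r t - z)%C) in *. set (h := (w - z)%C) in *.
    replace (psi t * (/ (q - h) * / (q - h)) - psi t * (/ q * / q) - psi t * (2 * (/ q * (/ q * / q))) * h)%C
      with (psi t * ((3 * q - 2 * h) * ((/ q * (/ q * / q)) * (/ (q - h) * / (q - h)))) * (h * h))%C
      by (field; auto).
    rewrite (Cmod_mult _ (h * h)), (Cmod_mult h). apply Rmult_le_compat_r.
    apply Rmult_le_pos; apply Cmod_ge_0.
    repeat apply Cmod_mult_le; auto.
    eapply Rle_trans; [apply Cmod_sub_le|]. rewrite !Cmod_mult, !Cmod_R, !Rabs_pos_eq by lra. lra.
Qed.

(** The integral does not depend on [z]: its derivative in [z] is the integral along the closed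
    circle of a function with primitive [- / (circ c r t - z)]. At the centre the integrand is
    [1]. *)
Lemma winding (c z : C) (r : R) : Cmod (z - c) < r ->
  cauchy1 c r (fun t => RtoC r * expi t)%C z = RtoC (2 * PI).
Proof.
  intros H. assert (Hr : 0 < r) by (generalize (Cmod_ge_0 (z - c)); lra).
  set (psi t := (RtoC r * expi t)%C).
  assert (Cp : forall t, ccont psi t).
  { intros t. apply ccont_mult. apply ccont_const. apply ccont_expi. }
  assert (Hr0 : RtoC r <> 0%C) by (intros E; apply (f_equal Re) in E; simpl in E; lra).
  rewrite (cderiv_const_segment (cauchy1 c r psi) c z r); auto.
  - unfold cauchy1. rewrite (cint_ext _ (fun _ => 1%C)).
    + rewrite cint_const. rewrite Rminus_0_r. ring.
    + intros t _. unfold psi, circ.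
      replace (c + RtoC r * expi t - c)%C with (RtoC r * expi t)%C by ring.
      apply Cinv_r, Cmult_neq_0; auto. apply expi_neq_0.
  - intros w Hw. eapply gder_eq. apply cauchy1_cderiv; auto.
    unfold cauchy2.
    rewrite (cint_ext _ (fun t => - Ci * (Ci * (psi t * (/ (circ c r t - w) * / (circ c r t - w)))))%C).
    2:{ intros t _. symmetry. apply Cmult_opp_Ci_Ci. }
    assert (Cq : forall t, ccont (fun t => Ci * (psi t * (/ (circ c r t - w) * / (circ c r t - w))))%C t).
    { intros t. repeat apply ccont_mult; auto; apply ccont_const || apply ccont_expi || (apply ccont_kernel; auto). }
    rewrite cint_scal by (intros t _; apply Cq).
    rewrite (cint_FTC (fun t => - / (circ c r t - w))%C).
    + rewrite circ_2PI. ring.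
    + intros t _. eapply gder_eq. apply gder_opp, gder_inv. apply ccont_RtoC.
      apply gder_minus. apply rderiv_circ. apply gder_const. apply circ_neq; auto.
      unfold psi. field. apply circ_neq; auto.
    + intros t _. apply Cq.
Qed.

Lemma ccont_quotient (f : C -> C) (z l : C) : cderiv f z l ->
  ccont (fun w => if Ceq_dec w z then l else (f w - f z) / (w - z))%C z.
Proof.
  intros H. unfold ccont. destruct (Ceq_dec z z) as [_|N]; [|congruence].
  destruct H as [p [H1 H2]].
  intros e He. generalize (filter_and _ _ H1 (H2 e He)). apply filter_imp. intros w [h1 h2].
  destruct (Ceq_dec w z) as [->|N].
  - rewrite Cmod_self; auto.
  - rewrite h1. assert (N' := Csub_neq_0 _ _ N).
    replace (p w * (w - z) / (w - z))%C with (p w) by (field; auto). auto.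
Qed.

(** The difference quotient of [f] at [z], completed by the derivative, is continuous on [S] and
    differentiable off [z]. It therefore has a primitive, its integral along the circle vanishes,
    and [winding] evaluates the part containing [f z]. *)
Theorem cauchy_formula (S : C -> Prop) (f : C -> C) (c z : C) (r : R) : box S ->
  (forall w, Cmod (w - c) <= r -> S w) -> (forall w, S w -> exists l, cderiv f w l) ->
  Cmod (z - c) < r ->
  cauchy1 c r (fun t => f (circ c r t) * (RtoC r * expi t))%C z = (RtoC (2 * PI) * f z)%C.
Proof.
  intros HS Hr Hf Hz.
  assert (Hr0 : 0 < r) by (generalize (Cmod_ge_0 (z - c)); lra).
  assert (Sz : S z) by (apply Hr; lra).
  destruct (Hf z Sz) as [l Hl].
  set (q w := (if Ceq_dec w z then l else (f w - f z) / (w - z))%C).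
  assert (Lq : forall w, w <> z -> locally w (fun u => ((f u - f z) / (u - z))%C = q u)).
  { intros w N. apply locally_Cmod. exists (Cmod (w - z)). split.
    - apply Cmod_gt_0, Csub_neq_0; auto.
    - intros u Hu. unfold q. destruct (Ceq_dec u z) as [->|]; auto.
      rewrite Cmod_sub_comm in Hu. lra. }
  assert (Dq : forall w, S w -> w <> z -> exists l, cderiv q w l).
  { intros w Hw N. destruct (Hf w Hw) as [m Hm]. eexists. eapply gder_loc. apply Lq; auto.
    apply (gder_div (fun z => z) (fun u => f u - f z)%C (fun u => u - z)%C).
    - apply ccont_id.
    - apply gder_minus. exact Hm. apply gder_const.
    - apply gder_minus. apply gder_param. apply gder_const.
    - apply Csub_neq_0; auto. }
  assert (Cq : forall w, S w -> ccont q w).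
  { intros w Hw. destruct (Ceq_dec w z) as [->|N].
    - apply ccont_quotient; auto.
    - apply ccont_of_cderiv. auto. }
  destruct (primitive S q z HS Sz Cq Dq) as [Q HQ].
  assert (L0 : cint (fun t => q (circ c r t) * (RtoC r * expi t))%C 0 (2 * PI) = 0%C).
  { apply (loop_zero Q); auto. lra. }
  set (psi t := (RtoC r * expi t)%C).
  assert (Cp : forall t, ccont psi t).
  { intros t. apply ccont_mult. apply ccont_const. apply ccont_expi. }
  assert (Cfp : forall t, ccont (fun t => f (circ c r t) * psi t)%C t).
  { intros t. apply ccont_mult; auto. apply ccont_comp. apply ccont_circ.
    apply ccont_of_cderiv, Hf, Hr. rewrite Cmod_circ; lra. }
  rewrite (cint_ext _ (fun t => f (circ c r t) * psi t * / (circ c r t - z) -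
     f z * (psi t * / (circ c r t - z)))%C) in L0.
  - rewrite cint_minus, cint_scal in L0.
    + assert (W := winding c z r Hz). unfold cauchy1, psi in *. rewrite W in L0.
      replace (RtoC (2 * PI) * f z)%C with (f z * RtoC (2 * PI) + 0)%C by ring.
      rewrite <- L0. ring.
    + intros t _. apply cauchy_cont; auto.
    + intros t _. apply cauchy_cont; auto.
    + intros t _. apply ccont_mult. apply ccont_const. apply cauchy_cont; auto.
  - intros t _. unfold q, psi. assert (N := circ_neq c z r t Hz).
    destruct (Ceq_dec (circ c r t) z) as [E|_].
    + exfalso. apply N. rewrite E. ring.
    + field; auto.
Qed.

(** * Local Cauchy formulas and their consequences *)

Definition square (c : C) (s : R) (w : C) : Prop :=
  Rabs (Re w - Re c) < s /\ Rabs (Im w - Im c) < s.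

Lemma square_disc (c w : C) (s : R) : square c s w -> Cmod (w - c) < 2 * s.
Proof.
  intros [h1 h2]. eapply Rle_lt_trans; [apply Cmod_le_abs|].
  simpl in *. unfold Re, Im, Rminus in *. lra.
Qed.

Lemma disc_square (c w : C) (s : R) : Cmod (w - c) < s -> square c s w.
Proof.
  intros H. split; (eapply Rle_lt_trans; [|exact H]).
  apply (re_le_Cmod (w - c)). apply (im_le_Cmod (w - c)).
Qed.

Lemma box_square (c : C) (s : R) : box (square c s).
Proof.
  split.
  - apply open_Cmod. intros z [h1 h2].
    set (d := Rmin (s - Rabs (Re z - Re c)) (s - Rabs (Im z - Im c))).
    exists d. split; [apply Rmin_glb_lt; lra|].
    intros w Hw.
    assert (k1 : d <= s - Rabs (Re z - Re c)) by apply Rmin_l.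
    assert (k2 : d <= s - Rabs (Im z - Im c)) by apply Rmin_r.
    assert (a1 := re_le_Cmod (w - z)). assert (a2 := im_le_Cmod (w - z)).
    change (Rabs (Re w - Re z) <= Cmod (w - z)) in a1.
    change (Rabs (Im w - Im z) <= Cmod (w - z)) in a2.
    split.
    + replace (Re w - Re c) with ((Re w - Re z) + (Re z - Re c)) by ring.
      eapply Rle_lt_trans; [apply Rabs_triang|]. lra.
    + replace (Im w - Im c) with ((Im w - Im z) + (Im z - Im c)) by ring.
      eapply Rle_lt_trans; [apply Rabs_triang|]. lra.
  - intros z w u [h1 h2] [h3 h4] [h5 h6]. split; apply Rabs_def1.
    all: apply Rabs_def2 in h1, h2, h3, h4; minmax.
Qed.

Lemma box_plane : box (fun _ => True).
Proof. split; auto. apply open_true. Qed.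

Lemma box_segment (S : C -> Prop) (p z : C) (t : R) : box S -> S p -> S z -> 0 <= t <= 1 ->
  S (p + RtoC t * (z - p))%C.
Proof.
  intros [_ HB] Hp Hz Ht. apply (HB p z); auto. split; simpl.
  - replace (fst p + (t * (fst z + - fst p) - 0 * (snd z + - snd p)))
      with (fst p + t * (fst z - fst p)) by ring. apply between_mid; auto.
  - replace (snd p + (t * (snd z + - snd p) + 0 * (fst z + - fst p)))
      with (snd p + t * (snd z - snd p)) by ring. apply between_mid; auto.
Qed.

Lemma RtoC_neq_0 (x : R) : x <> 0 -> RtoC x <> 0%C.
Proof. intros H E. apply H. apply (f_equal Re) in E. exact E. Qed.

(** The formula is applied in the square of half-side [R / 2], a box contained in the disc of radius
    [R] and containing the closed disc of radius [R / 4]. This radius is the origin of the factor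
    [4] in [cauchy_estimate]. *)
Lemma local_cauchy (f : C -> C) (c : C) (R : R) : 0 < R ->
  (forall w, Cmod (w - c) < R -> exists l, cderiv f w l) ->
  forall z, Cmod (z - c) < R / 4 ->
  cauchy1 c (R / 4) (fun t => f (circ c (R / 4) t) * (RtoC (R / 4) * expi t))%C z = (RtoC (2 * PI) * f z)%C.
Proof.
  intros HR H z Hz. apply (cauchy_formula (square c (R / 2))); auto.
  - apply box_square.
  - intros w Hw. apply disc_square. lra.
  - intros w Hw. apply H. apply square_disc in Hw. lra.
Qed.

Lemma two_PI_neq_0 : RtoC (2 * PI) <> 0%C.
Proof. apply RtoC_neq_0. generalize PI_RGT_0; lra. Qed.

Lemma ccont_cauchy_density (f : C -> C) (c : C) (r t : R) : 0 <= r ->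
  (forall w, Cmod (w - c) <= r -> ccont f w) ->
  ccont (fun t => f (circ c r t) * (RtoC r * expi t))%C t.
Proof.
  intros Hr H. apply ccont_mult. apply ccont_comp. apply ccont_circ.
  apply H. rewrite Cmod_circ; lra. apply ccont_mult. apply ccont_const. apply ccont_expi.
Qed.

Lemma local_cauchy_deriv (f f' : C -> C) (c : C) (R : R) : 0 < R ->
  (forall w, Cmod (w - c) < R -> cderiv f w (f' w)) ->
  forall z, Cmod (z - c) < R / 4 ->
  f' z = (/ RtoC (2 * PI) *
    cauchy2 c (R / 4) (fun t => f (circ c (R / 4) t) * (RtoC (R / 4) * expi t)) z)%C.
Proof.
  intros HR H z Hz.
  set (psi t := (f (circ c (R / 4) t) * (RtoC (R / 4) * expi t))%C).
  assert (Cp : forall t, ccont psi t).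
  { intros t. apply ccont_cauchy_density; [lra|]. intros w Hw. eapply cderiv_cont, H. lra. }
  apply (cderiv_unique f z); [apply H; lra|].
  apply gder_loc with (fun w => / RtoC (2 * PI) * cauchy1 c (R / 4) psi w)%C.
  - apply locally_Cmod. exists (R / 4 - Cmod (z - c)). split; [lra|]. intros w Hw.
    unfold psi. rewrite local_cauchy; auto.
    + field. apply two_PI_neq_0.
    + intros u Hu. exists (f' u); auto.
    + generalize (Cmod_sub_triangle z w c). lra.
  - apply gder_scal. apply ccont_id. apply cauchy1_cderiv; auto.
Qed.

(** Locally [f'] is a multiple of a [cauchy2] integral, which is differentiable in its parameter
    whatever the continuous density. *)
Theorem cderiv_deriv (f f' : C -> C) (z : C) (d : R) : 0 < d ->
  (forall w, Cmod (w - z) < d -> cderiv f w (f' w)) -> exists l, cderiv f' z l.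
Proof.
  intros Hd H.
  set (psi t := (f (circ z (d / 4) t) * (RtoC (d / 4) * expi t))%C).
  destruct (cauchy2_cderiv z z (d / 4) psi) as [l Hl].
  - intros t. apply ccont_cauchy_density; [lra|]. intros w Hw. eapply cderiv_cont, H. lra.
  - rewrite Cmod_self. lra.
  - eexists. eapply gder_loc; [|apply gder_scal; [apply ccont_id|exact Hl]].
    apply locally_Cmod. exists (d / 4). split; [lra|]. intros w Hw.
    symmetry. apply local_cauchy_deriv; auto.
Qed.

(** The limit is continuous and its rectangle integrals vanish, being limits of those of [u n].
    Morera then presents it as the derivative of a holomorphic function, hence holomorphic
    itself. *)
Theorem weierstrass (u : nat -> C -> C) (f : C -> C) (z : C) (d : R) (N0 : nat) : 0 < d ->
  (forall n w, (N0 <= n)%nat -> Cmod (w - z) < d -> exists l, cderiv (u n) w l) ->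
  (forall e, 0 < e -> exists N, forall n w, (N <= n)%nat -> Cmod (w - z) < d ->
     Cmod (u n w - f w) < e) ->
  exists l, cderiv f z l.
Proof.
  intros Hd Hu Hl.
  assert (Cf : forall w, Cmod (w - z) < d -> ccont f w).
  { intros w Hw e He. assert (He3 : 0 < e / 3) by lra.
    destruct (Hl _ He3) as [N HN]. set (n := Nat.max N N0).
    assert (n1 : (N <= n)%nat) by apply Nat.le_max_l.
    assert (n2 : (N0 <= n)%nat) by apply Nat.le_max_r.
    destruct (proj1 (locally_Cmod _ _) (ccont_of_cderiv _ _ (Hu n w n2 Hw) _ He3)) as [d' [Hd' H']].
    apply locally_Cmod. exists (Rmin d' (d - Cmod (w - z))). split; [apply Rmin_glb_lt; lra|].
    intros v Hv.
    destruct (Rlt_Rmin _ _ _ Hv) as [v1 v2].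
    assert (v3 : Cmod (v - z) < d) by (generalize (Cmod_sub_triangle w v z); lra).
    generalize (HN n v n1 v3) (HN n w n1 Hw) (H' v v1)
      (Cmod_sub_triangle (u n v) (f v) (f w)) (Cmod_sub_triangle (u n w) (u n v) (f w)).
    rewrite (Cmod_sub_comm (f v) (u n v)). lra. }
  destruct (morera (square z (d / 2)) f z) as [G HG].
  - apply box_square.
  - apply disc_square. rewrite Cmod_self. lra.
  - intros w Hw. apply Cf. apply square_disc in Hw. lra.
  - intros w Hw. set (L := Rabs (Re w - Re z) + Rabs (Im w - Im z)).
    apply (Cmod_small_eq_0 _ (2 * L)).
    { unfold L; generalize (Rabs_pos (Re w - Re z)) (Rabs_pos (Im w - Im z)); lra. }
    intros e He.
    assert (Hin : forall v, in_rect (Re z) (Re w) (Im z) (Im w) v -> Cmod (v - z) < d).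
    { intros v Hv. replace d with (2 * (d / 2)) by field. apply square_disc.
      apply (proj2 (box_square z (d / 2)) z w); auto. apply disc_square. rewrite Cmod_self. lra. }
    destruct (Hl e He) as [N HN]. set (n := Nat.max N N0).
    assert (Hn : (N <= n)%nat /\ (N0 <= n)%nat) by (split; [apply Nat.le_max_l|apply Nat.le_max_r]).
    assert (E : rint f (Re z) (Re w) (Im z) (Im w) =
      (- rint (fun v => u n v - f v) (Re z) (Re w) (Im z) (Im w))%C).
    { rewrite rint_minus, (goursat (u n)).
      - ring.
      - intros v Hv. apply Hu; auto. apply Hn.
      - intros v Hv. apply ccont_of_cderiv, Hu; auto. apply Hn.
      - auto. }
    rewrite E, Cmod_opp. eapply Rle_trans; [apply (rint_ML _ _ _ _ _ e)|].
    + intros v Hv. apply ccont_minus; auto. apply ccont_of_cderiv, Hu; auto. apply Hn.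
    + intros v Hv. left. apply HN; auto. apply Hn.
    + fold L. right; ring.
  - apply (cderiv_deriv G f z (d / 2)); [lra|]. intros w Hw. apply HG, disc_square; auto.
Qed.

Theorem cauchy_estimate (f f' : C -> C) (c : C) (R B : R) : 0 < R ->
  (forall w, Cmod (w - c) < R -> cderiv f w (f' w) /\ Cmod (f w) <= B) ->
  Cmod (f' c) <= 4 * B / R.
Proof.
  intros HR H. assert (HP := PI_RGT_0). set (r := R / 4). assert (Hr : 0 < r) by (unfold r; lra).
  assert (Hc : forall t, Cmod (circ c r t - c) < R) by (intros; rewrite Cmod_circ; unfold r; lra).
  rewrite (local_cauchy_deriv f f' c R) by (try rewrite Cmod_self; try lra; intros; apply H; auto).
  fold r. rewrite Cmod_mult, Cmod_inv, Cmod_R, Rabs_pos_eq by (lra || apply two_PI_neq_0).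
  apply (Rmult_le_reg_l (2 * PI)); [lra|]. rewrite <- Rmult_assoc, Rinv_r, Rmult_1_l by lra.
  unfold cauchy2. rewrite (cint_ext _ (fun t => f (circ c r t) * (/ RtoC r * / expi t))%C).
  - eapply Rle_trans; [apply (cint_ML _ _ _ (B * (/ r * / 1)))|].
    + intros t _. apply ccont_mult; [|apply ccont_mult; [apply ccont_const|]].
      * apply ccont_comp; [apply ccont_circ|]. eapply cderiv_cont, H; auto.
      * apply ccont_inv; [apply ccont_expi|apply expi_neq_0].
    + intros t _. apply Cmod_mult_le; [apply H; auto|apply Cmod_mult_le].
      * rewrite Cmod_inv, Cmod_R, Rabs_pos_eq by (lra || (apply RtoC_neq_0; lra)). lra.
      * rewrite Cmod_inv, Cmod_expi by apply expi_neq_0. lra.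
    + rewrite Rminus_0_r, Rabs_pos_eq by lra. right. unfold r. field. lra.
  - intros t _. unfold circ. replace (c + RtoC r * expi t - c)%C with (RtoC r * expi t)%C by ring.
    field. split; [apply expi_neq_0|apply RtoC_neq_0; lra].
Qed.

(** [cauchy_estimate] for the Cayley transform [(f - a)/(f + conj a)], [a = f c]. *)
Lemma re_pos_deriv (f f' : C -> C) (c : C) (R : R) : 0 < R -> 0 < Re (f c) ->
  (forall w, Cmod (w - c) < R -> cderiv f w (f' w) /\ 0 <= Re (f w)) ->
  Cmod (f' c) <= 8 / R * Re (f c).
Proof.
  intros HR Ha H. set (a := f c) in *.
  assert (N : forall w, Cmod (w - c) < R -> (f w + Cconj a <> 0)%C).
  { intros w Hw E. apply (f_equal Re) in E. simpl in E. destruct (H w Hw) as [_ h].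
    unfold Re in *. lra. }
  assert (Ec : (a + Cconj a)%C = RtoC (2 * Re a)).
  { destruct a; unfold Cplus, Cconj, RtoC; simpl. f_equal; ring. }
  assert (B := cauchy_estimate (fun w => (f w - a) / (f w + Cconj a))%C
    (fun w => f' w * (a + Cconj a) / ((f w + Cconj a) * (f w + Cconj a)))%C c R 1 HR).
  cbv beta in B. fold a in B. rewrite Ec in B.
  assert (N0 : RtoC (2 * Re a) <> 0%C) by (apply RtoC_neq_0; lra).
  replace (f' c * RtoC (2 * Re a) / (RtoC (2 * Re a) * RtoC (2 * Re a)))%C
    with (f' c / RtoC (2 * Re a))%C in B by (field; auto).
  rewrite Cmod_div, Cmod_R, Rabs_pos_eq in B by (auto; lra).
  apply (Rmult_le_reg_r (/ (2 * Re a))); [apply Rinv_0_lt_compat; lra|].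
  replace (8 / R * Re a * / (2 * Re a)) with (4 * 1 / R) by (field; lra).
  apply B. intros w Hw. destruct (H w Hw) as [h1 h2]. specialize (N w Hw). split.
  - eapply gder_eq. apply gder_div; [apply ccont_id| | |exact N].
    + apply gder_minus; [exact h1|apply gder_const].
    + apply gder_plus; [exact h1|apply gder_const].
    + rewrite <- Ec. field. exact N.
  - rewrite Cmod_div by exact N. apply Cmod_gt_0 in N.
    apply (Rmult_le_reg_r (Cmod (f w + Cconj a))); auto.
    unfold Rdiv. rewrite Rmult_assoc, Rinv_l, Rmult_1_l, Rmult_1_r by lra.
    apply sqrt_le_1_alt. simpl. unfold Re in *. destruct (f w), a; simpl in *. nra.
Qed.

(** * The exponential and logarithms of zero-free functions *)

Definition Cexp (z : C) : C := (RtoC (exp (Re z)) * expi (Im z))%C.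

Lemma Cexp_plus (z w : C) : Cexp (z + w) = (Cexp z * Cexp w)%C.
Proof.
  destruct z as [a b], w as [c d]. unfold Cexp, expi, Cmult, Cplus, RtoC; simpl.
  rewrite exp_plus, cos_plus, sin_plus. f_equal; ring.
Qed.

Lemma Cmod_Cexp (z : C) : Cmod (Cexp z) = exp (Re z).
Proof.
  unfold Cexp. rewrite Cmod_mult, Cmod_expi, Cmod_R, Rabs_pos_eq, Rmult_1_r; auto.
  left; apply exp_pos.
Qed.

Lemma Cexp_neq_0 (z : C) : Cexp z <> 0%C.
Proof. apply Cmod_gt_0. rewrite Cmod_Cexp. apply exp_pos. Qed.

Lemma Cexp_0 : Cexp 0 = 1%C.
Proof.
  unfold Cexp, expi; simpl. rewrite exp_0, cos_0, sin_0.
  unfold Cmult, RtoC; simpl. f_equal; ring.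
Qed.

Lemma Cexp_2PI : Cexp (0, 2 * PI) = 1%C.
Proof.
  unfold Cexp, expi; simpl. rewrite exp_0, cos_2PI, sin_2PI.
  unfold Cmult, RtoC; simpl. f_equal; ring.
Qed.

Lemma Cexp_opp (z : C) : (Cexp (- z) * Cexp z = 1)%C.
Proof. rewrite <- Cexp_plus. replace (- z + z)%C with (RtoC 0) by ring. apply Cexp_0. Qed.

Lemma Cexp_surj (w : C) : w <> 0%C -> exists z, Cexp z = w.
Proof.
  intros Hw. assert (Hm : 0 < Cmod w) by (apply Cmod_gt_0; auto).
  destruct w as [a b]. set (m := Cmod (a, b)) in *.
  assert (E : m * m = a * a + b * b).
  { assert (Q := Cmod2_alt (a, b)). fold m in Q. simpl in Q. lra. }
  set (x := a / m).
  assert (Ex : a = m * x) by (unfold x; field; lra).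
  assert (Hx2 : b * b = m * m * (1 - x * x)) by (rewrite Ex in E; nra).
  assert (Hx1 : x * x <= 1).
  { apply Rnot_lt_le. intros K. assert (0 < m * m) by nra.
    assert (0 < m * m * (x * x - 1)) by (apply Rmult_lt_0_compat; lra). nra. }
  assert (Hx : -1 <= x <= 1) by nra.
  assert (Hs : 0 <= 1 - Rsqr x) by (unfold Rsqr; lra).
  assert (Sq := sqrt_sqrt (1 - Rsqr x) Hs). assert (Sp := sqrt_pos (1 - Rsqr x)).
  set (s := sqrt (1 - Rsqr x)) in *. unfold Rsqr in Sq.
  assert (Hb : (b - m * s) * (b + m * s) = 0).
  { replace ((b - m * s) * (b + m * s)) with (b * b - m * m * (s * s)) by ring.
    rewrite Sq, Hx2; ring. }
  assert (Em : exp (ln m) = m) by (apply exp_ln; auto).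
  (* [acos x] determines the angle up to sign; whether [b] is [m * s] or its opposite selects
     [acos x] or [- acos x]. *)
  apply Rmult_integral in Hb. destruct Hb as [Hb|Hb].
  - exists (ln m, acos x). unfold Cexp, expi; simpl. rewrite cos_acos, sin_acos by auto. fold s.
    rewrite Em. unfold Cmult, RtoC; simpl. f_equal; lra.
  - exists (ln m, - acos x). unfold Cexp, expi; simpl.
    rewrite cos_neg, sin_neg, cos_acos, sin_acos by auto. fold s.
    rewrite Em. unfold Cmult, RtoC; simpl. f_equal; lra.
Qed.

Lemma rderiv_segment (p q : C) (t : R) : rderiv (fun t => p + RtoC t * q)%C t q.
Proof.
  eapply gder_eq. apply gder_plus. apply gder_const. apply gder_mult. apply ccont_RtoC.
  apply gder_param. apply gder_const. cbv beta. ring.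
Qed.

Lemma rderiv_Cexp_line (h : C) (t : R) :
  rderiv (fun t => Cexp (RtoC t * h)) t (h * Cexp (RtoC t * h))%C.
Proof.
  destruct h as [a b].
  apply gder_ext with (fun t => (exp (t * a) * cos (t * b), exp (t * a) * sin (t * b))).
  - intros s. unfold Cexp, expi, Cmult, RtoC; simpl.
    replace (s * a - 0 * b) with (s * a) by ring. replace (s * b + 0 * a) with (s * b) by ring.
    f_equal; ring.
  - eapply gder_eq. apply rderiv_intro; auto_derive; auto; reflexivity.
    unfold Cexp, expi, Cmult, RtoC; simpl.
    replace (t * a - 0 * b) with (t * a) by ring. replace (t * b + 0 * a) with (t * b) by ring.
    f_equal; ring.
Qed.

Lemma exp_nondecreasing (x y : R) : x <= y -> exp x <= exp y.
Proof. intros [h| ->]; [left; apply exp_increasing; auto|right; auto]. Qed.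

Lemma Cexp_bound (h : C) (t : R) : Cmod h <= 1 -> 0 <= t <= 1 -> Cmod (Cexp (RtoC t * h)) <= 3.
Proof.
  intros Hh Ht. rewrite Cmod_Cexp. eapply Rle_trans; [|exact exp_le_3].
  apply exp_nondecreasing. eapply Rle_trans; [apply Rle_abs|]. eapply Rle_trans; [apply re_le_Cmod|].
  rewrite Cmod_mult, Cmod_R, Rabs_pos_eq by lra. generalize (Cmod_ge_0 h); nra.
Qed.

(** The fundamental theorem along the segment from [0] to [h] is used twice, with [exp 1 <= 3]. This
    gives the derivative of [Cexp] at [0], and the addition law carries it to every point. *)
Lemma Cexp_taylor (h : C) : Cmod h <= 1 -> Cmod (Cexp h - 1 - h) <= 3 * (Cmod h * Cmod h).
Proof.
  intros Hh. assert (Hp := Cmod_ge_0 h).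
  assert (Cl : forall t, ccont (fun t => Cexp (RtoC t * h)) t).
  { intros t. eapply rderiv_cont, rderiv_Cexp_line. }
  assert (B1 : forall t, 0 <= t <= 1 -> Cmod (Cexp (RtoC t * h) - 1) <= 3 * Cmod h).
  { intros t Ht. replace (Cexp (RtoC t * h) - 1)%C with (cint (fun t => h * Cexp (RtoC t * h))%C 0 t).
    - eapply Rle_trans; [apply (cint_ML _ _ _ (Cmod h * 3))|].
      + intros s _. apply ccont_mult; auto. apply ccont_const.
      + intros s Hs. apply Cmod_mult_le; [lra|]. apply Cexp_bound; auto.
        rewrite Rmin_left, Rmax_right in Hs; lra.
      + rewrite Rminus_0_r, Rabs_pos_eq by lra. nra.
    - rewrite (cint_FTC (fun t => Cexp (RtoC t * h))).
      + f_equal. f_equal. rewrite <- Cexp_0. f_equal. ring.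
      + intros s _. apply rderiv_Cexp_line.
      + intros s _. apply ccont_mult; auto. apply ccont_const. }
  replace (Cexp h - 1 - h)%C with (cint (fun t => h * (Cexp (RtoC t * h) - 1))%C 0 1).
  - eapply Rle_trans; [apply (cint_ML _ _ _ (Cmod h * (3 * Cmod h)))|].
    + intros s _. apply ccont_mult. apply ccont_const. apply ccont_minus; auto. apply ccont_const.
    + intros s Hs. rewrite Rmin_left, Rmax_right in Hs by lra. apply Cmod_mult_le; [lra|auto].
    + rewrite Rminus_0_r, Rabs_R1. lra.
  - rewrite (cint_FTC (fun t => Cexp (RtoC t * h) - RtoC t * h)%C).
    + replace (RtoC 1 * h)%C with h by ring. replace (RtoC 0 * h)%C with (RtoC 0) by ring.
      rewrite Cexp_0. ring.
    + intros s _. eapply gder_eq. apply gder_minus. apply rderiv_Cexp_line.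
      apply gder_mult. apply ccont_RtoC. apply gder_param. apply gder_const. cbv beta. ring.
    + intros s _. apply ccont_mult. apply ccont_const. apply ccont_minus; auto. apply ccont_const.
Qed.

Lemma cderiv_Cexp (z : C) : cderiv Cexp z (Cexp z).
Proof.
  apply cderiv_intro. intros e He.
  assert (Hz : 0 < Cmod (Cexp z)) by (apply Cmod_gt_0, Cexp_neq_0). set (m := Cmod (Cexp z)) in *.
  assert (He' : 0 < e / (3 * m)) by (apply Rdiv_lt_0_compat; lra).
  exists (Rmin 1 (e / (3 * m))). split; [apply Rmin_glb_lt; lra|]. intros w Hw.
  destruct (Rlt_Rmin _ _ _ Hw) as [w1 w2].
  replace (Cexp w) with (Cexp z * Cexp (w - z))%C by (rewrite <- Cexp_plus; f_equal; ring).
  replace (Cexp z * Cexp (w - z) - Cexp z - Cexp z * (w - z))%C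
    with (Cexp z * (Cexp (w - z) - 1 - (w - z)))%C by ring.
  rewrite Cmod_mult. fold m. assert (T := Cexp_taylor (w - z) ltac:(lra)).
  assert (Hp := Cmod_ge_0 (w - z)). set (h := Cmod (w - z)) in *.
  apply lt_div_mult in w2; [|lra].
  apply Rle_trans with (m * (3 * (h * h))); [apply Rmult_le_compat_l; lra|]. nra.
Qed.

Lemma cderiv_0_box (S : C -> Prop) (h : C -> C) (p z : C) : box S -> S p -> S z ->
  (forall w, S w -> cderiv h w 0%C) -> h z = h p.
Proof.
  intros HS Hp Hz H. assert (E : cint (fun _ => 0%C) 0 1 = (h z - h p)%C).
  { rewrite (cint_FTC (fun t => h (p + RtoC t * (z - p)))%C).
    - f_equal; [|f_equal]; f_equal; ring.
    - intros t Ht. rewrite Rmin_left, Rmax_right in Ht by lra.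
      eapply gder_eq. apply rderiv_chain. apply rderiv_segment.
      apply H, box_segment; auto. ring.
    - intros t _. apply ccont_const. }
  rewrite cint_const in E. replace (h z) with ((h z - h p) + h p)%C by ring.
  rewrite <- E. ring.
Qed.

Lemma linear_ode (S : C -> Prop) (Y P s : C -> C) (p : C) : box S -> S p ->
  (forall z, S z -> cderiv Y z (s z * Y z)%C /\ cderiv P z (s z)) ->
  exists k : C, forall z, S z -> Y z = (k * Cexp (P z))%C.
Proof.
  intros HS Hp H. exists (Y p * Cexp (- P p))%C. intros z Hz.
  rewrite <- (cderiv_0_box S (fun z => Y z * Cexp (- P z))%C p z); auto.
  - rewrite <- Cmult_assoc, Cexp_opp. ring.
  - intros w Hw. destruct (H w Hw) as [h1 h2]. eapply gder_eq. apply gder_mult. apply ccont_id. exact h1.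
    apply (cderiv_chain Cexp (fun z => - P z)%C). apply gder_opp, h2. apply cderiv_Cexp. cbv beta. ring.
Qed.

(** [h'/h] is holomorphic, so it has a primitive [P] on the box; [h] is a constant multiple of
    [Cexp P], and [Cexp_surj] moves the constant into the exponent. *)
Theorem holomorphic_log (S : C -> Prop) (h h' : C -> C) (p : C) : box S -> S p ->
  (forall z, S z -> cderiv h z (h' z) /\ h z <> 0%C) ->
  exists L, forall z, S z -> cderiv L z (h' z / h z)%C /\ h z = Cexp (L z).
Proof.
  intros HS Hp H.
  assert (Hd : forall z, S z -> exists l, cderiv (fun z => h' z / h z)%C z l).
  { intros z Hz. destruct (proj1 (open_Cmod S) (proj1 HS) z Hz) as [d [Hd HdS]].
    destruct (cderiv_deriv h h' z d Hd) as [l Hl]. { intros w Hw. apply H; auto. }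
    eexists. apply gder_div. apply ccont_id. exact Hl. apply H; auto. apply H; auto. }
  destruct (primitive S (fun z => h' z / h z)%C p HS Hp) as [P HP].
  - intros w Hw. apply ccont_of_cderiv; auto.
  - intros w Hw _; auto.
  - destruct (linear_ode S h P (fun z => h' z / h z)%C p HS Hp) as [k Hk].
    { intros z Hz. destruct (H z Hz). split; [eapply gder_eq; eauto; field; auto|auto]. }
    destruct (Cexp_surj k) as [c Hc].
    { intros E. destruct (H p Hp) as [_ N]. apply N. rewrite Hk, E; auto. ring. }
    exists (fun z => c + P z)%C. intros z Hz. split.
    + eapply gder_eq. apply gder_plus. apply gder_const. apply HP; auto. ring.
    + rewrite Cexp_plus, Hc. auto.
Qed.

Lemma ln_Cmod_Cexp (z : C) : ln (Cmod (Cexp z)) = Re z.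
Proof. rewrite Cmod_Cexp. apply ln_exp. Qed.

(** With [L] a logarithm of [h], the function [ln K - L] has real part [ln K - ln |h| >= 0], so
    [re_pos_deriv] bounds its derivative [- h'/h]. The logarithm lives on the square of half-side
    [R / 2], which turns [8 / R] into [16 / R]. *)
Theorem zero_free_deriv (h h' : C -> C) (c : C) (R K : R) : 0 < R ->
  (forall w, Cmod (w - c) < R -> cderiv h w (h' w) /\ h w <> 0%C /\ Cmod (h w) <= K) ->
  Cmod (h' c / h c) <= 16 / R * (ln K - ln (Cmod (h c))).
Proof.
  intros HR H.
  assert (Sq : forall w, square c (R / 2) w -> Cmod (w - c) < R).
  { intros w Hw. apply square_disc in Hw. lra. }
  assert (Cc : Cmod (c - c) = 0) by (replace (c - c)%C with (RtoC 0) by ring; apply Cmod_0).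
  destruct (holomorphic_log (square c (R / 2)) h h' c) as [L HL].
  - apply box_square.
  - apply disc_square. lra.
  - intros z Hz. split; apply H; auto.
  - destruct (HL c) as [_ E]. { apply disc_square; lra. }
    rewrite E at 2. rewrite ln_Cmod_Cexp. apply le_epsilon. intros e He.
    (* [re_pos_deriv] asks for a strictly positive real part at [c]; adding [d] to [ln K] ensures it
       and costs exactly [e] in the bound. *)
    set (d := e * R / 16). assert (Hd : 0 < d) by (unfold d; nra).
    assert (P : forall w, Cmod (w - c) < R / 2 -> Re (L w) <= ln K).
    { intros w Hw. destruct (H w) as [_ [h3 h4]]; [lra|]. apply Cmod_gt_0 in h3.
      rewrite <- ln_Cmod_Cexp, <- (proj2 (HL w (disc_square _ _ _ Hw))). apply ln_le; auto. }
    assert (Pc := P c ltac:(lra)).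
    rewrite <- Cmod_opp. replace (16 / R * (ln K - Re (L c)) + e) with (8 / (R / 2) * Re (RtoC (ln K + d) - L c)%C).
    2:{ unfold d, Re; simpl. field. lra. }
    apply (re_pos_deriv (fun z => RtoC (ln K + d) - L z)%C (fun z => - (h' z / h z))%C); [lra| |].
    + simpl. unfold Re in *. lra.
    + intros w Hw. split.
      * eapply gder_eq. apply gder_minus. apply gder_const. apply HL, disc_square; auto. ring.
      * specialize (P w Hw). simpl. unfold Re in *. lra.
Qed.

Theorem liouville_deriv (f f' : C -> C) (K : R) :
  (forall w, cderiv f w (f' w) /\ Cmod (f w) <= K) -> forall z, f' z = 0%C.
Proof.
  intros H z. assert (HK : 0 <= K) by (eapply Rle_trans; [apply Cmod_ge_0|apply (H z)]).
  apply (Cmod_small_eq_0 _ (4 * K)); [lra|]. intros e He.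
  replace (e * (4 * K)) with (4 * K / / e) by (field; lra).
  apply (cauchy_estimate f); auto. apply Rinv_0_lt_compat; auto.
Qed.

(** * Harnack and Hurwitz *)

Lemma segment_dist (c z : C) (t : R) : 0 <= t <= 1 ->
  Cmod (c + RtoC t * (z - c) - c) <= Cmod (z - c).
Proof.
  intros Ht. replace (c + RtoC t * (z - c) - c)%C with (RtoC t * (z - c))%C by ring.
  rewrite Cmod_mult, Cmod_R, Rabs_pos_eq by lra. generalize (Cmod_ge_0 (z - c)). nra.
Qed.

Lemma MVT01 (u u' : R -> R) : (forall t, 0 <= t <= 1 -> is_derive u t (u' t)) ->
  exists t, 0 <= t <= 1 /\ u 1 - u 0 = u' t.
Proof.
  intros H. destruct (MVT_gen u 0 1 u') as [t [Ht E]].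
  - intros t Ht. apply H. minmax.
  - intros t Ht. apply continuity_pt_filterlim, (ex_derive_continuous (V := R_NormedModule)).
    exists (u' t). apply H. minmax.
  - exists t. split; [minmax|]. rewrite E. ring.
Qed.

(** Along the segment from [c] to [z], [u = ln K - ln |h|] satisfies [|u'| <= 8 * u]: apply
    [zero_free_deriv] on discs of radius [R / 2] and multiply by the length, at most [R / 4]. Hence
    [u t * exp (8 * t)] does not decrease. *)
Theorem harnack (h h' : C -> C) (c z : C) (R K : R) : 0 < R ->
  (forall w, Cmod (w - c) < R -> cderiv h w (h' w) /\ h w <> 0%C /\ Cmod (h w) <= K) ->
  Cmod (z - c) <= R / 4 ->
  ln K - ln (Cmod (h c)) <= exp 8 * (ln K - ln (Cmod (h z))).
Proof.
  intros HR H Hz.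
  destruct (holomorphic_log (square c (R / 2)) h h' c) as [L HL].
  - apply box_square.
  - apply disc_square. rewrite Cmod_self; lra.
  - intros w Hw. apply square_disc in Hw. split; apply H; lra.
  - set (g t := (c + RtoC t * (z - c))%C).
    assert (Hg : forall t, 0 <= t <= 1 -> Cmod (g t - c) <= R / 4).
    { intros t Ht. eapply Rle_trans; [apply segment_dist; auto|auto]. }
    set (u t := ln K - Re (L (g t))).
    set (u' t := - Re ((h' (g t) / h (g t)) * (z - c))%C).
    assert (Lg : forall t, 0 <= t <= 1 -> cderiv L (g t) (h' (g t) / h (g t))%C /\ h (g t) = Cexp (L (g t))).
    { intros t Ht. apply HL. apply disc_square. generalize (Hg t Ht); lra. }
    assert (Du : forall t, 0 <= t <= 1 -> is_derive u t (u' t)).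
    { intros t Ht. unfold u, u'. destruct (rderiv_elim _ _ _ (rderiv_chain L g t _ _ (rderiv_segment c (z - c) t) (proj1 (Lg t Ht)))) as [D _].
      evar_last. apply (is_derive_minus (V := R_NormedModule) (fun _ => ln K)). apply is_derive_const. exact D.
      unfold minus, plus, opp, zero; simpl. ring. }
    assert (Bu : forall t, 0 <= t <= 1 -> Rabs (u' t) <= 8 * u t).
    { intros t Ht. unfold u'. rewrite Rabs_Ropp. eapply Rle_trans; [apply re_le_Cmod|].
      rewrite Cmod_mult.
      assert (B : Cmod (h' (g t) / h (g t)) <= 16 / (R / 2) * u t).
      { unfold u. rewrite <- ln_Cmod_Cexp, <- (proj2 (Lg t Ht)).
        apply zero_free_deriv; [lra|]. intros w Hw. apply H.
        generalize (Cmod_sub_triangle (g t) w c) (Hg t Ht). lra. }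
      assert (U0 : 0 <= u t).
      { assert (0 <= 16 / (R / 2) * u t) by (eapply Rle_trans; [apply Cmod_ge_0|exact B]).
        apply (Rmult_le_reg_l (16 / (R / 2))). apply Rdiv_lt_0_compat; lra. lra. }
      replace (8 * u t) with (16 / (R / 2) * u t * (R / 4)) by (field; lra).
      apply Rmult_le_compat; auto; apply Cmod_ge_0. }
    destruct (MVT01 (fun t => u t * exp (8 * t)) (fun t => (u' t + 8 * u t) * exp (8 * t))) as [t [Ht E]].
    + intros t Ht.
      evar_last. apply (is_derive_mult u (fun t => exp (8 * t))). apply Du; lra.
      auto_derive; auto. exact Rmult_comm.
      unfold plus, mult; simpl. ring.
    + assert (P : 0 <= (u' t + 8 * u t) * exp (8 * t)).
      { apply Rmult_le_pos; [|left; apply exp_pos]. generalize (Bu t Ht).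
        unfold Rabs; destruct Rcase_abs; lra. }
      rewrite Rmult_0_r, exp_0, Rmult_1_r in E.
      assert (E0 : u 0 = ln K - ln (Cmod (h c))).
      { destruct (Lg 0) as [_ E0]; [lra|]. unfold u. rewrite <- ln_Cmod_Cexp, <- E0.
        unfold g. do 4 f_equal. ring. }
      assert (E1 : u 1 = ln K - ln (Cmod (h z))).
      { destruct (Lg 1) as [_ E1]; [lra|]. unfold u. rewrite <- ln_Cmod_Cexp, <- E1.
        unfold g. do 4 f_equal. ring. }
      rewrite <- E0, <- E1. lra.
Qed.

(** Otherwise [harnack] propagates [u n c -> 0] to a whole disc about [c]. *)
Theorem hurwitz (u u' : nat -> C -> C) (h : C -> C) (c : C) (r0 : R) (N0 : nat) : 0 < r0 ->
  (forall n w, (N0 <= n)%nat -> Cmod (w - c) < r0 -> cderiv (u n) w (u' n w)) ->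
  (forall e, 0 < e -> exists N, forall n, (N <= n)%nat -> forall w, Cmod (w - c) < r0 ->
     Cmod (u n w - h w) < e) ->
  ccont h c -> h c = 0%C ->
  (forall r, 0 < r -> exists w, Cmod (w - c) < r /\ h w <> 0%C) ->
  forall r, 0 < r -> exists N, forall n, (N <= n)%nat -> exists w, Cmod (w - c) < r /\ u n w = 0%C.
Proof.
  intros Hr0 Hu Hc Hh h0 Hnz r Hr.
  destruct (proj1 (locally_Cmod _ _) (Hh 1 Rlt_0_1)) as [d [Hd Hd1]].
  set (s := Rmin r (Rmin r0 d)). assert (Hs : 0 < s) by (repeat apply Rmin_glb_lt; auto).
  assert (Sw : forall w, Cmod (w - c) < s -> Cmod (w - c) < r /\ Cmod (w - c) < r0 /\ Cmod (w - c) < d).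
  { intros w Hw. apply Rlt_Rmin in Hw. destruct Hw as [h1 h2]. apply Rlt_Rmin in h2. auto. }
  destruct (Hnz (s / 4)) as [z [Hz Nz]]; [lra|]. apply Cmod_gt_0 in Nz. set (e := Cmod (h z)) in *.
  (* The lower bound that [harnack] would force on [|u n c|] in the absence of zeros, given
     [|u n z| > e / 2]. The upper bound [2] used there comes from [|h| < 1] near [c] and
     [|u n - h| < 1]. *)
  set (b := exp (ln 2 - exp 8 * (ln 2 - ln (e / 2)))).
  assert (Hm : 0 < Rmin 1 (Rmin (e / 2) b)) by (repeat apply Rmin_glb_lt; [lra|lra|apply exp_pos]).
  destruct (Hc _ Hm) as [N1 H1]. exists (Nat.max N0 N1). intros n Hn. apply NNPP. intros Q.
  assert (Nzn : forall w, Cmod (w - c) < s -> u n w <> 0%C).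
  { intros w Hw E. apply Q. exists w. split; auto. apply Sw; auto. }
  assert (Dn : forall w, Cmod (w - c) < r0 -> Cmod (u n w - h w) < 1 /\ Cmod (u n w - h w) < e / 2 /\
    Cmod (u n w - h w) < b).
  { intros w Hw. specialize (H1 n ltac:(lia) w Hw). apply Rlt_Rmin in H1. destruct H1 as [k1 k2].
    apply Rlt_Rmin in k2. auto. }
  assert (Hc0 : Cmod (c - c) < s) by (rewrite Cmod_self; auto).
  assert (B : ln 2 - ln (Cmod (u n c)) <= exp 8 * (ln 2 - ln (Cmod (u n z)))).
  { apply (harnack (u n) (u' n) c z s 2 Hs); [|lra]. intros w Hw. destruct (Sw w Hw) as [w1 [w2 w3]].
    split; [apply Hu; auto; lia|split; auto]. specialize (Hd1 w w3). rewrite h0 in Hd1.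
    generalize (proj1 (Dn w w2)) (Cmod_le_sub (u n w) (h w)).
    replace (h w - 0)%C with (h w) in Hd1 by ring. lra. }
  assert (D1 : Cmod (u n c) < b).
  { replace (u n c) with (u n c - h c)%C by (rewrite h0; ring). apply Dn, Sw; auto. }
  assert (D2 : e / 2 < Cmod (u n z)).
  { generalize (proj1 (proj2 (Dn z (proj1 (proj2 (Sw z ltac:(lra))))))) (Cmod_le_sub (h z) (u n z)).
    rewrite (Cmod_sub_comm (h z)). fold e. lra. }
  apply ln_increasing in D1; [|apply Cmod_gt_0; auto]. apply ln_increasing in D2; [|lra].
  unfold b in D1. rewrite ln_exp in D1. assert (0 < exp 8) by apply exp_pos. nra.
Qed.

(** * A spherical height function, near [0] exactly at large values *)

Definition sph (w : C) : R := / (1 + Cmod w ^ 2).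

Lemma sph_pos (w : C) : 0 < sph w.
Proof. apply Rinv_0_lt_compat. generalize (pow2_ge_0 (Cmod w)); lra. Qed.

(** The derivative of [1 / (1 + |f|^2)] along the segment is at most
    [2 |f| |f'| |q - p| / (1 + |f|^2)^2], and [2 |f| <= 1 + |f|^2] absorbs one factor. *)
Lemma sph_lipschitz (f f' : C -> C) (p q : C) (K : R) :
  (forall t, 0 <= t <= 1 -> let w := (p + RtoC t * (q - p))%C in
     cderiv f w (f' w) /\ Cmod (f' w) <= K * (1 + Cmod (f w) ^ 2)) ->
  Rabs (sph (f q) - sph (f p)) <= K * Cmod (q - p).
Proof.
  intros H. set (g t := (p + RtoC t * (q - p))%C).
  set (U t := Re (f (g t))). set (V t := Im (f (g t))). set (w' t := (f' (g t) * (q - p))%C).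
  assert (Es : forall t, sph (f (g t)) = / (1 + (U t ^ 2 + V t ^ 2))).
  { intros t. unfold sph. rewrite Cmod2_alt. reflexivity. }
  destruct (MVT01 (fun t => / (1 + (U t ^ 2 + V t ^ 2)))
    (fun t => - (2 * (U t * Re (w' t) + V t * Im (w' t)) / (1 + (U t ^ 2 + V t ^ 2)) ^ 2))) as [t [Ht E]].
  { intros t Ht.
    destruct (rderiv_elim _ _ _ (rderiv_chain f g t _ _ (rderiv_segment p (q - p) t) (proj1 (H t Ht)))) as [DU DV].
    assert (EU : Derive (fun x => U x) t = Re (w' t)) by (apply is_derive_unique; exact DU).
    assert (EV : Derive (fun x => V x) t = Im (w' t)) by (apply is_derive_unique; exact DV).
    assert (0 < 1 + (U t ^ 2 + V t ^ 2)) by (generalize (pow2_ge_0 (U t)) (pow2_ge_0 (V t)); lra).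
    auto_derive.
    - split; [eexists; exact DU|]. split; [eexists; exact DV|]. split; auto. lra.
    - rewrite EU, EV. field. lra. }
  rewrite <- !Es in E. replace (g 1) with q in E by (unfold g; ring). replace (g 0) with p in E by (unfold g; ring).
  rewrite E, Rabs_Ropp.
  destruct (H t Ht) as [_ B]. fold (g t) in B.
  assert (Ew : Cmod (f (g t)) ^ 2 = U t ^ 2 + V t ^ 2) by apply Cmod2_alt.
  assert (Ed : Rabs (U t * Re (w' t) + V t * Im (w' t)) <= Cmod (f (g t)) * (Cmod (f' (g t)) * Cmod (q - p))).
  { rewrite <- (Cmod_conj (f (g t))), <- !Cmod_mult. fold (w' t).
    eapply Rle_trans; [|apply re_le_Cmod]. right. f_equal. unfold U, V, w', Cconj, Cmult, Re, Im; simpl. ring. }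
  rewrite <- Ew. assert (m0 := Cmod_ge_0 (f (g t))). assert (k0 := Cmod_ge_0 (q - p)).
  set (m := Cmod (f (g t))) in *. set (k := Cmod (q - p)) in *. set (s := 1 + m ^ 2) in *.
  assert (S1 : 0 < s) by (unfold s; nra).
  unfold Rdiv. rewrite Rabs_mult, Rabs_mult, (Rabs_pos_eq 2), (Rabs_pos_eq (/ s ^ 2)) by
    (try lra; left; apply Rinv_0_lt_compat, pow_lt; auto).
  apply (Rmult_le_reg_r (s ^ 2)); [apply pow_lt; auto|].
  rewrite Rmult_assoc, Rinv_l, Rmult_1_r by (apply pow_nonzero; lra).
  assert (B2 : m * (Cmod (f' (g t)) * k) <= m * (K * s * k)).
  { apply Rmult_le_compat_l; auto. apply Rmult_le_compat_r; auto. }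
  assert (Ks : 0 <= K * s) by (eapply Rle_trans; [apply Cmod_ge_0|exact B]).
  assert (B3 : 2 * m <= s) by (unfold s; generalize (pow2_ge_0 (m - 1)); lra).
  apply Rle_trans with (2 * m * (K * s * k)); [lra|].
  replace (K * k * s ^ 2) with (s * (K * s * k)) by ring.
  apply Rmult_le_compat_r; auto. apply Rmult_le_pos; auto.
Qed.

(** * A special case of Picard's theorem *)

Lemma sph_Cmod (w : C) (a : R) : 0 < a -> a <= sph w -> Cmod w ^ 2 <= / a - 1.
Proof.
  intros Ha H. unfold sph in H. apply Rinv_le_contravar in H; auto. rewrite Rinv_inv in H. lra.
Qed.

Lemma sph_Cmod_ge (w : C) (a : R) : 0 < a -> sph w <= a -> / a - 1 <= Cmod w ^ 2.
Proof.
  intros Ha H. assert (S := sph_pos w). apply Rinv_le_contravar in H; auto.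
  unfold sph in H. rewrite Rinv_inv in H. lra.
Qed.

Lemma ln2_le_1 : ln 2 <= 1.
Proof.
  rewrite <- (ln_exp 1). apply ln_le; [lra|]. generalize (exp_ineq1 1). lra.
Qed.

(** On the disc of radius [d = 3 / (10 * K)] the value [sph (G w)] moves by at most [3 / 10]. If
    [|G z| <= 1] it stays above [1/2 - 3/10 = 1/5], so [|G| <= 2]; otherwise it stays below
    [1/2 + 3/10 = 4/5], so [|1/G| <= 2]. In either case [zero_free_deriv] applies with the bound
    [2], to [G] or to [1/G]. *)
Lemma log_derivative_bound (G G' : C -> C) (K : R) (z : C) : 0 < K ->
  (forall w, cderiv G w (G' w) /\ G w <> 0%C /\ Cmod (G' w) <= K * (1 + Cmod (G w) ^ 2)) ->
  Cmod (G' z / G z) <= 16 / (3 / (10 * K)) * (1 + Rabs (ln (Cmod (G z)))).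
Proof.
  intros HK H. set (d := 3 / (10 * K)). assert (Hd : 0 < d) by (apply Rdiv_lt_0_compat; lra).
  assert (Kd : K * d = 3 / 10) by (unfold d; field; lra).
  assert (L : forall w, Cmod (w - z) < d -> Rabs (sph (G w) - sph (G z)) <= 3 / 10).
  { intros w Hw. assert (B : Rabs (sph (G w) - sph (G z)) <= K * Cmod (w - z)).
    { apply (sph_lipschitz G G'). intros t Ht. split; apply H. }
    eapply Rle_trans; [exact B|]. rewrite <- Kd. apply Rmult_le_compat_l; lra. }
  assert (Gz : 0 < Cmod (G z)) by (apply Cmod_gt_0; apply H).
  assert (H16 : 0 < 16 / d) by (apply Rdiv_lt_0_compat; lra).
  assert (L2 := ln2_le_1).
  destruct (Rle_dec (Cmod (G z)) 1) as [C1|C1].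
  - assert (S : / 2 <= sph (G z)).
    { unfold sph. apply Rinv_le_contravar; nra. }
    eapply Rle_trans; [apply (zero_free_deriv G G' z d 2 Hd)|].
    + intros w Hw. repeat split; try apply H.
      assert (S1 : / 5 <= sph (G w)).
      { generalize (L w Hw). unfold Rabs; destruct Rcase_abs; lra. }
      apply sph_Cmod in S1; [|lra]. rewrite Rinv_inv in S1. generalize (Cmod_ge_0 (G w)). nra.
    + apply Rmult_le_compat_l; [lra|]. unfold Rabs; destruct Rcase_abs; lra.
  - assert (S : sph (G z) <= / 2).
    { unfold sph. apply Rinv_le_contravar; nra. }
    assert (N : (- G' z / (G z * G z) / (/ G z))%C = (- (G' z / G z))%C).
    { field. apply H. }
    assert (B := zero_free_deriv (fun w => / G w)%C (fun w => - G' w / (G w * G w))%C z d 2 Hd).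
    cbv beta in B. rewrite N, Cmod_opp, Cmod_inv, ln_Rinv in B; auto; [|apply H].
    eapply Rle_trans; [apply B|].
    + intros w Hw. split; [|split].
      * apply gder_inv. apply ccont_id. apply H. apply H.
      * intros E. apply (f_equal (Cmult (G w))) in E. rewrite Cinv_r in E by apply H.
        rewrite Cmult_0_r in E. apply (f_equal Re) in E. simpl in E. lra.
      * assert (S1 : sph (G w) <= 4 / 5).
        { generalize (L w Hw). unfold Rabs; destruct Rcase_abs; lra. }
        apply sph_Cmod_ge in S1; [|lra]. rewrite Cmod_inv by apply H.
        assert (0 < Cmod (G w)) by (apply Cmod_gt_0, H).
        replace 2 with (/ / 2) by field. apply Rinv_le_contravar; [lra|].
        replace (/ (4 / 5) - 1) with (/ 2 * / 2) in S1 by field. nra.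
    + apply Rmult_le_compat_l; [lra|]. unfold Rabs; destruct Rcase_abs; lra.
Qed.

(** Gronwall's argument for [ln (1 + (ln |G|)^2)] along rays. *)
Lemma log_derivative_growth (G G' : C -> C) (K : R) : 0 < K ->
  (forall w, cderiv G w (G' w) /\ G w <> 0%C /\ Cmod (G' w) <= K * (1 + Cmod (G w) ^ 2)) ->
  exists c, 0 <= c /\ forall z, Cmod (G' z / G z) <= exp (c * (1 + Cmod z)).
Proof.
  intros HK H. assert (B := fun z => log_derivative_bound G G' K z HK H).
  set (k := 16 / (3 / (10 * K))) in *.
  assert (Hk : 0 < k) by (unfold k; repeat apply Rdiv_lt_0_compat; lra).
  destruct (holomorphic_log (fun _ => True) G G' 0%C box_plane I) as [P HP].
  { intros w _. split; apply H. }
  assert (E : forall z, ln (Cmod (G z)) = Re (P z)).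
  { intros z. destruct (HP z I) as [_ ->]. apply ln_Cmod_Cexp. }
  set (y0 := ln (1 + Re (P 0%C) ^ 2)).
  assert (Y0 : 0 <= y0).
  { apply Rle_trans with (ln 1); [rewrite ln_1; lra|]. apply ln_le; [lra|].
    generalize (pow2_ge_0 (Re (P 0%C))); lra. }
  (* From [2a(1 + a) <= 3(1 + a^2)], the function [ln (1 + x^2)] grows by at most [3 * k * Cmod z]
     from its value [y0] at the origin. Then [k(1 + |x|) <= 2k(1 + x^2)] contributes
     [ln (2 * k)]. *)
  exists (Rabs (ln (2 * k)) + y0 + 3 * k). split.
  { generalize (Rabs_pos (ln (2 * k))). lra. }
  intros z. set (X t := Re (P (0 + RtoC t * (z - 0))%C)).
  set (X' t := Re ((G' (0 + RtoC t * (z - 0)) / G (0 + RtoC t * (z - 0)))%C * (z - 0))).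
  assert (DX : forall t, is_derive X t (X' t)).
  { intros t. apply (rderiv_elim _ _ _ (rderiv_chain P _ t _ _ (rderiv_segment 0 (z - 0) t) (proj1 (HP _ I)))). }
  assert (BX : forall t, Rabs (X' t) <= k * (1 + Rabs (X t)) * Cmod z).
  { intros t. eapply Rle_trans; [apply re_le_Cmod|]. rewrite Cmod_mult.
    replace (Cmod (z - 0)) with (Cmod z) by (f_equal; ring).
    apply Rmult_le_compat_r; [apply Cmod_ge_0|]. unfold X. rewrite <- E. apply B. }
  assert (S : forall x, 0 < 1 + x ^ 2) by (intros x; generalize (pow2_ge_0 x); lra).
  assert (DY : forall t, is_derive (fun t => ln (1 + X t ^ 2)) t (2 * X t * X' t / (1 + X t ^ 2))).
  { intros t. auto_derive.
    - split; [eexists; apply DX|]. split; auto. apply S.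
    - assert (EX : Derive (fun x => X x) t = X' t) by (apply is_derive_unique, DX).
      rewrite EX. field. generalize (S (X t)); simpl; lra. }
  assert (BY : forall t, 2 * X t * X' t / (1 + X t ^ 2) <= 3 * k * Cmod z).
  { intros t. apply (Rmult_le_reg_r (1 + X t ^ 2)); [apply S|].
    unfold Rdiv. rewrite Rmult_assoc, Rinv_l by (generalize (S (X t)); lra).
    rewrite Rmult_1_r. eapply Rle_trans; [apply Rle_abs|]. rewrite Rabs_mult.
    rewrite Rabs_mult, (Rabs_pos_eq 2) by lra.
    eapply Rle_trans; [apply Rmult_le_compat_l; [|apply BX]|].
    - generalize (Rabs_pos (X t)); lra.
    - rewrite <- (pow2_abs (X t)). assert (a0 := Rabs_pos (X t)). set (a := Rabs (X t)) in *.
      replace (2 * a * (k * (1 + a) * Cmod z)) with (2 * a * (1 + a) * (k * Cmod z)) by ring.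
      replace (3 * k * Cmod z * (1 + a ^ 2)) with (3 * (1 + a ^ 2) * (k * Cmod z)) by ring.
      apply Rmult_le_compat_r. apply Rmult_le_pos; [lra|apply Cmod_ge_0].
      clearbody a. generalize (pow2_ge_0 (a - 1)). nra. }
  destruct (MVT01 (fun t => ln (1 + X t ^ 2)) (fun t => 2 * X t * X' t / (1 + X t ^ 2))) as [t [_ Et]].
  { intros t _; apply DY. }
  specialize (BY t). rewrite <- Et in BY.
  assert (X0 : X 0 = Re (P 0%C)) by (unfold X; do 2 f_equal; ring).
  assert (X1 : X 1 = Re (P z)) by (unfold X; do 2 f_equal; ring).
  rewrite X0, X1 in BY. fold y0 in BY.
  eapply Rle_trans; [apply B|]. rewrite E. set (x := Re (P z)) in *.
  apply Rle_trans with (2 * k * (1 + x ^ 2)).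
  { rewrite <- (pow2_abs x). assert (a0 := Rabs_pos x). set (a := Rabs x) in *. clearbody a.
    replace (2 * k * (1 + a ^ 2)) with (k * (2 * (1 + a ^ 2))) by ring.
    apply Rmult_le_compat_l; [lra|]. generalize (pow2_ge_0 (a - 1)). nra. }
  rewrite <- (exp_ln (2 * k)) at 1 by lra. rewrite <- (exp_ln (1 + x ^ 2)) by apply S.
  rewrite <- exp_plus. apply exp_nondecreasing.
  assert (Z0 := Cmod_ge_0 z). generalize (Rle_abs (ln (2 * k))) (Rabs_pos (ln (2 * k))). intros. nra.
Qed.

Lemma cderiv_C_derive (f : C -> C) (z : C) : (exists l, cderiv f z l) -> cderiv f z (C_derive f z).
Proof.
  intros [l Hl]. assert (D := proj2 (cderiv_is_derive _ _ _) Hl).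
  rewrite (is_C_derive_unique _ _ _ D). exact Hl.
Qed.

Lemma le_of_forall_div (a b x : R) : (forall r, 0 < r -> x <= a + b / r) -> x <= a.
Proof.
  intros H. apply le_epsilon. intros e He. assert (Hb := Rabs_pos b). assert (Hb2 := Rle_abs b).
  assert (Hr : 0 < (Rabs b + 1) / e) by (apply Rdiv_lt_0_compat; lra).
  eapply Rle_trans; [apply (H _ Hr)|]. apply Rplus_le_compat_l.
  apply (Rmult_le_reg_r ((Rabs b + 1) / e)); auto. field_simplify; lra.
Qed.

(** On the disc of radius [r] about [z] the bound of [zero_free_deriv] is
    [16 / r * (c * (1 + |z| + r) - ln |E z|)], which tends to [16 * c] as [r] grows. So [E'/E] is a
    bounded entire function, constant by Liouville. *)
Lemma zero_free_exp_type (E E' : C -> C) (c : R) : 0 <= c ->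
  (forall z, cderiv E z (E' z) /\ E z <> 0%C /\ Cmod (E z) <= exp (c * (1 + Cmod z))) ->
  exists a, forall z, E' z = (a * E z)%C.
Proof.
  intros Hc H.
  assert (B : forall z, Cmod (E' z / E z) <= 16 * c).
  { intros z. apply le_of_forall_div with (16 * (c * (1 + Cmod z) - ln (Cmod (E z)))). intros r Hr.
    eapply Rle_trans; [apply (zero_free_deriv E E' z r (exp (c * (1 + Cmod z + r))) Hr)|].
    - intros w Hw. destruct (H w) as [h1 [h2 h3]]. repeat split; auto.
      eapply Rle_trans; [exact h3|]. apply exp_nondecreasing. apply Rmult_le_compat_l; auto.
      generalize (Cmod_le_sub w z). lra.
    - rewrite ln_exp. right. field. lra. }
  set (A z := (E' z / E z)%C).
  assert (DA : forall z, cderiv A z (C_derive A z)).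
  { intros z. apply cderiv_C_derive.
    destruct (cderiv_deriv E E' z 1 Rlt_0_1) as [l Hl]. { intros; apply H. }
    eexists. apply gder_div. apply ccont_id. exact Hl. apply H. apply H. }
  assert (A0 : forall z, cderiv A z 0%C).
  { intros z. eapply gder_eq; [apply DA|]. apply (liouville_deriv A _ (16 * c)).
    intros w; split; [apply DA|apply B]. }
  exists (A 0%C). intros z.
  rewrite <- (cderiv_0_box (fun _ => True) A 0 z box_plane); auto.
  unfold A. field. apply H.
Qed.

Theorem no_entire_omitting (G G' : C -> C) (K : R) : 0 < K ->
  (forall z, cderiv G z (G' z) /\ G z <> 0%C /\ G z <> 1%C /\ G' z <> 0%C /\
     Cmod (G' z) <= K * (1 + Cmod (G z) ^ 2)) -> False.
Proof.
  intros HK H.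
  assert (N1 : forall z, (G z - 1 <> 0)%C) by (intros; apply Csub_neq_0; apply H).
  assert (N0 : forall z, G z <> 0%C) by apply H.
  assert (D1 : forall z, cderiv (fun z => G z - 1)%C z (G' z)).
  { intros z. eapply gder_eq. apply gder_minus. apply H. apply gder_const. ring. }
  destruct (log_derivative_growth G G' K HK) as [c1 [Hc1 B1]]. { intros w; repeat split; apply H. }
  (* The factor [3] comes from [1 + |G|^2 <= 3 * (1 + |G - 1|^2)]. *)
  destruct (log_derivative_growth (fun z => G z - 1)%C G' (3 * K)) as [c2 [Hc2 B2]]; [lra| |].
  { intros w. repeat split; auto. destruct (H w) as [_ [_ [_ [_ h]]]].
    eapply Rle_trans; [exact h|]. rewrite (Rmult_comm 3), Rmult_assoc. apply Rmult_le_compat_l; [lra|].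
    generalize (Cmod_le_sub (G w) 1) (Cmod_ge_0 (G w)) (Cmod_ge_0 (G w - 1)). rewrite Cmod_1.
    set (a := Cmod (G w)). set (b := Cmod (G w - 1)). clearbody a b. intros.
    generalize (pow2_ge_0 (b - 1)). nra. }
  set (E z := (G' z / (G z * (G z - 1)))%C).
  assert (EN : forall z, E z <> 0%C).
  { intros z. unfold E. apply Cmult_neq_0. apply H. apply Cinv_neq_0; auto. all: apply Cmult_neq_0; auto. }
  assert (DE : forall z, cderiv E z (C_derive E z)).
  { intros z. apply cderiv_C_derive.
    destruct (cderiv_deriv G G' z 1 Rlt_0_1) as [l Hl]. { intros; apply H. }
    eexists. apply (gder_div _ G' (fun z => G z * (G z - 1))%C). apply ccont_id. exact Hl.
    apply gder_mult. apply ccont_id. apply H. apply D1. apply Cmult_neq_0; auto. }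
  (* Each of the two logarithmic derivatives whose difference is [E] is at most
     [exp ((c1 + c2) * (1 + |z|))]; the extra [1] pays for the factor [2], as
     [2 <= exp (1 + |z|)]. *)
  destruct (zero_free_exp_type E (C_derive E) (c1 + c2 + 1)) as [a Ha]; [lra| |].
  { intros z. repeat split; auto.
    replace (E z) with (G' z / (G z - 1) - G' z / G z)%C by (unfold E; field; auto).
    eapply Rle_trans; [apply Cmod_sub_le|].
    eapply Rle_trans; [apply Rplus_le_compat; [apply B2|apply B1]|].
    assert (Z := Cmod_ge_0 z).
    replace ((c1 + c2 + 1) * (1 + Cmod z)) with ((c1 + c2) * (1 + Cmod z) + (1 + Cmod z)) by ring.
    rewrite exp_plus.
    assert (e2 : 2 <= exp (1 + Cmod z)) by (generalize (exp_ineq1 (1 + Cmod z)); lra).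
    assert (e3 : exp (c2 * (1 + Cmod z)) <= exp ((c1 + c2) * (1 + Cmod z))) by (apply exp_nondecreasing; nra).
    assert (e4 : exp (c1 * (1 + Cmod z)) <= exp ((c1 + c2) * (1 + Cmod z))) by (apply exp_nondecreasing; nra).
    generalize (exp_pos ((c1 + c2) * (1 + Cmod z))). nra. }
  (* [W = 1 - 1/G] satisfies [W' = E * W] and never equals [1], because [G] has no poles. Any
     primitive of [E] therefore exhibits [W] as a constant times an exponential, and it remains to
     make that expression equal to [1]. *)
  set (W z := ((G z - 1) / G z)%C).
  assert (WN : forall z, W z <> 0%C).
  { intros z. apply Cmult_neq_0; auto. apply Cinv_neq_0; auto. }
  assert (W1 : forall z, W z <> 1%C).
  { intros z h. assert (h2 : (W z * G z = G z - 1)%C) by (unfold W; field; auto).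
    rewrite h in h2. assert (h3 : RtoC 1 = RtoC 0).
    { transitivity (G z - 1 * G z)%C; [rewrite h2; ring|ring]. }
    apply (f_equal Re) in h3. simpl in h3. lra. }
  assert (DW : forall z, cderiv W z (E z * W z)%C).
  { intros z. eapply gder_eq. apply gder_div. apply ccont_id. apply D1. apply H. auto.
    unfold E, W. field. split; auto. }
  assert (Const : forall S, (forall z, cderiv S z (E z)) ->
    exists k : C, k <> 0%C /\ forall z, W z = (k * Cexp (S z))%C).
  { intros S HS. destruct (linear_ode (fun _ => True) W S E 0%C box_plane I) as [k Hk]; auto.
    exists k. split; auto. intros E0. apply (WN 0%C). rewrite Hk, E0; auto. ring. }
  destruct (Ceq_dec a 0) as [->|Na].
  - assert (E0 : forall z, E z = E 0%C).
    { intros z. apply (cderiv_0_box (fun _ => True) E 0 z box_plane); auto.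
      intros w _. eapply gder_eq. apply DE. rewrite Ha. ring. }
    destruct (Const (fun z => E 0 * z)%C) as [k [Hk HW]].
    { intros z. eapply gder_eq. apply gder_scal. apply ccont_id. apply gder_param. rewrite (E0 z). ring. }
    destruct (Cexp_surj (/ k)%C) as [y Hy].
    { apply Cinv_neq_0; auto. }
    apply (W1 (y / E 0)%C). rewrite HW. replace (E 0 * (y / E 0))%C with y by (field; auto).
    rewrite Hy. field; auto.
  - destruct (Const (fun z => / a * E z)%C) as [k [Hk HW]].
    { intros z. eapply gder_eq. apply gder_scal. apply ccont_id. apply DE. rewrite Ha. field; auto. }
    destruct (Cexp_surj (/ k)%C) as [c Hc].
    { apply Cinv_neq_0; auto. }
    (* Since [E = e * Cexp (a * z)] takes every value except [0], the exponent [E / a] can be made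
       equal to [s] only if [s] is nonzero. Should the logarithm found be [0], the period of [Cexp]
       supplies another one. *)
    assert (T : exists s : C, s <> 0%C /\ Cexp s = (/ k)%C).
    { destruct (Ceq_dec c 0) as [->|Nc]; [|exists c; auto].
      exists ((0, 2 * PI) : C). split.
      - intros h. apply (f_equal Im) in h. simpl in h. generalize PI_RGT_0; lra.
      - rewrite Cexp_2PI, <- Hc. symmetry; apply Cexp_0. }
    destruct T as [s [Hs Es]].
    destruct (linear_ode (fun _ => True) E (fun z => a * z)%C (fun _ => a) 0%C box_plane I) as [e EE].
    { intros z _. split; [rewrite <- Ha; auto|]. eapply gder_eq. apply gder_scal. apply ccont_id.
      apply gder_param. ring. }
    assert (Ne : e <> 0%C) by (intros E0; apply (EN 0%C); rewrite EE, E0; auto; ring).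
    destruct (Cexp_surj (a * s / e)%C) as [y Hy].
    { apply Cmult_neq_0; [apply Cmult_neq_0|apply Cinv_neq_0]; auto. }
    apply (W1 (y / a)%C). rewrite HW, EE by auto. replace (a * (y / a))%C with y by (field; auto).
    rewrite Hy. replace (/ a * (e * (a * s / e)))%C with s by (field; auto).
    rewrite Es. field; auto.
Qed.

(** * Subsequences *)

Definition cvgR (x : nat -> R) (l : R) : Prop :=
  forall e, 0 < e -> exists N, forall n, (N <= n)%nat -> Rabs (x n - l) < e.

Definition cvgC (x : nat -> C) (l : C) : Prop :=
  forall e, 0 < e -> exists N, forall n, (N <= n)%nat -> Cmod (x n - l) < e.

Definition increasing_seq (phi : nat -> nat) : Prop := forall n, (phi n < phi (S n))%nat.

Lemma increasing_seq_ge (phi : nat -> nat) : increasing_seq phi -> forall n, (n <= phi n)%nat.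
Proof. intros H n. induction n; [lia|]. generalize (H n); lia. Qed.

Lemma cvgC_subseq (x : nat -> C) (l : C) (phi : nat -> nat) :
  increasing_seq phi -> cvgC x l -> cvgC (fun n => x (phi n)) l.
Proof.
  intros Hp H e He. destruct (H e He) as [N HN]. exists N. intros n Hn. apply HN.
  generalize (increasing_seq_ge phi Hp n). lia.
Qed.

Lemma inv_INR_lt (e : R) : 0 < e -> exists N, forall n, (N <= n)%nat -> / (INR n + 1) < e.
Proof.
  intros He. destruct (archimed_cor1 e He) as [N [H1 H2]]. exists N. intros n Hn.
  eapply Rlt_trans; [|exact H1]. apply Rinv_lt_contravar.
  - apply le_INR in Hn. apply lt_0_INR in H2. apply Rmult_lt_0_compat; lra.
  - apply le_INR in Hn. lra.
Qed.

(** The first [k] entries of [l] form a cluster point of the vectors [(x 0 n, ..., x (k-1) n)].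
    Extending cluster points coordinate by coordinate replaces the nested subsequences of the usual
    diagonal argument. *)
Definition jointly_adherent (x : nat -> nat -> R) (k : nat) (l : nat -> R) : Prop :=
  forall e, 0 < e -> forall N, exists n, (N <= n)%nat /\
    forall j, (j < k)%nat -> Rabs (x j n - l j) < e.

Definition update (l : nat -> R) (k : nat) (v : R) (j : nat) : R :=
  if Nat.eq_dec j k then v else l j.

Lemma jointly_adherent_extend (x : nat -> nat -> R) (M : R) (k : nat) (l : nat -> R) :
  (forall k n, Rabs (x k n) <= M) -> jointly_adherent x k l ->
  exists v, jointly_adherent x (S k) (update l k v).
Proof.
  intros HM H.
  destruct (functional_choice (fun i n => (i <= n)%nat /\
    forall j, (j < k)%nat -> Rabs (x j n - l j) < / (INR i + 1))) as [s Hs].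
  { intros i. apply H. apply Rinv_0_lt_compat. generalize (pos_INR i); lra. }
  destruct (Bolzano_Weierstrass (fun i => x k (s i)) (fun c => - M <= c <= M) (compact_P3 _ _)) as [v Hv].
  { intros n. apply Rabs_le_between. auto. }
  exists v. intros e He N. destruct (inv_INR_lt e He) as [N1 H1].
  destruct (Hv (disc v (mkposreal e He)) (Nat.max N N1)) as [i [Hi1 Hi2]].
  { exists (mkposreal e He). intros y Hy; exact Hy. }
  exists (s i). destruct (Hs i) as [h1 h2]. split; [lia|].
  intros j Hj. unfold update. destruct (Nat.eq_dec j k) as [->|N2].
  - exact Hi2.
  - eapply Rlt_trans; [apply h2; lia|]. apply H1. lia.
Qed.

Theorem diagonal_subsequence (x : nat -> nat -> R) (M : R) :
  (forall k n, Rabs (x k n) <= M) ->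
  exists phi, increasing_seq phi /\ forall k, exists l, cvgR (fun n => x k (phi n)) l.
Proof.
  intros HM.
  destruct (sequence_choice (jointly_adherent x)
    (fun k l l' => forall j, (j < k)%nat -> l' j = l j) (fun _ => 0)) as [L [_ HL]].
  { intros e He N. exists N. split; auto. intros j Hj; lia. }
  { intros k l Hl. destruct (jointly_adherent_extend x M k l HM Hl) as [v Hv].
    exists (update l k v). split; auto. intros j Hj. unfold update. destruct Nat.eq_dec; [lia|auto]. }
  (* Stage [S k] is the first at which coordinate [k] is chosen; later stages leave it unchanged. *)
  set (l k := L (S k) k).
  assert (Ll : forall k j, (j < k)%nat -> L k j = l j).
  { induction k; intros j Hj; [lia|]. destruct (Nat.eq_dec j k) as [->|N]; auto.
    destruct (HL k) as [_ E]. rewrite E by lia. apply IHk; lia. }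
  (* The [n]-th index brings the first [n] coordinates within [1 / (n + 1)] of their limits, so
     coordinate [k] is controlled from [n = S k] on. At [n = 0] nothing is required, and [O] can
     start the sequence. *)
  destruct (sequence_choice (fun n m => forall j, (j < n)%nat -> Rabs (x j m - l j) < / (INR n + 1))
    (fun _ m m' => (m < m')%nat) O) as [phi [_ Hphi]].
  { intros j Hj; lia. }
  { intros n m _. destruct (proj1 (HL (S n)) (/ (INR (S n) + 1))) with (N := S m) as [m' [h1 h2]].
    - apply Rinv_0_lt_compat. generalize (pos_INR (S n)); lra.
    - exists m'. split; auto. intros j Hj. rewrite <- (Ll (S n)); auto. }
  exists phi. split; [intros n; apply Hphi|].
  intros k. exists (l k). intros e He. destruct (inv_INR_lt e He) as [N1 H1].
  exists (Nat.max N1 (S k)). intros n Hn.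
  eapply Rlt_trans; [apply (proj1 (Hphi n)); lia|apply H1; lia].
Qed.

Lemma cvgC_of_parts (x : nat -> C) (a b : R) :
  cvgR (fun n => Re (x n)) a -> cvgR (fun n => Im (x n)) b -> cvgC x (a, b).
Proof.
  intros Ha Hb e He. assert (He2 : 0 < e / 2) by lra.
  destruct (Ha _ He2) as [N1 H1], (Hb _ He2) as [N2 H2].
  exists (Nat.max N1 N2). intros n Hn. eapply Rle_lt_trans; [apply Cmod_le_abs|].
  specialize (H1 n ltac:(lia)). specialize (H2 n ltac:(lia)).
  change (Rabs (Re (x n) - a) + Rabs (Im (x n) - b) < e). lra.
Qed.

Theorem bounded_subsequence (z : nat -> C) (M : R) : (forall n, Cmod (z n) <= M) ->
  exists phi, increasing_seq phi /\ exists l, cvgC (fun n => z (phi n)) l.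
Proof.
  intros HM.
  destruct (diagonal_subsequence (fun k n => match k with O => Re (z n) | _ => Im (z n) end) M) as [phi [Hp H]].
  { intros k n. destruct k; (eapply Rle_trans; [|apply HM]); [apply re_le_Cmod|apply im_le_Cmod]. }
  exists phi. split; auto. destruct (H O) as [a Ha], (H 1%nat) as [b Hb].
  exists (a, b). apply cvgC_of_parts; auto.
Qed.

Lemma cvgC_Cmod_le (x : nat -> C) (l a : C) (b : R) : cvgC x l ->
  (forall N, exists n, (N <= n)%nat /\ Cmod (x n - a) <= b) -> Cmod (l - a) <= b.
Proof.
  intros H Hb. apply le_epsilon. intros e He. destruct (H e He) as [N HN].
  destruct (Hb N) as [n [h1 h2]]. specialize (HN n h1).
  generalize (Cmod_sub_triangle (x n) l a). rewrite (Cmod_sub_comm l (x n)). lra.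
Qed.

(** If uniformity fails, points where [|w n - g| >= e] accumulate at some [z], and the common
    Lipschitz constant contradicts convergence at [z]. Halving the radius keeps [z] inside the open
    disc. *)
Lemma equilipschitz_uniform (w : nat -> C -> C) (g : C -> C) (z0 : C) (r K : R) (N0 : nat) :
  0 < r -> 0 <= K ->
  (forall n z z', (N0 <= n)%nat -> Cmod (z - z0) < r -> Cmod (z' - z0) < r ->
     Cmod (w n z - w n z') <= K * Cmod (z - z')) ->
  (forall z, Cmod (z - z0) < r -> cvgC (fun n => w n z) (g z)) ->
  forall e, 0 < e -> exists N, forall n, (N <= n)%nat -> forall z, Cmod (z - z0) < r / 2 ->
    Cmod (w n z - g z) < e.
Proof.
  intros Hr HK HL Hc e He. apply NNPP. intros HN.
  destruct (functional_choice (fun (N : nat) (p : nat * C) => (N <= fst p)%nat /\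
    Cmod (snd p - z0) < r / 2 /\ e <= Cmod (w (fst p) (snd p) - g (snd p)))) as [s Hs].
  { intros N. apply NNPP. intros Q. apply HN. exists N. intros n Hn z Hz.
    apply Rnot_le_lt. intros h. apply Q. exists (n, z). auto. }
  assert (Gl : forall z z', Cmod (z - z0) < r -> Cmod (z' - z0) < r -> Cmod (g z - g z') <= K * Cmod (z - z')).
  { intros z z' Hz Hz'. apply le_epsilon. intros d Hd. assert (Hd2 : 0 < d / 2) by lra.
    destruct (Hc z Hz _ Hd2) as [N1 H1], (Hc z' Hz' _ Hd2) as [N2 H2].
    set (n := Nat.max N0 (Nat.max N1 N2)).
    generalize (H1 n ltac:(lia)) (H2 n ltac:(lia)) (HL n z z' ltac:(lia) Hz Hz')
      (Cmod_sub_triangle (w n z) (g z) (g z')) (Cmod_sub_triangle (w n z') (w n z) (g z')).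
    rewrite (Cmod_sub_comm (g z) (w n z)). lra. }
  destruct (bounded_subsequence (fun i => snd (s i)) (r / 2 + Cmod z0)) as [phi [Hp [z Hz]]].
  { intros n. generalize (Cmod_le_sub (snd (s n)) z0). destruct (Hs n) as [_ [h _]]. lra. }
  assert (Zr : Cmod (z - z0) <= r / 2).
  { apply (cvgC_Cmod_le _ _ _ _ Hz). intros N. exists N. split; auto. left; apply Hs. }
  assert (He4 : 0 < e / 4) by lra.
  assert (Hd : 0 < e / (4 * (K + 1))) by (apply Rdiv_lt_0_compat; lra).
  destruct (Hz _ Hd) as [N1 H1]. destruct (Hc z ltac:(lra) _ He4) as [N2 H2].
  set (i := Nat.max N0 (Nat.max N1 N2)). specialize (H1 i ltac:(lia)).
  assert (Gi := increasing_seq_ge phi Hp i). destruct (Hs (phi i)) as [s1 [s2 s3]].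
  set (n := fst (s (phi i))) in *. set (y := snd (s (phi i))) in *.
  specialize (H2 n ltac:(lia)).
  assert (L1 := HL n y z ltac:(lia) ltac:(lra) ltac:(lra)).
  assert (L2 := Gl z y ltac:(lra) ltac:(lra)). rewrite (Cmod_sub_comm z y) in L2.
  assert (Q : K * Cmod (y - z) <= e / 4).
  { apply lt_div_mult in H1; [|lra].
    generalize (Cmod_ge_0 (y - z)). nra. }
  generalize (Cmod_sub_triangle (w n z) (w n y) (g y)) (Cmod_sub_triangle (g z) (w n z) (g y)). lra.
Qed.

Lemma lipschitz_of_deriv (f f' : C -> C) (z0 : C) (r K : R) :
  (forall z, Cmod (z - z0) < r -> cderiv f z (f' z) /\ Cmod (f' z) <= K) ->
  forall z z', Cmod (z - z0) < r -> Cmod (z' - z0) < r -> Cmod (f z - f z') <= K * Cmod (z - z').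
Proof.
  intros H z z' Hz Hz'.
  assert (S : forall t, 0 <= t <= 1 -> Cmod (z' + RtoC t * (z - z') - z0) < r).
  { intros t Ht.
    replace (z' + RtoC t * (z - z') - z0)%C with (RtoC (1 - t) * (z' - z0) + RtoC t * (z - z0))%C
      by (rewrite RtoC_minus; ring).
    eapply Rle_lt_trans; [apply Cmod_triangle|]. rewrite !Cmod_mult, !Cmod_R, !Rabs_pos_eq by lra.
    destruct (Req_dec_T t 0) as [->|Nt]; [lra|]. nra. }
  assert (C' : forall y, Cmod (y - z0) < r -> ccont f' y).
  { intros y Hy. apply ccont_of_cderiv. apply cderiv_deriv with f (r - Cmod (y - z0)); [lra|].
    intros v Hv. apply H. generalize (Cmod_sub_triangle y v z0). lra. }
  assert (Cl : cont_on (fun t => (z - z') * f' (z' + RtoC t * (z - z')))%C 0 1).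
  { intros t Ht. rewrite Rmin_left, Rmax_right in Ht by lra. apply ccont_mult. apply ccont_const.
    apply (ccont_comp (fun t => z' + RtoC t * (z - z'))%C).
    eapply rderiv_cont, rderiv_segment. apply C', S; auto. }
  replace (f z - f z')%C with (cint (fun t => (z - z') * f' (z' + RtoC t * (z - z')))%C 0 1).
  - eapply Rle_trans; [apply (cint_ML _ _ _ (Cmod (z - z') * K)); auto|].
    + intros t Ht. rewrite Rmin_left, Rmax_right in Ht by lra. apply Cmod_mult_le; [lra|]. apply H, S; auto.
    + rewrite Rminus_0_r, Rabs_R1. lra.
  - rewrite (cint_FTC (fun t => f (z' + RtoC t * (z - z')))%C); auto.
    + f_equal; [|f_equal]; f_equal; ring.
    + intros t Ht. rewrite Rmin_left, Rmax_right in Ht by lra. eapply gder_eq.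
      apply rderiv_chain. apply rderiv_segment. apply H, S; auto. ring.
Qed.

(** * Marty's theorem *)

(** An enumeration, with repetitions, of the points whose coordinates are rational. Both coordinates
    share the denominator [m + 1], and signed numerators are differences of natural numbers. *)
Definition grid (k : nat) : C :=
  let (m, k1) := Cantor.of_nat k in
  let (p, q) := Cantor.of_nat k1 in
  let (i, j) := Cantor.of_nat p in
  let (i', j') := Cantor.of_nat q in
  ((INR i - INR j) / (INR m + 1), (INR i' - INR j') / (INR m + 1)).

Lemma grid_approx (x : R) (m : nat) :
  exists i j, Rabs ((INR i - INR j) / (INR m + 1) - x) <= / (INR m + 1).
Proof.
  assert (Hm := pos_INR m). set (k := up (x * (INR m + 1))).
  destruct (archimed (x * (INR m + 1))) as [h1 h2]. fold k in h1, h2.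
  exists (Z.to_nat k), (Z.to_nat (- k)).
  assert (E : INR (Z.to_nat k) - INR (Z.to_nat (- k)) = IZR k).
  { rewrite !INR_IZR_INZ, <- minus_IZR. f_equal. lia. }
  rewrite E. replace (IZR k / (INR m + 1) - x) with ((IZR k - x * (INR m + 1)) * / (INR m + 1)) by (field; lra).
  rewrite Rabs_mult, (Rabs_pos_eq (/ _)) by (left; apply Rinv_0_lt_compat; lra).
  rewrite <- (Rmult_1_l (/ (INR m + 1))) at 2.
  apply Rmult_le_compat_r. left; apply Rinv_0_lt_compat; lra. apply Rabs_le; lra.
Qed.

Lemma grid_dense (z : C) (d : R) : 0 < d -> exists k, Cmod (grid k - z) < d.
Proof.
  intros Hd. destruct (inv_INR_lt (d / 2)) as [m Hm]; [lra|]. specialize (Hm m (le_n m)).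
  destruct (grid_approx (Re z) m) as [i [j H1]], (grid_approx (Im z) m) as [i' [j' H2]].
  exists (Cantor.to_nat (m, Cantor.to_nat (Cantor.to_nat (i, j), Cantor.to_nat (i', j')))).
  unfold grid. rewrite !Cantor.cancel_of_to. eapply Rle_lt_trans; [apply Cmod_le_abs|].
  simpl. unfold Re, Im, Rminus in *. simpl in *. lra.
Qed.

(** Stereographic projection, up to an affine change of coordinates. *)
Definition sphere_coord (c : nat) (w : C) : R :=
  match c with O => sph w | 1%nat => Re w * sph w | _ => Im w * sph w end.

Lemma sph_le_1 (w : C) : sph w <= 1.
Proof.
  unfold sph. rewrite <- Rinv_1. apply Rinv_le_contravar; [lra|].
  generalize (pow2_ge_0 (Cmod w)); lra.
Qed.

Lemma sphere_coord_bound (c : nat) (w : C) : Rabs (sphere_coord c w) <= 1.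
Proof.
  assert (S := sph_pos w). assert (S1 := sph_le_1 w).
  assert (B : forall x, Rabs x <= Cmod w -> Rabs (x * sph w) <= 1).
  { intros x Hx. rewrite Rabs_mult, (Rabs_pos_eq (sph w)) by lra.
    apply Rle_trans with (Cmod w * sph w); [apply Rmult_le_compat_r; lra|].
    apply (Rmult_le_reg_r (1 + Cmod w ^ 2)); [generalize (pow2_ge_0 (Cmod w)); lra|].
    unfold sph. rewrite Rmult_assoc, Rinv_l by (generalize (pow2_ge_0 (Cmod w)); lra).
    generalize (pow2_ge_0 (Cmod w - 1)). nra. }
  destruct c as [|[|c]]; simpl.
  - rewrite Rabs_pos_eq; lra.
  - apply B, re_le_Cmod.
  - apply B, im_le_Cmod.
Qed.

Definition locally_bounded_at (v : nat -> C -> C) (z0 : C) : Prop :=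
  exists r B N, 0 < r /\ forall n z, (N <= n)%nat -> Cmod (z - z0) < r -> Cmod (v n z) <= B.

Definition locally_infinite_at (v : nat -> C -> C) (z0 : C) : Prop :=
  exists r, 0 < r /\ forall B, exists N, forall n z, (N <= n)%nat -> Cmod (z - z0) < r -> B < Cmod (v n z).

Lemma disc_shrink (z z0 w : C) (r : R) :
  Cmod (w - z) < r - Cmod (z - z0) -> Cmod (w - z0) < r.
Proof. intros H. generalize (Cmod_sub_triangle z w z0). lra. Qed.

(** [harnack] for [1 / v n], which is bounded by [1], gives [ln |v n z0| <= exp 8 * ln |v n z|]:
    divergence at the centre spreads uniformly to a disc. *)
Lemma infinite_at_point (v v' : nat -> C -> C) (z0 : C) (r : R) (N0 : nat) : 0 < r ->
  (forall n z, (N0 <= n)%nat -> Cmod (z - z0) < r -> cderiv (v n) z (v' n z) /\ 1 <= Cmod (v n z)) ->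
  (forall B, exists N, forall n, (N <= n)%nat -> B < Cmod (v n z0)) ->
  locally_infinite_at v z0.
Proof.
  intros Hr H HI. exists (r / 4). split; [lra|]. intros B.
  set (b := exp (exp 8 * ln (Rabs B + 1))).
  destruct (HI b) as [N HN]. exists (Nat.max N N0). intros n z Hn Hz.
  assert (h1 : b < Cmod (v n z0)) by (apply HN; lia).
  assert (Hv : forall w, Cmod (w - z0) < r -> v n w <> 0%C).
  { intros w Hw. apply Cmod_gt_0. destruct (H n w ltac:(lia) Hw). lra. }
  assert (Q : ln 1 - ln (Cmod (/ v n z0)) <= exp 8 * (ln 1 - ln (Cmod (/ v n z)))).
  { apply (harnack (fun w => / v n w)%C (fun w => - v' n w / (v n w * v n w))%C z0 z r 1 Hr).
    - intros w Hw. destruct (H n w ltac:(lia) Hw) as [k1 k2]. split; [|split].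
      + apply gder_inv. apply ccont_id. exact k1. auto.
      + apply Cmod_gt_0. rewrite Cmod_inv; auto. apply Rinv_0_lt_compat. lra.
      + rewrite Cmod_inv; auto. rewrite <- Rinv_1. apply Rinv_le_contravar; lra.
    - lra. }
  assert (z1 : v n z0 <> 0%C) by (apply Hv; rewrite Cmod_self; lra).
  assert (z2 : v n z <> 0%C) by (apply Hv; lra).
  assert (P1 := proj1 (Cmod_gt_0 _) z1). assert (P2 := proj1 (Cmod_gt_0 _) z2).
  rewrite ln_1, !Cmod_inv, !ln_Rinv in Q by auto.
  apply ln_increasing in h1; [|apply exp_pos]. unfold b in h1. rewrite ln_exp in h1.
  assert (L : ln (Rabs B + 1) < ln (Cmod (v n z))).
  { apply (Rmult_lt_reg_l (exp 8)); [apply exp_pos|]. lra. }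
  apply ln_lt_inv in L; auto. generalize (Rle_abs B); lra. generalize (Rabs_pos B); lra.
Qed.

(** The bound is asked only from some index on, because the rescaled functions are controlled on
    discs that grow with [n]. *)
Definition spherically_bounded_at (v v' : nat -> C -> C) (z0 : C) : Prop :=
  exists r K N, 0 < r /\ forall n z, (N <= n)%nat -> Cmod (z - z0) < r ->
    cderiv (v n) z (v' n z) /\ Cmod (v' n z) <= K * (1 + Cmod (v n z) ^ 2).

Lemma spherically_bounded_lipschitz (v v' : nat -> C -> C) (z0 : C) :
  spherically_bounded_at v v' z0 ->
  exists r K N, 0 < r /\ 0 < K /\
   (forall n z, (N <= n)%nat -> Cmod (z - z0) < r -> cderiv (v n) z (v' n z) /\
      Rabs (sph (v n z) - sph (v n z0)) <= K * Cmod (z - z0)).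
Proof.
  intros [r [K [N [Hr H]]]]. exists r, (Rabs K + 1), N. assert (A := Rabs_pos K).
  split; auto. split; [lra|]. intros n z Hn Hz. split; [apply H; auto|].
  apply Rle_trans with (K * Cmod (z - z0)).
  - apply (sph_lipschitz (v n) (v' n) z0 z K). intros t Ht. apply H; auto.
    eapply Rle_lt_trans; [apply segment_dist; auto|auto].
  - apply Rmult_le_compat_r; [apply Cmod_ge_0|generalize (Rle_abs K); lra].
Qed.

(** If [s = 0] the values at [z0] tend to infinity, and the Lipschitz bound on [sph] keeps
    [sph <= 1/4 + 1/4], that is [|v n| >= 1], nearby, so [infinite_at_point] applies. If [s > 0] the
    same bound keeps [sph >= s / 2] nearby, hence [|v n|] bounded. *)
Lemma bounded_or_infinite (v v' : nat -> C -> C) (z0 : C) (s : R) :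
  spherically_bounded_at v v' z0 -> cvgR (fun n => sph (v n z0)) s ->
  locally_bounded_at v z0 \/ locally_infinite_at v z0.
Proof.
  intros Hv Hs. destruct (spherically_bounded_lipschitz v v' z0 Hv) as [r [K [N [Hr [HK H]]]]].
  assert (S0 : 0 <= s).
  { apply le_epsilon. intros e He. destruct (Hs e He) as [N1 H1]. specialize (H1 N1 (le_n _)).
    apply Rabs_def2 in H1. generalize (sph_pos (v N1 z0)). lra. }
  destruct (Req_dec_T s 0) as [->|N0].
  - right.
    assert (Hq : 0 < / (4 * K)) by (apply Rinv_0_lt_compat; lra).
    destruct (Hs (/ 4)) as [N1 H1]; [lra|].
    apply (infinite_at_point v v' z0 (Rmin r (/ (4 * K))) (Nat.max N N1)).
    + apply Rmin_glb_lt; auto.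
    + intros n z Hn Hz. destruct (Rlt_Rmin _ _ _ Hz) as [z1 z2].
      split; [apply H; auto; lia|].
      destruct (H n z ltac:(lia) z1) as [_ k1]. specialize (H1 n ltac:(lia)).
      apply (Rmult_lt_compat_l K) in z2; auto.
      replace (K * / (4 * K)) with (/ 4) in z2 by (field; lra).
      apply Rabs_def2 in H1. apply Rabs_le_between in k1.
      assert (k2 : sph (v n z) <= / 2) by lra.
      apply sph_Cmod_ge in k2; [|lra]. rewrite Rinv_inv in k2. generalize (Cmod_ge_0 (v n z)). nra.
    + intros B. set (b := Rabs B + 1). assert (Hb : 1 <= b) by (unfold b; generalize (Rabs_pos B); lra).
      assert (Hb2 : 0 < / (1 + b ^ 2)) by (apply Rinv_0_lt_compat; nra).
      destruct (Hs _ Hb2) as [N2 H2]. exists N2. intros n Hn. specialize (H2 n Hn).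
      apply Rabs_def2 in H2. assert (k : sph (v n z0) <= / (1 + b ^ 2)) by lra.
      apply sph_Cmod_ge in k; auto. rewrite Rinv_inv in k.
      assert (b <= Cmod (v n z0)) by (generalize (Cmod_ge_0 (v n z0)); nra).
      unfold b in *. generalize (Rle_abs B); lra.
  - left.
    assert (Hq : 0 < s / (4 * K)) by (apply Rdiv_lt_0_compat; lra).
    destruct (Hs (s / 4)) as [N1 H1]; [lra|].
    exists (Rmin r (s / (4 * K))), (1 + / (s / 2)), (Nat.max N N1).
    split; [apply Rmin_glb_lt; auto|]. intros n z Hn Hz.
    destruct (Rlt_Rmin _ _ _ Hz) as [z1 z2].
    destruct (H n z ltac:(lia) z1) as [_ k1]. specialize (H1 n ltac:(lia)).
    apply (Rmult_lt_compat_l K) in z2; auto.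
    replace (K * (s / (4 * K))) with (s / 4) in z2 by (field; lra).
    apply Rabs_def2 in H1. apply Rabs_le_between in k1.
    assert (k2 : s / 2 <= sph (v n z)) by lra.
    apply sph_Cmod in k2; [|lra].
    assert (Hi : 0 < / (s / 2)) by (apply Rinv_0_lt_compat; lra).
    generalize (Cmod_ge_0 (v n z)). set (m := Cmod (v n z)) in *. set (i := / (s / 2)) in *.
    clearbody m i. nra.
Qed.

Lemma cvgR_of_cauchy (x : nat -> R) :
  (forall e, 0 < e -> exists N, forall n m, (N <= n)%nat -> (N <= m)%nat -> Rabs (x n - x m) < e) ->
  exists l, cvgR x l.
Proof.
  intros H. destruct (Rcomplete.R_complete x) as [l Hl].
  - intros e He. destruct (H e He) as [N HN]. exists N. intros n m Hn Hm. apply HN; lia.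
  - exists l. exact Hl.
Qed.

Lemma cvgC_of_cauchy (x : nat -> C) :
  (forall e, 0 < e -> exists N, forall n m, (N <= n)%nat -> (N <= m)%nat -> Cmod (x n - x m) < e) ->
  exists l, cvgC x l.
Proof.
  intros H.
  destruct (cvgR_of_cauchy (fun n => Re (x n))) as [a Ha];
    [|destruct (cvgR_of_cauchy (fun n => Im (x n))) as [b Hb]; [|exists (a, b); apply cvgC_of_parts; auto]];
    intros e He; destruct (H e He) as [N HN]; exists N; intros n m Hn Hm;
    (eapply Rle_lt_trans; [|apply (HN n m Hn Hm)]).
  - apply (re_le_Cmod (x n - x m)).
  - apply (im_le_Cmod (x n - x m)).
Qed.

(** Only [sph] is transported from the grid to [z0] here: its Lipschitz bound needs no bound on the
    functions, so it is available before bounded and infinite behaviour are told apart. *)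
Lemma sph_cvg (v v' : nat -> C -> C) (z0 : C) :
  (forall k, exists l, cvgR (fun n => sph (v n (grid k))) l) ->
  spherically_bounded_at v v' z0 -> exists l, cvgR (fun n => sph (v n z0)) l.
Proof.
  intros Hg Hv. destruct (spherically_bounded_lipschitz v v' z0 Hv) as [r [K [N [Hr [HK H]]]]].
  apply cvgR_of_cauchy. intros e He.
  destruct (grid_dense z0 (Rmin r (e / 4 / K))) as [k Hk].
  { apply Rmin_glb_lt; auto. repeat apply Rdiv_lt_0_compat; lra. }
  destruct (Hg k) as [l Hl]. destruct (Rlt_Rmin _ _ _ Hk) as [z1 z2]. apply lt_div_mult in z2; auto.
  destruct (Hl (e / 4)) as [N1 H1]; [lra|].
  exists (Nat.max N N1). intros n m Hn Hm.
  generalize (H1 n ltac:(lia)) (H1 m ltac:(lia)) (proj2 (H n _ ltac:(lia) z1)) (proj2 (H m _ ltac:(lia) z1)).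
  intros a1 a2 a3 a4. apply Rabs_def2 in a1, a2. apply Rabs_le_between in a3, a4.
  apply Rabs_def1; lra.
Qed.

Lemma bounded_lipschitz (v v' : nat -> C -> C) (z0 : C) :
  spherically_bounded_at v v' z0 -> locally_bounded_at v z0 ->
  exists r B L N, 0 < r /\ 0 <= L /\
    (forall n z, (N <= n)%nat -> Cmod (z - z0) < r -> cderiv (v n) z (v' n z) /\ Cmod (v n z) <= B) /\
    (forall n z z', (N <= n)%nat -> Cmod (z - z0) < r -> Cmod (z' - z0) < r ->
       Cmod (v n z - v n z') <= L * Cmod (z - z')).
Proof.
  intros [r2 [K [N2 [Hr2 H2]]]] [r1 [B [N1 [Hr1 H1]]]].
  exists (Rmin r1 r2), B, (Rabs K * (1 + B ^ 2)), (Nat.max N1 N2).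
  assert (H : forall n z, (Nat.max N1 N2 <= n)%nat -> Cmod (z - z0) < Rmin r1 r2 ->
    cderiv (v n) z (v' n z) /\ Cmod (v n z) <= B /\ Cmod (v' n z) <= Rabs K * (1 + B ^ 2)).
  { intros n z Hn Hz. destruct (Rlt_Rmin _ _ _ Hz) as [z1 z2].
    destruct (H2 n z ltac:(lia) z2) as [h1 h2]. assert (h3 := H1 n z ltac:(lia) z1).
    split; [auto|split; auto]. eapply Rle_trans; [exact h2|].
    assert (h4 := Cmod_ge_0 (v n z)). apply Rle_trans with (Rabs K * (1 + Cmod (v n z) ^ 2)).
    - apply Rmult_le_compat_r; [nra|apply Rle_abs].
    - apply Rmult_le_compat_l; [apply Rabs_pos|nra]. }
  split; [apply Rmin_glb_lt; auto|split; [apply Rmult_le_pos; [apply Rabs_pos|nra]|split]].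
  - intros n z Hn Hz. destruct (H n z Hn Hz) as [h1 [h2 _]]. auto.
  - intros n z z' Hn. apply (lipschitz_of_deriv (v n) (v' n)). intros y Hy.
    destruct (H n y Hn Hy) as [h1 [_ h3]]. auto.
Qed.

Lemma Rabs_sub_lt (a b l d : R) : Rabs (a - l) < d / 2 -> Rabs (b - l) < d / 2 -> Rabs (a - b) < d.
Proof. intros H1 H2. apply Rabs_def2 in H1, H2. apply Rabs_def1; lra. Qed.

(** From [s (w - w') = s w - s' w' + w' (s' - s)] with [s = sph w], [s' = sph w']. *)
Lemma sphere_coord_dist (w w' : C) (B d : R) : Cmod w <= B -> Cmod w' <= B ->
  Rabs (sph w - sph w') < d -> Rabs (Re w * sph w - Re w' * sph w') < d ->
  Rabs (Im w * sph w - Im w' * sph w') < d -> Cmod (w - w') <= (1 + B ^ 2) * (2 + B) * d.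
Proof.
  intros Hw Hw' H0 H1 H2. assert (W := Cmod_ge_0 w). assert (W' := Cmod_ge_0 w').
  assert (S : Cmod (RtoC (sph w) * (w - w')) <= (2 + B) * d).
  { set (k := (Re w * sph w - Re w' * sph w', Im w * sph w - Im w' * sph w') : C).
    replace (RtoC (sph w) * (w - w'))%C with (k - RtoC (sph w - sph w') * w')%C.
    - eapply Rle_trans; [apply Cmod_sub_le|]. rewrite Cmod_mult, Cmod_R.
      assert (A := Cmod_le_abs k). simpl in A.
      assert (Rabs (sph w - sph w') * Cmod w' <= d * B) by (apply Rmult_le_compat; auto using Rabs_pos; lra).
      lra.
    - unfold k. destruct w, w'. unfold Cminus, Cplus, Cmult, Copp, RtoC, Re, Im; simpl. f_equal; ring. }
  assert (P := sph_pos w). rewrite Cmod_mult, Cmod_R, Rabs_pos_eq in S by lra.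
  assert (P1 : 1 <= (1 + B ^ 2) * sph w).
  { apply Rle_trans with ((1 + Cmod w ^ 2) * sph w).
    - unfold sph. rewrite Rinv_r; [lra|nra].
    - apply Rmult_le_compat_r; nra. }
  assert (D := Cmod_ge_0 (w - w')).
  apply Rle_trans with ((1 + B ^ 2) * (sph w * Cmod (w - w'))); [nra|].
  rewrite Rmult_assoc. apply Rmult_le_compat_l; [nra|auto].
Qed.

(** Where the functions are bounded, closeness of the sphere coordinates at a nearby grid point
    gives closeness of the values there, with a factor [q] depending only on the bound; the
    Lipschitz estimate carries it to [z0]. *)
Lemma bounded_cvg (v v' : nat -> C -> C) (z0 : C) :
  (forall c k, exists l, cvgR (fun n => sphere_coord c (v n (grid k))) l) ->
  spherically_bounded_at v v' z0 -> locally_bounded_at v z0 -> exists l, cvgC (fun n => v n z0) l.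
Proof.
  intros Hg Hv Hb. destruct (bounded_lipschitz v v' z0 Hv Hb) as [r [B [L [N [Hr [HL [H1 H2]]]]]]].
  apply cvgC_of_cauchy. intros e He.
  destruct (grid_dense z0 (Rmin r (e / 4 / (L + 1)))) as [k Hk].
  { apply Rmin_glb_lt; auto. repeat apply Rdiv_lt_0_compat; lra. }
  destruct (Rlt_Rmin _ _ _ Hk) as [z1 z2]. apply lt_div_mult in z2; [|lra].
  assert (B0 : 0 <= B) by (eapply Rle_trans; [apply Cmod_ge_0|apply (H1 N _ (le_n N) z1)]).
  set (q := (1 + B ^ 2) * (2 + B)). assert (Hq : 0 < q) by (apply Rmult_lt_0_compat; nra).
  assert (Hd : 0 < e / 4 / q) by (repeat apply Rdiv_lt_0_compat; lra).
  destruct (Hg O k) as [l0 C0], (Hg 1%nat k) as [l1 C1], (Hg 2%nat k) as [l2 C2].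
  destruct (C0 _ (Rdiv_lt_0_compat _ 2 Hd Rlt_0_2)) as [N0 K0], (C1 _ (Rdiv_lt_0_compat _ 2 Hd Rlt_0_2)) as [N1 K1],
    (C2 _ (Rdiv_lt_0_compat _ 2 Hd Rlt_0_2)) as [N2 K2].
  exists (Nat.max N (Nat.max N0 (Nat.max N1 N2))). intros n m Hn Hm. simpl in K0, K1, K2.
  assert (E0 := Rabs_sub_lt _ _ _ _ (K0 n ltac:(lia)) (K0 m ltac:(lia))).
  assert (E1 := Rabs_sub_lt _ _ _ _ (K1 n ltac:(lia)) (K1 m ltac:(lia))).
  assert (E2 := Rabs_sub_lt _ _ _ _ (K2 n ltac:(lia)) (K2 m ltac:(lia))).
  assert (Bn := proj2 (H1 n _ ltac:(lia) z1)). assert (Bm := proj2 (H1 m _ ltac:(lia) z1)).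
  assert (Ln := H2 n z0 (grid k) ltac:(lia) ltac:(rewrite Cmod_self; auto) z1).
  assert (Lm := H2 m (grid k) z0 ltac:(lia) z1 ltac:(rewrite Cmod_self; auto)).
  rewrite (Cmod_sub_comm z0) in Ln. assert (G0 := Cmod_ge_0 (grid k - z0)).
  assert (D := sphere_coord_dist (v n (grid k)) (v m (grid k)) B (e / 4 / q) Bn Bm E0 E1 E2).
  fold q in D. replace (q * (e / 4 / q)) with (e / 4) in D by (field; lra).
  generalize (Cmod_sub_triangle (v n (grid k)) (v n z0) (v m z0))
    (Cmod_sub_triangle (v m (grid k)) (v n (grid k)) (v m z0)). lra.
Qed.

(** Along a subsequence the sphere coordinates converge at every grid point. Each point of [D] then
    has a neighbourhood of boundedness, with a limit at the point, or one of divergence to infinity;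
    both kinds form open sets without common point, so connectedness of [D] leaves only one. *)
Theorem marty (D : C -> Prop) (u u' : nat -> C -> C) : open D -> C_connected D ->
  (forall z, D z -> spherically_bounded_at u u' z) ->
  exists phi, increasing_seq phi /\
   ((exists g, (forall z, D z -> exists l, cderiv g z l) /\
      loc_unif_cvg D (fun n => u (phi n)) g) \/
    loc_unif_cvg_infty D (fun n => u (phi n))).
Proof.
  intros HO HC Hu.
  (* The index [k] codes a pair made of a sphere coordinate and a grid point, so that one extraction
     treats them all. *)
  destruct (diagonal_subsequence (fun k n => let (c, k') := Cantor.of_nat k in
    sphere_coord c (u n (grid k'))) 1) as [phi [Hphi Hcv]].
  { intros k n. destruct (Cantor.of_nat k). apply sphere_coord_bound. }
  exists phi. split; auto.
  set (v n := u (phi n)). set (v' n := u' (phi n)).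
  assert (Hv : forall z, D z -> spherically_bounded_at v v' z).
  { intros z Hz. destruct (Hu z Hz) as [r [K [N [Hr H]]]]. exists r, K, N. split; auto.
    intros n w Hn. apply H. generalize (increasing_seq_ge phi Hphi n); lia. }
  assert (Hg : forall c k, exists l, cvgR (fun n => sphere_coord c (v n (grid k))) l).
  { intros c k. destruct (Hcv (Cantor.to_nat (c, k))) as [l Hl]. exists l.
    rewrite Cantor.cancel_of_to in Hl. exact Hl. }
  assert (Alt : forall z, D z ->
    (locally_bounded_at v z /\ exists l, cvgC (fun n => v n z) l) \/ locally_infinite_at v z).
  { intros z Hz. destruct (sph_cvg v v' z (Hg O) (Hv z Hz)) as [s Hs].
    destruct (bounded_or_infinite v v' z s (Hv z Hz) Hs) as [h|h]; [left|right; auto].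
    split; auto. apply (bounded_cvg v v'); auto. }
  assert (Inf : forall z, locally_infinite_at v z ->
    forall B, exists N, forall n, (N <= n)%nat -> B < Cmod (v n z)).
  { intros z [r [Hr H]] B. destruct (H B) as [N HN]. exists N. intros n Hn. apply HN; auto.
    rewrite Cmod_self; auto. }
  destruct (classic (exists z, D z /\ locally_infinite_at v z)) as [HI|HI];
  [destruct (classic (exists z, D z /\ locally_bounded_at v z)) as [HB|HB]|].
  (* Openness comes from shrinking the disc; at a common point [|v n z|] would be eventually bounded
     and yet exceed that bound. *)
  - exfalso. destruct (HC (locally_bounded_at v) (locally_infinite_at v)) as [z [_ [[r [B [N [Hr hB]]]] h2]]]; auto.
    + apply open_Cmod. intros z [r [B [N [Hr H]]]]. exists r. split; auto. intros w Hw.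
      exists (r - Cmod (w - z)), B, N. split; [lra|]. intros n y Hn Hy. apply H; auto.
      apply (disc_shrink w); auto.
    + apply open_Cmod. intros z [r [Hr H]]. exists r. split; auto. intros w Hw.
      exists (r - Cmod (w - z)). split; [lra|]. intros B. destruct (H B) as [N HN]. exists N.
      intros n y Hn Hy. apply HN; auto. apply (disc_shrink w); auto.
    + intros z Hz. destruct (Alt z Hz) as [[h _]|h]; auto.
    + destruct (Inf z h2 B) as [N2 H2].
      generalize (H2 (Nat.max N N2) ltac:(lia)) (hB (Nat.max N N2) z ltac:(lia) ltac:(rewrite Cmod_self; auto)). lra.
  - right. intros z0 Hz0. destruct (Alt z0 Hz0) as [[h _]|[r [Hr H]]].
    { exfalso. apply HB. eauto. }
    exists r. split; auto. intros K. destruct (H K) as [N HN]. exists N. intros n Hn z _ Hz. apply HN; auto.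
  - left. assert (Pt : forall z, exists l, D z -> cvgC (fun n => v n z) l).
    { intros z. destruct (classic (D z)) as [Hz|Hz]; [|exists 0%C; tauto].
      destruct (Alt z Hz) as [[_ [l Hl]]|h]; [exists l; auto|]. exfalso; apply HI; eauto. }
    destruct (functional_choice _ Pt) as [g Hgl]. exists g.
    assert (Unif : forall z0, D z0 -> exists r N0, 0 < r /\
      (forall n z, (N0 <= n)%nat -> Cmod (z - z0) < r -> exists l, cderiv (v n) z l) /\
      forall e, 0 < e -> exists N, forall n, (N <= n)%nat ->
        forall z, Cmod (z - z0) < r -> Cmod (v n z - g z) < e).
    { intros z0 Hz0. destruct (Alt z0 Hz0) as [[Hb _]|h]; [|exfalso; apply HI; eauto].
      destruct (bounded_lipschitz v v' z0 (Hv z0 Hz0) Hb) as [r1 [B [L [N [Hr1 [HL [H1 H2]]]]]]].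
      destruct (proj1 (open_Cmod D) HO z0 Hz0) as [r3 [Hr3 H3]].
      set (r := Rmin r1 r3). assert (Hr : 0 < r) by (apply Rmin_glb_lt; auto).
      assert (Rr : r <= r1 /\ r <= r3) by (split; [apply Rmin_l|apply Rmin_r]).
      exists (r / 2), N. split; [lra|]. split.
      - intros n z Hn Hz. exists (v' n z). apply H1; [lia|lra].
      - apply (equilipschitz_uniform v g z0 r L N); auto.
        + intros n z z' Hn Hz Hz'. apply H2; [auto|lra|lra].
        + intros z Hz. apply Hgl, H3. lra. }
    split.
    + intros z Hz. destruct (Unif z Hz) as [r [N0 [Hr [Hd Hu']]]].
      apply (weierstrass v g z r N0); auto.
      intros e He. destruct (Hu' e He) as [N HN]. exists N. intros n w Hn Hw. apply HN; auto.
    + intros z Hz. destruct (Unif z Hz) as [r [N0 [Hr [Hd Hu']]]]. exists r. split; auto.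
      intros e He. destruct (Hu' e He) as [N HN]. exists N. intros n Hn w _ Hw. apply HN; auto.
Qed.

(** * Zalcman's rescaling *)

Lemma plane_connected : C_connected (fun _ => True).
Proof.
  intros U V HU HV Hcov [a [_ Ha]] [b [_ Hb]]. apply NNPP. intros Hno.
  assert (No : forall z, U z -> V z -> False) by (intros z h1 h2; apply Hno; exists z; auto).
  set (g t := (a + RtoC t * (b - a))%C).
  (* the indicator function of [U] on the line through [a] and [b] *)
  destruct (functional_choice (fun t y => (U (g t) -> y = 1) /\ (V (g t) -> y = 0))) as [f Hf].
  { intros t. destruct (Hcov (g t) I) as [h|h]; [exists 1|exists 0]; split; auto; intros; exfalso; eauto. }
  assert (Loc : forall (W : C -> Prop) y, open W -> (forall t, W (g t) -> f t = y) ->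
    forall t, W (g t) -> continuity_pt f t).
  { intros W y HW Hy t Ht.
    assert (HL : locally t (fun s => W (g s))).
    { apply (proj1 (clim_filterlim (locally t) (FF := filter_filter) g (g t)) (rderiv_cont _ _ _ (rderiv_segment a (b - a) t)) W).
      apply HW, Ht. }
    apply continuity_pt_filterlim. apply filterlim_ext_loc with (fun _ => f t); [|apply filterlim_const].
    revert HL. apply filter_imp. intros s Hs. rewrite (Hy t Ht), (Hy s Hs). reflexivity. }
  assert (E : f 0 = 1 /\ f 1 = 0).
  { split; apply Hf; unfold g; [replace (a + RtoC 0 * (b - a))%C with a by ring|
      replace (a + RtoC 1 * (b - a))%C with b by ring]; auto. }
  destruct (IVT_gen f 0 1 (/ 2)) as [t [_ Ht]].
  - intros t. destruct (Hcov (g t) I) as [h|h]; [apply (Loc U 1)|apply (Loc V 0)]; auto; intros; apply Hf; auto.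
  - destruct E as [-> ->]. minmax.
  - destruct (Hcov (g t) I) as [h|h]; apply Hf in h; lra.
Qed.

Lemma continuous_bounded_disc (f : C -> C) (c : C) (r : R) :
  (forall w, Cmod (w - c) <= r -> ccont f w) ->
  exists B, forall w, Cmod (w - c) <= r -> Cmod (f w) <= B.
Proof.
  intros H. apply NNPP. intros Q.
  destruct (functional_choice (fun (n : nat) w => Cmod (w - c) <= r /\ INR n < Cmod (f w))) as [s Hs].
  { intros n. apply NNPP. intros Q2. apply Q. exists (INR n). intros w Hw.
    apply Rnot_lt_le. intros h. apply Q2. exists w; auto. }
  destruct (bounded_subsequence s (r + Cmod c)) as [phi [Hp [z Hz]]].
  { intros n. generalize (Cmod_le_sub (s n) c). destruct (Hs n). lra. }
  assert (Zr : Cmod (z - c) <= r).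
  { apply (cvgC_Cmod_le _ _ _ _ Hz). intros N. exists N. split; auto. apply Hs. }
  destruct (proj1 (locally_Cmod _ _) (H z Zr 1 Rlt_0_1)) as [d [Hd Hf]].
  destruct (Hz d Hd) as [N1 H1].
  destruct (INR_archimed 1 (Cmod (f z) + 1)) as [N2 H2]; [lra|]. rewrite Rmult_1_r in H2.
  set (n := Nat.max N1 N2). specialize (H1 n ltac:(lia)). destruct (Hs (phi n)) as [_ h].
  assert (k : INR N2 <= INR (phi n)).
  { apply le_INR. generalize (increasing_seq_ge phi Hp n). lia. }
  generalize (Hf _ H1) (Cmod_le_sub (f (s (phi n))) (f z)). lra.
Qed.

(** Zalcman's rescaling at an almost maximal point of
    [(2R - |z - z0|) |f'| / (1 + |f|^2)]. *)
Theorem rescaling_point (f f' : C -> C) (z0 w : C) (R k : R) : 0 < R -> 0 < k ->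
  (forall z, Cmod (z - z0) < 4 * R -> cderiv f z (f' z)) ->
  Cmod (w - z0) < R -> k * (1 + Cmod (f w) ^ 2) < Cmod (f' w) ->
  exists z rho, 0 < rho /\ rho * k <= 4 /\ Cmod (z - z0) < 2 * R /\
    Cmod (f' z) * rho = 1 + Cmod (f z) ^ 2 /\
    forall x, Cmod x <= R * k / 4 -> Cmod (z + RtoC rho * x - z0) < 2 * R /\
      Cmod (f' (z + RtoC rho * x)%C) * rho <= 4 * (1 + Cmod (f (z + RtoC rho * x)%C) ^ 2).
Proof.
  intros HR Hk Hf Hw Hbig.
  assert (F1 : forall z, 0 < 1 + Cmod (f z) ^ 2) by (intros z; generalize (pow2_ge_0 (Cmod (f z))); lra).
  set (s z := Cmod (f' z) / (1 + Cmod (f z) ^ 2)).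
  assert (Es : forall z, Cmod (f' z) = s z * (1 + Cmod (f z) ^ 2)).
  { intros z. unfold s. field. generalize (F1 z); lra. }
  assert (s0 : forall z, 0 <= s z).
  { intros z. apply Rmult_le_pos; [apply Cmod_ge_0|left; apply Rinv_0_lt_compat, F1]. }
  assert (sw : k < s w).
  { apply (Rmult_lt_reg_r (1 + Cmod (f w) ^ 2)); auto. rewrite <- Es. auto. }
  (* The supremum ranges over [|z - z0| < 2 * R], and Cauchy's estimate on discs of radius [R] about
     such [z] needs [f] bounded up to [3 * R]; it makes the supremum finite. *)
  destruct (continuous_bounded_disc f z0 (3 * R)) as [B HB].
  { intros z Hz. eapply cderiv_cont, Hf. lra. }
  set (q z := (2 * R - Cmod (z - z0)) * s z).
  destruct (completeness (fun x => exists z, Cmod (z - z0) < 2 * R /\ x = q z)) as [S [S1 S2]].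
  - exists (2 * R * (4 * B / R)). intros x [z [Hz ->]]. unfold q. apply Rmult_le_compat; auto.
    lra. generalize (Cmod_ge_0 (z - z0)); lra.
    apply Rle_trans with (Cmod (f' z)).
    + rewrite Es. rewrite <- (Rmult_1_r (s z)) at 1. apply Rmult_le_compat_l; auto.
      generalize (pow2_ge_0 (Cmod (f z))); lra.
    + apply (cauchy_estimate f f' z R B HR). intros v Hv.
      generalize (Cmod_sub_triangle z v z0). intros. split; [apply Hf|apply HB]; lra.
  - exists (q w), w. split; auto. lra.
  - assert (Sk : R * k < S).
    { apply Rlt_le_trans with (q w); [|apply S1; exists w; split; auto; lra].
      unfold q. apply Rlt_le_trans with (R * s w); [apply Rmult_lt_compat_l; auto|].
      apply Rmult_le_compat_r; auto. lra. }
    assert (Rk : 0 < R * k) by (apply Rmult_lt_0_compat; auto).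
    assert (Hz : exists z, Cmod (z - z0) < 2 * R /\ S / 2 < q z).
    { apply NNPP. intros Q. assert (S <= S / 2); [|lra]. apply S2. intros x [z [Hz ->]].
      apply Rnot_lt_le. intros h. apply Q. exists z; auto. }
    destruct Hz as [z [Hz Hq]].
    set (d := 2 * R - Cmod (z - z0)). assert (Hd : 0 < d) by (unfold d; lra).
    change (S / 2 < d * s z) in Hq.
    assert (sz : 0 < s z) by nra.
    assert (Hi : 0 < / s z) by (apply Rinv_0_lt_compat; auto).
    assert (Hr : s z * / s z = 1) by (apply Rinv_r; lra).
    (* The scale is the reciprocal of the spherical derivative at [z], which normalises that of the
       rescaled function to [1] at [0]. *)
    exists z, (/ s z). split; auto. split; [|split; auto; split].
    + assert (d2 : d <= 2 * R) by (unfold d; generalize (Cmod_ge_0 (z - z0)); lra).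
      assert (T : R * k <= 4 * R * s z) by nra.
      assert (T2 : k <= 4 * s z) by nra.
      apply (Rmult_le_reg_r (s z)); auto. rewrite Rmult_comm, <- Rmult_assoc, Hr. lra.
    + rewrite Es. field. lra.
    (* As [d * s z > S / 2 > R * k / 2], such an [x] moves the point by at most [d / 2], so at least
       half of the margin [d] remains. Then [d / 2 * s y <= S < 2 * d * s z] gives the constant
       [4]. *)
    + intros x Hx.
      assert (Hdx : / s z * Cmod x <= d / 2).
      { apply (Rmult_le_reg_l (s z)); auto. rewrite <- Rmult_assoc, Hr. lra. }
      assert (E1 : Cmod (z + RtoC (/ s z) * x - z0) <= Cmod (z - z0) + / s z * Cmod x).
      { replace (z + RtoC (/ s z) * x - z0)%C with ((z - z0) + RtoC (/ s z) * x)%C by ring.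
        eapply Rle_trans; [apply Cmod_triangle|].
        rewrite Cmod_mult, Cmod_R, Rabs_pos_eq by lra. lra. }
      set (y := (z + RtoC (/ s z) * x)%C) in *.
      assert (E2 : Cmod (y - z0) < 2 * R) by (unfold d in *; lra).
      split; auto.
      assert (E3 : q y <= S) by (apply S1; exists y; auto).
      unfold q in E3. assert (E4 : d / 2 * s y <= S).
      { eapply Rle_trans; [|exact E3]. apply Rmult_le_compat_r; auto. unfold d in *; lra. }
      assert (E5 : s y <= 4 * s z) by nra.
      rewrite Es. replace (s y * (1 + Cmod (f y) ^ 2) * / s z) with (s y * / s z * (1 + Cmod (f y) ^ 2)) by ring.
      apply Rmult_le_compat_r; [generalize (F1 y); lra|].
      apply (Rmult_le_reg_r (s z)); auto. rewrite Rmult_assoc, (Rmult_comm (/ s z)), Hr. lra.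
Qed.

(** * Passage to the limit in the rescaled conditions *)

Definition uniform_near (u : nat -> C -> C) (g : C -> C) (c : C) (r : R) : Prop :=
  forall e, 0 < e -> exists N, forall n, (N <= n)%nat -> forall w, Cmod (w - c) < r ->
    Cmod (u n w - g w) < e.

Lemma uniform_near_minus (u v : nat -> C -> C) (g h : C -> C) (c : C) (r : R) :
  uniform_near u g c r -> uniform_near v h c r ->
  uniform_near (fun n w => u n w - v n w)%C (fun w => g w - h w)%C c r.
Proof.
  intros Hu Hv e He. assert (He2 : 0 < e / 2) by lra.
  destruct (Hu _ He2) as [N1 H1], (Hv _ He2) as [N2 H2]. exists (Nat.max N1 N2). intros n Hn w Hw.
  specialize (H1 n ltac:(lia) w Hw). specialize (H2 n ltac:(lia) w Hw).
  replace (u n w - v n w - (g w - h w))%C with ((u n w - g w) - (v n w - h w))%C by ring.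
  eapply Rle_lt_trans; [apply Cmod_sub_le|]. lra.
Qed.

Lemma uniform_near_deriv (u u' : nat -> C -> C) (g g' : C -> C) (c : C) (r : R) (N0 : nat) : 0 < r ->
  (forall n w, (N0 <= n)%nat -> Cmod (w - c) < r -> cderiv (u n) w (u' n w)) ->
  (forall w, Cmod (w - c) < r -> cderiv g w (g' w)) ->
  uniform_near u g c r -> uniform_near u' g' c (r / 2).
Proof.
  intros Hr Hu Hg H e He.
  assert (He' : 0 < e * r / 16) by (apply Rdiv_lt_0_compat; nra).
  destruct (H _ He') as [N HN]. exists (Nat.max N N0). intros n Hn w Hw.
  assert (B : Cmod (u' n w - g' w) <= 4 * (e * r / 16) / (r / 2)).
  { apply (cauchy_estimate (fun w => u n w - g w)%C (fun w => u' n w - g' w)%C); [lra|].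
    intros v Hv. assert (Hvc : Cmod (v - c) < r) by (generalize (Cmod_sub_triangle w v c); lra).
    split.
    - apply gder_minus. apply Hu; auto; lia. apply Hg; auto.
    - left. apply HN; auto; lia. }
  replace (4 * (e * r / 16) / (r / 2)) with (e / 2) in B by (field; lra). lra.
Qed.

Lemma limit_eq_at_zeros (g b : nat -> C -> C) (G : C -> C) (beta c : C) (r : R) : 0 < r ->
  uniform_near g G c r -> uniform_near b (fun _ => beta) c r -> ccont G c ->
  (forall s, 0 < s -> exists N, forall n, (N <= n)%nat -> exists w, Cmod (w - c) < s /\ g n w = b n w) ->
  G c = beta.
Proof.
  intros Hr Hg Hb HG Hz. apply Cmod_sub_lt_eq. intros e He. assert (He3 : 0 < e / 3) by lra.
  destruct (proj1 (locally_Cmod _ _) (HG _ He3)) as [d [Hd H3]].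
  destruct (Hz (Rmin r d)) as [N0 H0]; [apply Rmin_glb_lt; auto|].
  destruct (Hg _ He3) as [N1 H1], (Hb _ He3) as [N2 H2].
  set (n := Nat.max N0 (Nat.max N1 N2)).
  destruct (H0 n ltac:(lia)) as [w [Hw E]].
  destruct (Rlt_Rmin _ _ _ Hw) as [w1 w2].
  specialize (H1 n ltac:(lia) w w1). specialize (H2 n ltac:(lia) w w1). specialize (H3 w w2).
  rewrite E in H1. rewrite (Cmod_sub_comm (G w)) in H3.
  generalize (Cmod_sub_triangle (G w) (G c) beta) (Cmod_sub_triangle (b n w) (G w) beta).
  rewrite (Cmod_sub_comm (G w) (b n w)). lra.
Qed.

(** Condition (i) for [f] and a target [a], read on [g x = f (z + rho x)] and
    [b x = a (z + rho x)]. *)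
Definition rescaled_shares (g g' b : C -> C) (rho M : R) (w : C) : Prop :=
  (exists l, cderiv b w l) /\
  (g' w = RtoC rho * b w -> g w = b w)%C /\ (g w = b w -> Cmod (g' w) <= rho * M).

Definition rescaled_limit_at (g g' b : nat -> C -> C) (rho : nat -> R) (M : R) (G : C -> C)
  (beta c : C) (r : R) (N0 : nat) : Prop :=
  0 < r /\ (forall n w, (N0 <= n)%nat -> Cmod (w - c) < r -> cderiv (g n) w (g' n w) /\
    rescaled_shares (g n) (g' n) (b n) (rho n) M w) /\
  uniform_near b (fun _ => beta) c r /\ uniform_near g G c r.

(** Hurwitz requires a limit that is not identically zero near [c], which is why local vanishing of
    [G'] appears as an alternative. The term [rho n * b n] disappears in the limit because [b n]
    stays near [beta] and [rho n] tends to [0]. *)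
Lemma zero_near_or_limit (g g' b : nat -> C -> C) (rho : nat -> R) (M : R) (G G' : C -> C)
  (beta c : C) (r : R) (N0 : nat) : rescaled_limit_at g g' b rho M G beta c r N0 ->
  cvgR rho 0 -> (forall w, cderiv G w (G' w)) ->
  G' c = 0%C -> (exists s, 0 < s /\ forall w, Cmod (w - c) < s -> G' w = 0%C) \/ G c = beta.
Proof.
  intros [Hr [H [Hb Hg]]] Hrho HG Hc.
  destruct (classic (exists s, 0 < s /\ forall w, Cmod (w - c) < s -> G' w = 0%C)) as [Q|Q]; [auto|right].
  assert (Hg' : uniform_near g' G' c (r / 2)).
  { apply (uniform_near_deriv g g' G G' c r N0); auto. intros; apply H; auto. }
  apply (limit_eq_at_zeros g b G beta c r); auto; [eapply cderiv_cont, HG|].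
  intros s Hs.
  destruct (hurwitz (fun n w => g' n w - RtoC (rho n) * b n w)%C
    (fun n => C_derive (fun w => g' n w - RtoC (rho n) * b n w)%C) G' c (r / 2) N0) with (r := Rmin s (r / 2))
    as [N HN]; auto.
  - lra.
  - intros n w Hn Hw. apply cderiv_C_derive. destruct (H n w Hn ltac:(lra)) as [h1 [[l Hl] _]].
    destruct (cderiv_deriv (g n) (g' n) w (r - Cmod (w - c))) as [m Hm].
    + lra.
    + intros y Hy. apply H; auto. apply (disc_shrink w); auto.
    + eexists. apply gder_minus; [exact Hm|]. apply gder_scal; [apply ccont_id|exact Hl].
  - intros e He. assert (He2 : 0 < e / 2) by lra. assert (Kb := Cmod_ge_0 beta).
    assert (He3 : 0 < e / 2 / (Cmod beta + 1)) by (apply Rdiv_lt_0_compat; lra).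
    destruct (Hg' _ He2) as [N1 H1], (Hb 1 Rlt_0_1) as [N2 H2], (Hrho _ He3) as [N3 H3].
    exists (Nat.max N1 (Nat.max N2 N3)). intros n Hn w Hw.
    specialize (H1 n ltac:(lia) w Hw). specialize (H2 n ltac:(lia) w ltac:(lra)). specialize (H3 n ltac:(lia)).
    rewrite Rminus_0_r in H3.
    replace (g' n w - RtoC (rho n) * b n w - G' w)%C with ((g' n w - G' w) - RtoC (rho n) * b n w)%C by ring.
    eapply Rle_lt_trans; [apply Cmod_sub_le|]. rewrite Cmod_mult, Cmod_R.
    assert (H4 : Cmod (b n w) <= Cmod beta + 1) by (generalize (Cmod_le_sub (b n w) beta); lra).
    apply lt_div_mult in H3; [|lra].
    apply (Rmult_le_compat_l (Rabs (rho n))) in H4; [|apply Rabs_pos]. lra.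
  - apply ccont_of_cderiv, cderiv_deriv with G 1; [lra|auto].
  - intros t Ht. apply NNPP. intros Q2. apply Q. exists t. split; auto. intros w Hw.
    apply NNPP. intros Q3. apply Q2. exists w; auto.
  - apply Rmin_glb_lt; lra.
  - exists (Nat.max N N0). intros n Hn. destruct (HN n ltac:(lia)) as [w [Hw E]].
    destruct (Rlt_Rmin _ _ _ Hw) as [w1 w2].
    exists w. split; auto. apply (H n w ltac:(lia) ltac:(lra)).
    replace (g' n w) with (g' n w - RtoC (rho n) * b n w + RtoC (rho n) * b n w)%C by ring.
    rewrite E. ring.
Qed.

(** [G' c <> 0] serves twice: it prevents [G - beta] from vanishing identically near [c], as Hurwitz
    needs, and it contradicts [|g' n| <= rho n * M] at points tending to [c]. *)
Lemma limit_omits (g g' b : nat -> C -> C) (rho : nat -> R) (M : R) (G G' : C -> C)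
  (beta c : C) (r : R) (N0 : nat) : rescaled_limit_at g g' b rho M G beta c r N0 ->
  cvgR rho 0 -> (forall w, cderiv G w (G' w)) ->
  G' c <> 0%C -> G c <> beta.
Proof.
  intros [Hr [H [Hb Hg]]] Hrho HG Hc E. apply Hc.
  assert (CG' : ccont G' c) by (apply ccont_of_cderiv, cderiv_deriv with G 1; [lra|auto]).
  assert (Hg' : uniform_near g' G' c (r / 2)).
  { apply (uniform_near_deriv g g' G G' c r N0); auto. intros; apply H; auto. }
  assert (Z : forall s, 0 < s -> exists N, forall n, (N <= n)%nat -> exists w,
    Cmod (w - c) < s /\ (g n w - b n w = 0)%C).
  { apply (hurwitz (fun n w => g n w - b n w)%C (fun n => C_derive (fun w => g n w - b n w)%C)
      (fun w => G w - beta)%C c r N0); auto.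
    - intros n w Hn Hw. apply cderiv_C_derive. destruct (H n w Hn Hw) as [h1 [[l Hl] _]].
      eexists. apply gder_minus; [exact h1|exact Hl].
    - apply uniform_near_minus; auto.
    - apply ccont_minus. eapply cderiv_cont, HG. apply ccont_const.
    - rewrite E; ring.
    - intros s Hs. apply NNPP. intros Q. apply Hc. apply (cderiv_unique G c); auto.
      apply gder_loc with (fun _ => beta); [|apply gder_const].
      apply locally_Cmod. exists s. split; auto. intros w Hw.
      apply NNPP. intros Q2. apply Q. exists w. split; auto. apply Csub_neq_0. auto. }
  apply Cmod_sub_lt_eq. intros e He. assert (He3 : 0 < e / 3) by lra.
  destruct (proj1 (locally_Cmod _ _) (CG' _ He3)) as [d [Hd H3]].
  destruct (Z (Rmin (r / 2) d)) as [N1 H1]; [apply Rmin_glb_lt; lra|].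
  assert (He4 : 0 < e / 3 / (Rabs M + 1)) by (apply Rdiv_lt_0_compat; generalize (Rabs_pos M); lra).
  destruct (Hg' _ He3) as [N2 H2], (Hrho _ He4) as [N4 H4].
  set (n := Nat.max N0 (Nat.max N1 (Nat.max N2 N4))).
  destruct (H1 n ltac:(lia)) as [w [Hw Ew]].
  destruct (Rlt_Rmin _ _ _ Hw) as [w1 w2].
  specialize (H2 n ltac:(lia) w w1). specialize (H3 w w2). specialize (H4 n ltac:(lia)).
  destruct (H n w ltac:(lia) ltac:(lra)) as [_ [_ [_ h]]].
  assert (Egb : g n w = b n w).
  { replace (g n w) with (g n w - b n w + b n w)%C by ring. rewrite Ew; ring. }
  specialize (h Egb). rewrite Rminus_0_r in H4.
  assert (B : rho n * M < e / 3).
  { eapply Rle_lt_trans; [apply Rle_abs|]. rewrite Rabs_mult.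
    assert (M0 := Rabs_pos M). apply Rle_lt_trans with (Rabs (rho n) * (Rabs M + 1)).
    apply Rmult_le_compat_l; [apply Rabs_pos|lra].
    apply lt_div_mult in H4; [|lra]. lra. }
  replace (G' c - 0)%C with (G' c) by ring.
  generalize (Cmod_le_sub (G' c) (G' w)) (Cmod_le_sub (G' w) (g' n w)).
  rewrite (Cmod_sub_comm (G' c)), (Cmod_sub_comm (G' w) (g' n w)). lra.
Qed.

Theorem no_rescaled_limit (g g' b1 b2 : nat -> C -> C) (rho : nat -> R) (M : R) (G : C -> C) (beta1 beta2 : C) :
  (forall c, exists r N, rescaled_limit_at g g' b1 rho M G beta1 c r N /\
     rescaled_limit_at g g' b2 rho M G beta2 c r N /\
     forall n w, (N <= n)%nat -> Cmod (w - c) < r -> Cmod (g' n w) <= 4 * (1 + Cmod (g n w) ^ 2)) ->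
  cvgR rho 0 -> (forall n, 1 <= Cmod (g' n 0%C)) -> beta1 <> beta2 -> False.
Proof.
  intros H Hrho H0 Hne.
  assert (HG : forall w, cderiv G w (C_derive G w)).
  { intros c. destruct (H c) as [r [N [[Hr [H1 [_ H2]]] _]]]. apply cderiv_C_derive.
    apply (weierstrass g G c r N); auto.
    - intros n w Hn Hw. eexists. apply H1; auto.
    - intros e He. destruct (H2 e He) as [N1 HN]. exists N1. intros; apply HN; auto. }
  set (G' := C_derive G) in *.
  assert (CG' : forall c, ccont G' c).
  { intros c. apply ccont_of_cderiv, cderiv_deriv with G 1; [lra|auto]. }
  assert (Pt : forall c, cvgC (fun n => g n c) (G c) /\ cvgC (fun n => g' n c) (G' c)).
  { intros c. destruct (H c) as [r [N [[Hr [H1 [_ H2]]] _]]].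
    assert (H3 : uniform_near g' G' c (r / 2)).
    { apply (uniform_near_deriv g g' G G' c r N); auto. intros; apply H1; auto. }
    split; intros e He.
    - destruct (H2 e He) as [N1 HN]. exists N1. intros n Hn. apply HN; auto. rewrite Cmod_self; lra.
    - destruct (H3 e He) as [N1 HN]. exists N1. intros n Hn. apply HN; auto. rewrite Cmod_self; lra. }
  assert (G'0 : G' 0%C <> 0%C).
  { intros E. destruct (proj2 (Pt 0%C) 1 Rlt_0_1) as [N HN]. specialize (HN N (le_n N)).
    rewrite E in HN. replace (g' N 0 - 0)%C with (g' N 0%C) in HN by ring. generalize (H0 N); lra. }
  (* The zero set of [G'] is open, since a zero without a neighbourhood of zeros would give [G c]
     both values [beta1] and [beta2]. Its complement is open by continuity and contains [0], so
     connectedness of the plane empties it. *)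
  assert (Nz : forall c, G' c <> 0%C).
  { intros c0 Hc0.
    destruct (plane_connected (fun c => G' c = 0%C) (fun c => G' c <> 0%C)) as [z [_ [h1 h2]]]; auto.
    - apply open_Cmod. intros c Hc. destruct (H c) as [r [N [H1 [H2 _]]]].
      destruct (zero_near_or_limit g g' b1 rho M G G' beta1 c r N) as [h|h]; auto.
      destruct (zero_near_or_limit g g' b2 rho M G G' beta2 c r N) as [h'|h']; auto.
      exfalso. apply Hne. congruence.
    - apply open_Cmod. intros c Hc. apply (locally_Cmod c (fun w => G' w <> 0%C)).
      apply (ccont_nonzero G' c); auto.
    - intros z _. apply classic.
    - exists c0; auto.
    - exists 0%C; auto. }
  assert (Om : forall c, G c <> beta1 /\ G c <> beta2).
  { intros c. destruct (H c) as [r [N [H1 [H2 _]]]]. split.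
    - apply (limit_omits g g' b1 rho M G G' beta1 c r N); auto.
    - apply (limit_omits g g' b2 rho M G G' beta2 c r N); auto. }
  (* Approximation within [1] gives [|G'| <= 4 * (1 + (|G| + 1)^2) + 1 <= 13 + 8 * |G|^2]. *)
  assert (BG : forall c, Cmod (G' c) <= 13 * (1 + Cmod (G c) ^ 2)).
  { intros c. destruct (Pt c) as [P1 P2]. destruct (P1 1 Rlt_0_1) as [N1 H1], (P2 1 Rlt_0_1) as [N2 H2].
    destruct (H c) as [r [N [[Hr _] [_ H3]]]].
    set (n := Nat.max N (Nat.max N1 N2)). specialize (H1 n ltac:(lia)). specialize (H2 n ltac:(lia)).
    assert (h := H3 n c ltac:(lia) ltac:(rewrite Cmod_self; auto)).
    generalize (Cmod_le_sub (G' c) (g' n c)) (Cmod_le_sub (g n c) (G c)).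
    rewrite (Cmod_sub_comm (G' c)). intros m1 m2. assert (B0 := Cmod_ge_0 (g n c)).
    assert (Cmod (g n c) ^ 2 <= (Cmod (G c) + 1) ^ 2) by (apply pow_incr; lra).
    generalize (pow2_ge_0 (Cmod (G c) - 1)). nra. }
  assert (Hd : (beta2 - beta1 <> 0)%C) by (apply Csub_neq_0; auto).
  assert (HD : 0 < Cmod (beta2 - beta1)) by (apply Cmod_gt_0; auto).
  set (d := Cmod (beta2 - beta1)) in *.
  (* The affine map sending [beta1] to [0] and [beta2] to [1] turns [G] into a function of modulus
     [y] with [|G| <= d * y + |beta1|], whence [1 + |G|^2 <= q * (1 + y^2)]. *)
  set (q := 1 + 2 * d ^ 2 + 2 * Cmod beta1 ^ 2).
  assert (Hq : 1 <= q) by (unfold q; generalize (pow2_ge_0 d) (pow2_ge_0 (Cmod beta1)); lra).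
  apply (no_entire_omitting (fun z => (G z - beta1) / (beta2 - beta1))%C
    (fun z => G' z / (beta2 - beta1))%C (13 * q / d)).
  { apply Rdiv_lt_0_compat; lra. }
  assert (Ninv : (/ (beta2 - beta1))%C <> 0%C).
  { apply Cmod_gt_0. rewrite Cmod_inv; auto. apply Rinv_0_lt_compat; auto. }
  intros z. split; [|split; [|split; [|split]]].
  - eapply gder_eq. apply gder_div. apply ccont_id. apply gder_minus. apply HG. apply gder_const.
    apply gder_const. auto. cbv beta. field. auto.
  - apply Cmult_neq_0; auto. apply Csub_neq_0. apply Om.
  - intros E. apply (proj2 (Om z)).
    replace (G z) with ((G z - beta1) / (beta2 - beta1) * (beta2 - beta1) + beta1)%C by (field; auto).
    rewrite E. ring.
  - apply Cmult_neq_0; auto.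
  - rewrite !Cmod_div by auto. fold d.
    apply (Rmult_le_reg_r d); auto. unfold Rdiv. rewrite Rmult_assoc, Rinv_l, Rmult_1_r by lra.
    eapply Rle_trans; [apply BG|].
    assert (E : Cmod (G z) <= Cmod (G z - beta1) + Cmod beta1) by apply Cmod_le_sub.
    assert (X0 := Cmod_ge_0 (G z - beta1)). assert (X1 := Cmod_ge_0 (G z)). assert (X2 := Cmod_ge_0 beta1).
    set (x := Cmod (G z - beta1)) in *. replace x with (d * (x * / d)) in E by (field; lra).
    set (y := x * / d) in *.
    replace (13 * q * / d * (1 + y ^ 2) * d) with (13 * (q * (1 + y ^ 2))) by (field; lra).
    apply Rmult_le_compat_l; [lra|].
    assert (E2 : Cmod (G z) ^ 2 <= (d * y + Cmod beta1) ^ 2) by (apply pow_incr; lra).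
    assert (E3 : (d * y + Cmod beta1) ^ 2 <= 2 * (d ^ 2 * y ^ 2) + 2 * Cmod beta1 ^ 2).
    { generalize (pow2_ge_0 (d * y - Cmod beta1)). nra. }
    unfold q. generalize (pow2_ge_0 d) (pow2_ge_0 y) (pow2_ge_0 (Cmod beta1)).
    set (d2 := d ^ 2) in *. set (y2 := y ^ 2) in *. set (c2 := Cmod beta1 ^ 2) in *.
    clearbody d2 y2 c2. nra.
Qed.

(** * Proof of the theorem *)

(** If [x] is not in [A], the complements of the closed discs of radius [1 / (k + 1)] about [x]
    cover [A]; a finite subcover keeps [A] away from [x]. Limits of target values thus remain in [A]
    or [B]. *)
Lemma C_compact_adherent (A : C -> Prop) (x : C) : C_compact A ->
  (forall e, 0 < e -> exists a, A a /\ Cmod (a - x) < e) -> A x.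
Proof.
  intros HA Hx. apply NNPP. intros Nx.
  destruct (HA nat (fun k a => / (INR k + 1) < Cmod (a - x))) as [l Hl].
  - intros k. apply open_Cmod. intros z Hz. exists (Cmod (z - x) - / (INR k + 1)). split; [lra|].
    intros w Hw. generalize (Cmod_sub_triangle w z x). rewrite (Cmod_sub_comm z w). lra.
  - intros z Hz. assert (h : 0 < Cmod (z - x)).
    { apply Cmod_gt_0, Csub_neq_0. intros ->. auto. }
    destruct (inv_INR_lt _ h) as [k Hk]. exists k. apply Hk. auto.
  - destruct (Hx (/ (INR (list_max l) + 1))) as [a [Ha Hax]].
    { apply Rinv_0_lt_compat. generalize (pos_INR (list_max l)); lra. }
    destruct (Hl a Ha) as [k [Hk1 Hk2]].
    assert (k <= list_max l)%nat.
    { assert (F := proj1 (list_max_le l (list_max l)) (le_n _)).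
      rewrite Forall_forall in F. apply F. auto. }
    assert (/ (INR (list_max l) + 1) <= / (INR k + 1)).
    { apply Rinv_le_contravar. generalize (pos_INR k); lra. apply le_INR in H. lra. }
    lra.
Qed.

Definition shares_derivative (f a : C -> C) (M : R) (z : C) : Prop :=
  (C_derive f z = a z -> f z = a z) /\ (f z = a z -> Cmod (C_derive f z) <= M).

Definition shares_on (F : C -> Prop) (f a1 a2 : C -> C) (A B : C -> Prop) (M : R) : Prop :=
  forall z, F z -> (exists l, cderiv f z l) /\
    (exists l, cderiv a1 z l) /\ (exists l, cderiv a2 z l) /\ A (a1 z) /\ B (a2 z) /\
    shares_derivative f a1 M z /\ shares_derivative f a2 M z.

(** The function, its two targets and the rescaling data are bundled so that a single choice over
    [n] selects them together. *)
Record rescaling : Type := Rescaling {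
  fn : C -> C; target1 : C -> C; target2 : C -> C; center : C; scale : R }.

Definition rescaled_point (p : rescaling) (x : C) : C := (center p + RtoC (scale p) * x)%C.
Definition rescaled_fn (p : rescaling) (x : C) : C := fn p (rescaled_point p x).
Definition rescaled_deriv (p : rescaling) (x : C) : C :=
  (RtoC (scale p) * C_derive (fn p) (rescaled_point p x))%C.

Definition good_rescaling (A B : C -> Prop) (M : R) (z0 : C) (R k : R) (p : rescaling) : Prop :=
  shares_on (fun w => Cmod (w - z0) < 4 * R) (fn p) (target1 p) (target2 p) A B M /\
  0 < scale p /\ scale p * k <= 4 /\ Cmod (center p - z0) < 2 * R /\
  Cmod (rescaled_deriv p 0) = 1 + Cmod (rescaled_fn p 0) ^ 2 /\
  forall x, Cmod x <= R * k / 4 -> Cmod (rescaled_point p x - z0) < 2 * R /\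
    Cmod (rescaled_deriv p x) <= 4 * (1 + Cmod (rescaled_fn p x) ^ 2).

(** This lets the property indexed by [INR n + 1] pass to subsequences. *)
Lemma good_rescaling_antitone (A B : C -> Prop) (M : R) (z0 : C) (R k k' : R) (p : rescaling) :
  0 < R -> k' <= k -> good_rescaling A B M z0 R k p -> good_rescaling A B M z0 R k' p.
Proof.
  intros HR Hk [h1 [h2 [h3 [h4 [h5 h6]]]]].
  assert (R * k' <= R * k) by (apply Rmult_le_compat_l; lra).
  assert (scale p * k' <= scale p * k) by (apply Rmult_le_compat_l; lra).
  split; [auto|split; [auto|split; [lra|split; [auto|split; [auto|]]]]].
  intros x Hx. apply h6. lra.
Qed.

Lemma cderiv_rescaled (f : C -> C) (p : rescaling) (x l : C) : cderiv f (rescaled_point p x) l ->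
  cderiv (fun x => f (rescaled_point p x)) x (RtoC (scale p) * l)%C.
Proof.
  intros H. eapply gder_eq. apply (cderiv_chain f (rescaled_point p)); [|exact H].
  apply gder_plus. apply gder_const. apply gder_scal. apply ccont_id. apply gder_param. ring.
Qed.

Lemma good_rescaling_shares (a : C -> C) (M : R) (p : rescaling) (x : C) : 0 < scale p ->
  (exists l, cderiv a (rescaled_point p x) l) -> shares_derivative (fn p) a M (rescaled_point p x) ->
  rescaled_shares (rescaled_fn p) (rescaled_deriv p) (fun x => a (rescaled_point p x)) (scale p) M x.
Proof.
  intros Hs [l Hl] [s1 s2]. split; [|split].
  - eexists. apply cderiv_rescaled, Hl.
  - intros E. apply s1. unfold rescaled_deriv in E.
    apply (f_equal (Cmult (/ RtoC (scale p)))) in E.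
    rewrite !Cmult_assoc, Cinv_l, !Cmult_1_l in E by (apply RtoC_neq_0; lra). exact E.
  - intros E. unfold rescaled_deriv. rewrite Cmod_mult, Cmod_R, Rabs_pos_eq by lra.
    apply Rmult_le_compat_l; [lra|]. apply s2. exact E.
Qed.

(** Values in the unit disc and Cauchy's estimate on discs of radius [2 * R] give [a] the Lipschitz
    constant [4 / (2 * R)] on [|w - z0| < 2 * R]; at scale [rho] it is nearly constant. *)
Lemma target_near (a : C -> C) (z0 z x : C) (R rho : R) : 0 < R -> 0 < rho ->
  (forall w, Cmod (w - z0) < 4 * R -> (exists l, cderiv a w l) /\ Cmod (a w) < 1) ->
  Cmod (z - z0) < 2 * R -> Cmod (z + RtoC rho * x - z0) < 2 * R ->
  Cmod (a (z + RtoC rho * x)%C - a z) <= 2 / R * (rho * Cmod x).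
Proof.
  intros HR Hrho Ha Hz Hx.
  replace (rho * Cmod x) with (Cmod (z + RtoC rho * x - z)).
  - apply (lipschitz_of_deriv a (C_derive a) z0 (2 * R)); auto.
    intros w Hw. split; [apply cderiv_C_derive, Ha; lra|].
    replace (2 / R) with (4 * 1 / (2 * R)) by (field; lra).
    apply (cauchy_estimate a (C_derive a)); [lra|]. intros y Hy.
    assert (Cmod (y - z0) < 4 * R) by (generalize (Cmod_sub_triangle w y z0); lra).
    split; [apply cderiv_C_derive|left]; apply Ha; auto.
  - replace (z + RtoC rho * x - z)%C with (RtoC rho * x)%C by ring.
    rewrite Cmod_mult, Cmod_R, Rabs_pos_eq by lra. auto.
Qed.

Lemma rescaled_targets_cvg (A : C -> Prop) (a : nat -> C -> C) (p : nat -> rescaling)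
  (z0 beta c : C) (R r : R) : 0 < R -> (forall w, A w -> Cmod w < 1) ->
  (forall n w, Cmod (w - z0) < 4 * R -> (exists l, cderiv (a n) w l) /\ A (a n w)) ->
  (forall n, 0 < scale (p n) /\ Cmod (center (p n) - z0) < 2 * R) -> cvgR (fun n => scale (p n)) 0 ->
  (exists N, forall n x, (N <= n)%nat -> Cmod (x - c) < r -> Cmod (rescaled_point (p n) x - z0) < 2 * R) ->
  cvgC (fun n => a n (center (p n))) beta ->
  uniform_near (fun n x => a n (rescaled_point (p n) x)) (fun _ => beta) c r.
Proof.
  intros HR HA Ha Hz Hrho [N HN] Hb e He.
  set (L := Rabs (Cmod c + r) + 1). assert (HL : 0 < L) by (unfold L; generalize (Rabs_pos (Cmod c + r)); lra).
  assert (R8 : 0 < 2 / R) by (apply Rdiv_lt_0_compat; lra).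
  assert (R8L : 0 < 2 / R * L) by (apply Rmult_lt_0_compat; auto).
  destruct (Hrho (e / 2 / (2 / R * L))) as [N1 H1]; [repeat apply Rdiv_lt_0_compat; lra|].
  destruct (Hb (e / 2)) as [N2 H2]; [lra|].
  exists (Nat.max N (Nat.max N1 N2)). intros n Hn x Hx.
  destruct (Hz n) as [k1 k2]. specialize (H1 n ltac:(lia)). specialize (H2 n ltac:(lia)).
  assert (B : Cmod (a n (rescaled_point (p n) x) - a n (center (p n))) <= 2 / R * (scale (p n) * Cmod x)).
  { apply (target_near (a n) z0); auto. intros w Hw. destruct (Ha n w Hw). auto. apply HN; auto. lia. }
  assert (Lx : Cmod x <= L).
  { generalize (Cmod_le_sub x c) (Rle_abs (Cmod c + r)). unfold L. lra. }
  rewrite Rminus_0_r, Rabs_pos_eq in H1 by lra.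
  apply lt_div_mult in H1; auto.
  assert (2 / R * (scale (p n) * Cmod x) <= scale (p n) * (2 / R * L)).
  { replace (scale (p n) * (2 / R * L)) with (2 / R * (scale (p n) * L)) by ring.
    apply Rmult_le_compat_l; [lra|]. apply Rmult_le_compat_l; lra. }
  generalize (Cmod_sub_triangle (a n (center (p n))) (a n (rescaled_point (p n) x)) beta). lra.
Qed.

(** Once [|g n| > 8 / r], the function [1 / g n] is at most [r / 8] and Cauchy's estimate bounds its
    derivative at [0] by [1/2]. The normalisation makes that derivative [(1 + m^2) / m^2 > 1] in
    modulus. *)
Lemma infinite_limit_deriv (g g' : nat -> C -> C) (r : R) (N0 : nat) : 0 < r ->
  (forall n w, (N0 <= n)%nat -> Cmod w < r -> cderiv (g n) w (g' n w)) ->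
  (forall K, exists N, forall n, (N <= n)%nat -> forall w, Cmod w < r -> K < Cmod (g n w)) ->
  (forall n, Cmod (g' n 0%C) = 1 + Cmod (g n 0%C) ^ 2) -> False.
Proof.
  intros Hr H HI H0.
  destruct (HI (8 / r)) as [N HN]. set (n := Nat.max N N0). specialize (HN n ltac:(lia)).
  assert (Hq : 0 < 8 / r) by (apply Rdiv_lt_0_compat; lra).
  assert (P0 := HN 0%C ltac:(rewrite Cmod_0; auto)).
  assert (Nz : forall w, Cmod w < r -> g n w <> 0%C).
  { intros w Hw. apply Cmod_gt_0. specialize (HN w Hw). lra. }
  assert (Nz0 : g n 0%C <> 0%C) by (apply Nz; rewrite Cmod_0; auto).
  assert (B := cauchy_estimate (fun w => / g n w)%C (fun w => - g' n w / (g n w * g n w))%C 0%C r (r / 8) Hr).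
  cbv beta in B. rewrite Cmod_div, Cmod_opp, Cmod_mult, H0 in B by (apply Cmult_neq_0; auto).
  replace (4 * (r / 8) / r) with (/ 2) in B by (field; lra).
  set (m := Cmod (g n 0%C)) in *.
  assert (Q : (1 + m ^ 2) / (m * m) <= / 2).
  { apply B. intros w Hw. replace (w - 0)%C with w in Hw by ring. split.
    - apply gder_inv. apply ccont_id. apply H; auto. lia. auto.
    - rewrite Cmod_inv by auto. replace (r / 8) with (/ (8 / r)) by (field; lra).
      apply Rinv_le_contravar; auto. left; auto. }
  apply (Rmult_le_compat_r (m * m)) in Q; [|nra].
  unfold Rdiv in Q. rewrite Rmult_assoc, Rinv_l in Q by nra. nra.
Qed.

Lemma large_rescaling_index (R : R) (c : C) : 0 < R ->
  exists N, forall n x, (N <= n)%nat -> Cmod (x - c) < 1 -> Cmod x <= R * (INR n + 1) / 4.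
Proof.
  intros HR. destruct (INR_archimed R (4 * (Cmod c + 1))) as [N HN]; auto. exists N. intros n x Hn Hx.
  apply le_INR in Hn. assert (INR N * R <= INR n * R) by (apply Rmult_le_compat_r; lra).
  generalize (Cmod_le_sub x c). nra.
Qed.

Lemma good_rescalings_diverge (A B : C -> Prop) (M : R) (z0 : C) (R : R) (p : nat -> rescaling)
  (G : C -> C) (beta1 beta2 : C) : 0 < R -> C_compact A -> C_compact B ->
  (forall z, A z -> Cmod z < 1) -> (forall z, B z -> Cmod z < 1) -> (forall z, ~ (A z /\ B z)) ->
  (forall n, good_rescaling A B M z0 R (INR n + 1) (p n)) ->
  cvgC (fun n => target1 (p n) (center (p n))) beta1 ->
  cvgC (fun n => target2 (p n) (center (p n))) beta2 ->
  ~ loc_unif_cvg (fun _ => True) (fun n => rescaled_fn (p n)) G.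
Proof.
  intros HR HA HB HA1 HB1 HAB Hp Cb1 Cb2 HG.
  assert (Hs : forall n, 0 < scale (p n) /\ Cmod (center (p n) - z0) < 2 * R) by (intros n; split; apply Hp).
  assert (Crho : cvgR (fun n => scale (p n)) 0).
  { intros e He. destruct (inv_INR_lt (e / 4)) as [N HN]; [lra|]. exists N. intros n Hn.
    specialize (HN _ Hn). destruct (Hp n) as [_ [k1 [k2 _]]].
    rewrite Rminus_0_r, Rabs_pos_eq by lra. assert (Hm := pos_INR n).
    apply (Rmult_lt_compat_r (INR n + 1)) in HN; [|lra]. rewrite Rinv_l in HN by lra.
    apply (Rmult_lt_reg_r (INR n + 1)); lra. }
  assert (Lim : forall (E : C -> Prop) a beta, C_compact E -> (forall n, E (a n (center (p n)))) ->
    cvgC (fun n => a n (center (p n))) beta -> E beta).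
  { intros E a beta HE Ha Hb. apply C_compact_adherent; auto. intros e He. destruct (Hb e He) as [N HN].
    exists (a N (center (p N))). split; auto. }
  apply (no_rescaled_limit (fun n => rescaled_fn (p n)) (fun n => rescaled_deriv (p n))
    (fun n x => target1 (p n) (rescaled_point (p n) x)) (fun n x => target2 (p n) (rescaled_point (p n) x))
    (fun n => scale (p n)) M G beta1 beta2); auto.
  - intros c. destruct (HG c I) as [r0 [Hr0 H0]]. destruct (large_rescaling_index R c HR) as [N HN].
    assert (Hr : Rmin r0 1 <= r0 /\ Rmin r0 1 <= 1) by (split; [apply Rmin_l|apply Rmin_r]).
    assert (Hr1 : 0 < Rmin r0 1) by (apply Rmin_glb_lt; lra).
    assert (Sh : forall (E : C -> Prop) a beta, (forall w, E w -> Cmod w < 1) ->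
      (forall n w, Cmod (w - z0) < 4 * R -> (exists l, cderiv (a n) w l) /\ E (a n w) /\
         shares_derivative (fn (p n)) (a n) M w) ->
      cvgC (fun n => a n (center (p n))) beta ->
      rescaled_limit_at (fun n => rescaled_fn (p n)) (fun n => rescaled_deriv (p n))
        (fun n x => a n (rescaled_point (p n) x)) (fun n => scale (p n)) M G beta c (Rmin r0 1) N).
    { intros E a beta HE Ha Hb. split; [auto|split; [|split]].
      - intros n x Hn Hx. assert (Hx' := HN n x Hn ltac:(lra)).
        destruct (Hp n) as [S [k1 [_ [_ [_ H]]]]]. destruct (H x Hx') as [h1 _].
        assert (h2 : Cmod (rescaled_point (p n) x - z0) < 4 * R) by lra.
        split; [apply cderiv_rescaled, cderiv_C_derive, S; auto|].
        apply good_rescaling_shares; auto; apply Ha; auto.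
      - apply (rescaled_targets_cvg E a p z0 beta c R); auto.
        + intros n w Hw. split; apply Ha; auto.
        + exists N. intros n x Hn Hx. apply Hp, HN; auto. lra.
      - intros e He. destruct (H0 e He) as [N1 H1]. exists N1. intros n Hn w Hw. apply H1; auto. lra. }
    exists (Rmin r0 1), N.
    split; [apply (Sh A (fun n => target1 (p n)))|split; [apply (Sh B (fun n => target2 (p n)))|]]; auto;
      intros n w Hw; try (intros Hx; apply (Hp n), HN; auto; lra);
      destruct (Hp n) as [S _]; split; [|split| |split]; apply S; auto.
  - intros n. destruct (Hp n) as [_ [_ [_ [_ [-> _]]]]].
    generalize (pow2_ge_0 (Cmod (rescaled_fn (p n) 0%C))). lra.
  (* Each limit stays in its compact set, so a common limit would lie in both [A] and [B]. *)
  - intros E. apply (HAB beta1). split.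
    + apply (Lim A (fun n => target1 (p n))); auto. intros n. apply (Hp n). generalize (proj2 (Hs n)); lra.
    + rewrite E. apply (Lim B (fun n => target2 (p n))); auto. intros n. apply (Hp n).
      generalize (proj2 (Hs n)); lra.
Qed.

Theorem shares_spherically_bounded (D : C -> Prop) (F : (C -> C) -> Prop) (A B : C -> Prop) (M : R) (z0 : C) :
  open D -> D z0 -> C_compact A -> C_compact B -> (forall z, A z -> Cmod z < 1) ->
  (forall z, B z -> Cmod z < 1) -> (forall z, ~ (A z /\ B z)) ->
  (forall f, F f -> exists a1 a2, shares_on D f a1 a2 A B M) ->
  exists r K, 0 < r /\ forall f z, F f -> Cmod (z - z0) < r ->
    Cmod (C_derive f z) <= K * (1 + Cmod (f z) ^ 2).
Proof.
  intros HO Hz0 HA HB HA1 HB1 HAB HF.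
  destruct (proj1 (open_Cmod D) HO z0 Hz0) as [R4 [HR4 HD]].
  (* The disc of radius [4 * R] required by the rescaling is then exactly the one known to lie in
     [D]. *)
  set (R := R4 / 4). assert (HR : 0 < R) by (unfold R; lra).
  apply NNPP. intros Hno.
  (* The bound fails on the disc of radius [R] with each constant [INR n + 1]; a function and a
     point witnessing this failure are what [rescaling_point] starts from. *)
  destruct (functional_choice (fun n => good_rescaling A B M z0 R (INR n + 1))) as [p Hp].
  { intros n. assert (Hn := pos_INR n). apply NNPP. intros Q. apply Hno.
    exists R, (INR n + 1). split; auto. intros f w Hf Hw. apply Rnot_lt_le. intros Hbig. apply Q.
    destruct (HF f Hf) as [a1 [a2 Hs]].
    assert (Hs4 : shares_on (fun w => Cmod (w - z0) < 4 * R) f a1 a2 A B M).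
    { intros y Hy. apply Hs, HD. unfold R in Hy. lra. }
    destruct (rescaling_point f (C_derive f) z0 w R (INR n + 1)) as [z [rho [h1 [h2 [h3 [h4 h5]]]]]]; auto.
    - lra.
    - intros y Hy. apply cderiv_C_derive, Hs4; auto.
    - exists (Rescaling f a1 a2 z rho). unfold good_rescaling, rescaled_deriv, rescaled_fn, rescaled_point; simpl.
      split; [auto|split; [auto|split; [auto|split; [auto|split]]]].
      + replace (z + RtoC rho * 0)%C with z by ring. rewrite Cmod_mult, Cmod_R, Rabs_pos_eq by lra. lra.
      + intros x Hx. rewrite Cmod_mult, Cmod_R, Rabs_pos_eq by lra. rewrite (Rmult_comm rho). auto. }
  assert (Sub : forall (q : nat -> rescaling) phi, increasing_seq phi ->
    (forall n, good_rescaling A B M z0 R (INR n + 1) (q n)) ->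
    forall n, good_rescaling A B M z0 R (INR n + 1) (q (phi n))).
  { intros q phi Hphi Hq n. apply good_rescaling_antitone with (INR (phi n) + 1); auto.
    assert (Hn := le_INR _ _ (increasing_seq_ge phi Hphi n)). lra. }
  assert (C4 : forall n, Cmod (center (p n) - z0) < 4 * R).
  { intros n. destruct (Hp n) as [_ [_ [_ [h _]]]]. lra. }
  (* Two successive extractions make both targets converge at the centres; a third, from [marty] on
     the whole plane, then decides between a finite and an infinite limit of the rescaled
     functions. *)
  destruct (bounded_subsequence (fun n => target1 (p n) (center (p n))) 1) as [phi [Hphi [l1 H1]]].
  { intros n. left. apply HA1, (Hp n), C4. }
  destruct (bounded_subsequence (fun n => target2 (p (phi n)) (center (p (phi n)))) 1) as [psi [Hpsi [l2 H2]]].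
  { intros n. left. apply HB1, (Hp (phi n)), C4. }
  apply (cvgC_subseq _ _ psi Hpsi) in H1.
  set (q n := p (phi (psi n))) in *.
  assert (Hq : forall n, good_rescaling A B M z0 R (INR n + 1) (q n)).
  { intros n. apply (Sub (fun n => p (phi n)) psi); auto. }
  assert (Dq : forall r : nat -> rescaling, (forall n, good_rescaling A B M z0 R (INR n + 1) (r n)) ->
    forall n x, Cmod x <= R * (INR n + 1) / 4 -> cderiv (rescaled_fn (r n)) x (rescaled_deriv (r n) x)).
  { intros r Hr n x Hx. destruct (Hr n) as [S [_ [_ [_ [_ H]]]]]. destruct (H x Hx) as [h _].
    apply cderiv_rescaled, cderiv_C_derive, S. lra. }
  destruct (marty (fun _ => True) (fun n => rescaled_fn (q n)) (fun n => rescaled_deriv (q n)) open_true plane_connected)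
    as [om [Hom Hlim]].
  { intros c _. destruct (large_rescaling_index R c HR) as [N HN]. exists 1, 4, N. split; [lra|].
    intros n x Hn Hx. split; [apply Dq; auto|apply (Hq n); auto]. }
  assert (Hqo := Sub q om Hom Hq).
  destruct Hlim as [[G [_ HG]]|HI].
  - apply (good_rescalings_diverge A B M z0 R (fun n => q (om n)) G l1 l2); auto.
    + apply (cvgC_subseq _ _ om Hom H1).
    + apply (cvgC_subseq _ _ om Hom H2).
  - destruct (HI 0%C I) as [r0 [Hr0 H0]]. destruct (large_rescaling_index R 0%C HR) as [N HN].
    apply (infinite_limit_deriv (fun n => rescaled_fn (q (om n))) (fun n => rescaled_deriv (q (om n))) (Rmin r0 1) N).
    + apply Rmin_glb_lt; lra.
    + intros n w Hn Hw. apply (Dq (fun n => q (om n))); auto. apply HN; auto.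
      replace (w - 0)%C with w by ring. apply (Rlt_Rmin _ _ _ Hw).
    + intros K. destruct (H0 K) as [N1 HN1]. exists N1. intros n Hn w Hw. apply HN1; auto.
      replace (w - 0)%C with w by ring. apply (Rlt_Rmin _ _ _ Hw).
    + intros n. apply (Hqo n).
Qed.

Theorem theorem2p5
  (D : C -> Prop) (hD : C_domain D)
  (F : (C -> C) -> Prop)
  (hF : forall f : C -> C, F f -> holomorphic_on D f)
  (A B : C -> Prop)
  (hA : C_compact A) (hB : C_compact B)
  (hA1 : forall z : C, A z -> Cmod z < 1)
  (hB1 : forall z : C, B z -> Cmod z < 1)
  (hAB : forall z : C, ~ (A z /\ B z))
  (hA0 : ~ A (RtoC 0)) (hB0 : ~ B (RtoC 0))
  (M : R) (hM : 0 < M)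
  (h : forall f : C -> C, F f ->
    exists a1 a2 : C -> C,
      holomorphic_on D a1 /\ holomorphic_on D a2 /\
      (forall z : C, D z -> A (a1 z)) /\
      (forall z : C, D z -> B (a2 z)) /\
      (forall z : C, D z ->
        (C_derive f z = a1 z -> f z = a1 z) /\
        (f z = a1 z -> Cmod (C_derive f z) <= M)) /\
      (forall z : C, D z ->
        (C_derive f z = a2 z -> f z = a2 z) /\
        (f z = a2 z -> Cmod (C_derive f z) <= M)) /\
      (forall z : C, D z -> C_derive f z = RtoC 1 -> f z = z) /\
      (forall z : C, D z -> f z = z -> Cmod (C_derive f z) <= M)) :
  normal_family D F.
Proof.
  destruct hD as [HO [HC _]].
  assert (Hol : forall f z, ex_derive f z <-> exists l, cderiv f z l).
  { intros f z. split; intros [l Hl]; exists l; apply cderiv_is_derive; auto. }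
  assert (HS : forall f, F f -> exists a1 a2, shares_on D f a1 a2 A B M).
  { intros f Hf. destruct (h f Hf) as [a1 [a2 [h1 [h2 [h3 [h4 [h5 [h6 _]]]]]]]]. exists a1, a2.
    intros z Hz. repeat split; try apply Hol; auto; try apply (hF f Hf z Hz); try apply h5; try apply h6; auto. }
  intros u Hu.
  destruct (marty D u (fun n => C_derive (u n)) HO HC) as [phi [Hphi Hlim]].
  - intros z0 Hz0.
    destruct (shares_spherically_bounded D F A B M z0 HO Hz0 hA hB hA1 hB1 hAB HS) as [r [K [Hr HK]]].
    destruct (proj1 (open_Cmod D) HO z0 Hz0) as [d [Hd HdD]].
    exists (Rmin r d), K, O. split; [apply Rmin_glb_lt; auto|]. intros n z _ Hz. split.
    + apply cderiv_C_derive, Hol. apply (hF (u n) (Hu n)), HdD.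
      eapply Rlt_le_trans; [exact Hz|apply Rmin_r].
    + apply HK; auto. eapply Rlt_le_trans; [exact Hz|apply Rmin_l].
  - exists phi. split; auto. destruct Hlim as [[g [Hg1 Hg2]]|Hinf]; [left|right; auto].
    exists g. split; auto. intros z Hz. apply Hol; auto.
Qed.
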